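(* The set $\{\gamma_1/\gamma_2 : \gamma_1,\gamma_2 \text{ Gaussian primes}\}$ is dense in $\mathbb{C}$.
   Context: A Gaussian prime is a prime element of the ring $\mathbb{Z}[i]=\{a+bi : a,b\in\mathbb{Z}\}$ of Gaussian integers. Equivalently, a nonzero Gaussian integer is prime if and only if it is of the form $\pm p$ or $\pm pi$ with $p$ a rational prime satisfying $p\equiv 3 \pmod 4$, or it is of the form $a+bi$ with $a^2+b^2$ a rational prime. *)

(* Defs.v *)
From Stdlib Require Import Reals ZArith.

(* A Gaussian integer a+bi is represented by the pair (a,b). *)
Definition gint : Type := (Z * Z)%type.

Definition gmul (u v : gint) : gint :=
  ((fst u * fst v - snd u * snd v)%Z, (fst u * snd v + snd u * fst v)%Z).

Definition gdvd (g a : gint) : Prop := exists d : gint, a = gmul g d.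

Definition gunit (u : gint) : Prop := exists v : gint, gmul u v = (1%Z, 0%Z).

Definition gprime (p : gint) : Prop :=
  p <> (0%Z, 0%Z) /\ ~ gunit p /\
  forall a b : gint, gdvd p (gmul a b) -> gdvd p a \/ gdvd p b.

Definition gtoC (g : gint) : R * R := (IZR (fst g), IZR (snd g)).

Definition Cdiv (z w : R * R) : R * R :=
  let '(a, b) := z in let '(c, d) := w in
  ((a * c + b * d) / (c * c + d * d), (b * c - a * d) / (c * c + d * d))%R.

Definition Cdist (z w : R * R) : R :=
  sqrt ((fst z - fst w) ^ 2 + (snd z - snd w) ^ 2)%R.

(* Main.v *)
From HB Require Import structures.
From Stdlib Require Import Reals ZArith Lra Lia ClassicalEpsilon.
From Coquelicot Require Import Coquelicot.
From mathcomp Require Import all_boot zify_ssreflect.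
Require Import Defs.

(** Suppose the quotients of Gaussian primes avoid a disc.  Shrinking it, we may
    centre it at a Gaussian rational [b / g], so that [g p] and [b q] are never
    relatively close for primes [p], [q].  Three facts contradict this.

    - Mertens: the sum of [ln N(p) / N(p)] over [N(p) <= n] is [4 ln n + O(1)]
      (the four associates of a prime all count).
    - Selberg's weights [sum_(d | a) mu(d) ln^2 (n / N(d))] are nonnegative and
      large on primes.  Hence a square of side comparable to its distance from
      the origin carries at most twice its expected share of primes, and the
      same holds for the multiples [g p] and for the multiples [b q].
    - A small square cannot meet both [g P] and [b P], where [P] is the set of
      primes.

    Consequently, in a window [x < N <= M x], the masses of [g P] and of [b P]
    add up to at most [8 ln M + o(1)], which is also what Mertens gives up to
    [O(1)].  But walking along a segment from a point of [g P] to one of [b P]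
    one meets a disc of radius comparable to [sqrt x] free of both, so each
    window has a fixed deficit; adding up many consecutive windows contradicts
    Mertens. *)

Set Implicit Arguments.
Unset Strict Implicit.
Unset Printing Implicit Defensive.
Delimit Scope R_scope with R.
Open Scope R_scope.

(** Mertens fixes only the total mass of primes in annuli and says nothing about directions, while
    the sieve loses a factor two. That loss is harmless because the two sets share the squares: a
    square gives at most twice the expected mass to one of them and nothing to the other, which is
    the expected mass of both together. In numbers, the sum of [1 / N(a)] over a window is about
    [cK * ln M], the sieve allows [8 / cK] times it, and Mertens demands [4 * ln M] for each set.
    The comparison is sharp to leading order, so no constant factor may be wasted and only a further
    loss of fixed size can decide it. Hence the grid of squares is refined until its own cost is
    small against the harmonic mass of the empty disc, and only then is [x] taken large. The number
    of squares stays bounded meanwhile, and the sieve error of each is smaller than its main term by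
    a logarithm. A fixed deficit per window suffices because the error in Mertens is bounded however
    many windows are joined. *)

HB.instance Definition _ := Monoid.isComLaw.Build R 0 Rplus
  (fun x y z => esym (Rplus_assoc x y z)) Rplus_comm Rplus_0_l.
HB.instance Definition _ := Monoid.isMulLaw.Build R 0 Rmult Rmult_0_l Rmult_0_r.
HB.instance Definition _ := Monoid.isAddLaw.Build R Rmult Rplus
  Rmult_plus_distr_r Rmult_plus_distr_l.

Notation "\sum_ ( i <- r | P ) F" :=
  (\big[Rplus/R0]_(i <- r | P%B) F) : R_scope.
Notation "\sum_ ( i <- r ) F" := (\big[Rplus/R0]_(i <- r) F) : R_scope.

Lemma Zeqb_axiom : Equality.axiom Z.eqb.
Proof. by move=> x y; apply: (iffP idP) => /Z.eqb_eq. Qed.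
HB.instance Definition _ := hasDecEq.Build Z Zeqb_axiom.
HB.instance Definition _ := Equality.copy gint (Z * Z)%type.

(** Classical decision, so that [gprime] and [gdvd] can filter sequences and index big sums. *)
Definition asb (P : Prop) : bool := if excluded_middle_informative P then true else false.

Lemma asbP (P : Prop) : reflect P (asb P).
Proof. by rewrite /asb; case: excluded_middle_informative => h; constructor. Qed.

Lemma INRD m n : INR (m + n)%N = INR m + INR n. Proof. exact: plus_INR. Qed.
Lemma INRM m n : INR (m * n)%N = INR m * INR n. Proof. exact: mult_INR. Qed.
Lemma INRB m n : (n <= m)%N -> INR (m - n)%N = INR m - INR n.
Proof. by move/leP; exact: minus_INR. Qed.
Lemma INRS n : INR n.+1 = INR n + 1. Proof. exact: S_INR. Qed.
Lemma INR_le m n : (m <= n)%N -> INR m <= INR n. Proof. by move/leP; exact: le_INR. Qed.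
Lemma INR_lt m n : (m < n)%N -> INR m < INR n. Proof. by move/leP; exact: lt_INR. Qed.
Lemma INR_leE m n : INR m <= INR n -> (m <= n)%N. Proof. by move/RIneq.INR_le/leP. Qed.
Lemma INR_ltE m n : INR m < INR n -> (m < n)%N. Proof. by move/RIneq.INR_lt/ltP. Qed.
Lemma INR_ge1 n : (0 < n)%N -> 1 <= INR n. Proof. exact: (@INR_le 1). Qed.

(** * Finite real sums *)

Section Sums.
Variable I : eqType.
Implicit Types (s t : seq I) (P : pred I) (F G : I -> R).

Lemma sum_le s P F G :
  (forall i, i \in s -> P i -> F i <= G i) ->
  \sum_(i <- s | P i) F i <= \sum_(i <- s | P i) G i.
Proof.
move=> h; rewrite big_seq_cond [X in _ <= X]big_seq_cond.
apply: (big_ind2 (fun x y => x <= y)) => //; first lra.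
- by move=> *; lra.
- by move=> i /andP [hi Pi]; apply: h.
Qed.

Lemma sum_ge0 s P F :
  (forall i, i \in s -> P i -> 0 <= F i) -> 0 <= \sum_(i <- s | P i) F i.
Proof.
move=> h; rewrite big_seq_cond; apply: big_ind => [|x y|i /andP [hi Pi]].
- lra.
- lra.
- exact: h.
Qed.

Lemma Rabs_sum s P F :
  Rabs (\sum_(i <- s | P i) F i) <= \sum_(i <- s | P i) Rabs (F i).
Proof.
apply: (big_ind2 (fun x y => Rabs x <= y)) => //.
- by rewrite Rabs_R0; lra.
- move=> x1 y1 x2 y2 h1 h2.
  apply: Rle_trans (Rabs_triang _ _) _; lra.
- move=> i _; lra.
Qed.

Lemma sum_Z s P (c : R) F :
  \sum_(i <- s | P i) (c * F i) = c * \sum_(i <- s | P i) F i.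
Proof. by rewrite big_distrr. Qed.

Lemma sum_Zr s P (c : R) F :
  \sum_(i <- s | P i) (F i * c) = (\sum_(i <- s | P i) F i) * c.
Proof. by rewrite big_distrl. Qed.

Lemma sum_add s P F G :
  \sum_(i <- s | P i) (F i + G i) = \sum_(i <- s | P i) F i + \sum_(i <- s | P i) G i.
Proof. by rewrite big_split. Qed.

Lemma sum_sub s P F G :
  \sum_(i <- s | P i) (F i - G i) = \sum_(i <- s | P i) F i - \sum_(i <- s | P i) G i.
Proof.
rewrite (eq_bigr (fun i => F i + (-1) * G i)); last by move=> i _; ring.
by rewrite sum_add sum_Z; ring.
Qed.

Lemma sum_const s (c : R) : \sum_(i <- s) c = INR (size s) * c.
Proof.
elim: s => [|x s IH]; first by rewrite big_nil /=; ring.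
by rewrite big_cons IH -[size (x :: s)]/(size s).+1 S_INR /=; ring.
Qed.

Lemma sum_eq s P F G :
  (forall i, i \in s -> P i -> F i = G i) ->
  \sum_(i <- s | P i) F i = \sum_(i <- s | P i) G i.
Proof.
move=> h; rewrite big_seq_cond [RHS]big_seq_cond.
by apply: eq_bigr => i /andP [? ?]; apply: h.
Qed.

Lemma sum_le_pred s P (Q : pred I) F :
  (forall i, i \in s -> P i -> Q i) ->
  (forall i, i \in s -> Q i -> 0 <= F i) ->
  \sum_(i <- s | P i) F i <= \sum_(i <- s | Q i) F i.
Proof.
move=> hPQ hF; rewrite big_mkcond [X in _ <= X]big_mkcond; apply: sum_le => i hi _.
case hP : (P i); first by rewrite (hPQ i hi hP); lra.
by case hQ : (Q i); [apply: hF | lra].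
Qed.

Lemma sum_le_subset s t F : uniq s -> {subset s <= t} ->
  (forall i, i \in t -> 0 <= F i) -> \sum_(i <- s) F i <= \sum_(i <- t) F i.
Proof.
elim: s t => [|x s IH] t /=.
  by move=> _ _ h; rewrite big_nil; apply: sum_ge0 => i hi _; apply: h.
move=> /andP [hx us] hs hF.
have hxt : x \in t by apply: hs; rewrite inE eqxx.
rewrite big_cons (perm_big _ (perm_to_rem hxt)) /= big_cons.
apply: Rplus_le_compat_l; apply: IH => //.
- move=> y hy; have hyt : y \in t by apply: hs; rewrite inE hy orbT.
  have := perm_mem (perm_to_rem hxt) y; rewrite hyt inE => /esym/orP [/eqP e|//].
  by move: hx; rewrite -e hy.
- by move=> i /mem_rem; apply: hF.
Qed.

End Sums.

(** One preimage for each element of [s] is enough: further or repeated values of [phi] only enlarge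
    the right side. *)
Lemma sum_le_image (I J : eqType) (s : seq I) (t : seq J) (phi : J -> I) (F : I -> R) :
  uniq s -> (forall i, i \in s -> exists2 j, j \in t & i = phi j) ->
  (forall j, j \in t -> 0 <= F (phi j)) ->
  \sum_(i <- s) F i <= \sum_(j <- t) F (phi j).
Proof.
move=> us h hF; rewrite -(big_map phi xpredT F); apply: sum_le_subset => //.
- by move=> i /h [j hj ->]; apply: map_f.
- by move=> i /mapP [j hj ->]; apply: hF.
Qed.

(** * Gaussian integers *)

Definition gadd (a b : gint) : gint := ((fst a + fst b)%Z, (snd a + snd b)%Z).
Definition gsub (a b : gint) : gint := ((fst a - fst b)%Z, (snd a - snd b)%Z).
Definition gconj (a : gint) : gint := (fst a, (- snd a)%Z).
Definition gnorm (a : gint) : Z := (fst a * fst a + snd a * snd a)%Z.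
Definition g0 : gint := (0%Z, 0%Z).
Definition g1 : gint := (1%Z, 0%Z).

Ltac gring := rewrite /gmul /gadd /gsub /gconj /g0 /g1; cbn [fst snd];
  first [ ring | f_equal; ring ].

Lemma gmulC a b : gmul a b = gmul b a. Proof. by gring. Qed.
Lemma gmulA a b c : gmul a (gmul b c) = gmul (gmul a b) c. Proof. by gring. Qed.
Lemma gmulCA a b c : gmul a (gmul b c) = gmul b (gmul a c). Proof. by gring. Qed.
Lemma gmul1 a : gmul g1 a = a. Proof. case: a => x y; gring. Qed.
Lemma gmulr1 a : gmul a g1 = a. Proof. case: a => x y; gring. Qed.
Lemma gmul0 a : gmul a g0 = g0. Proof. case: a => x y; gring. Qed.
Lemma gmul0l a : gmul g0 a = g0. Proof. case: a => x y; gring. Qed.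

Lemma gnormM a b : gnorm (gmul a b) = (gnorm a * gnorm b)%Z.
Proof. rewrite /gnorm /gmul /=; ring. Qed.
Lemma gnorm_ge0 a : (0 <= gnorm a)%Z. Proof. rewrite /gnorm; nia. Qed.
Arguments gnorm_ge0 : clear implicits.
Lemma gnorm_eq0 a : gnorm a = 0%Z -> a = g0.
Proof.
case: a => x y; rewrite /gnorm /g0 /= => h.
have -> : x = 0%Z by nia.
by have -> : y = 0%Z by nia.
Qed.
Lemma gnorm_gt0 a : a <> g0 -> (0 < gnorm a)%Z.
Proof.
move=> h; have := gnorm_ge0 a; have : gnorm a <> 0%Z by move/gnorm_eq0. lia.
Qed.
Lemma gnorm_gt0N a : (0 < gnorm a)%Z -> a <> g0.
Proof. by move=> h e; move: h; rewrite e. Qed.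
Lemma gmul_neq0 a b : a <> g0 -> b <> g0 -> gmul a b <> g0.
Proof.
move=> /gnorm_gt0 ha /gnorm_gt0 hb; apply: gnorm_gt0N; rewrite gnormM; nia.
Qed.
Lemma gmul_neq0l a b : gmul a b <> g0 -> a <> g0.
Proof. by move=> h e; apply: h; rewrite e gmul0l. Qed.
Lemma gmul_neq0r a b : gmul a b <> g0 -> b <> g0.
Proof. by move=> h e; apply: h; rewrite e gmul0. Qed.

Lemma gmulI a b c : a <> g0 -> gmul a b = gmul a c -> b = c.
Proof.
move=> /gnorm_gt0 ha h.
have : gnorm (gsub b c) = 0%Z.
  have : gnorm (gmul a (gsub b c)) = 0%Z.
    have -> : gmul a (gsub b c) = gsub (gmul a b) (gmul a c) by gring.
    by rewrite h /gnorm /gsub /= !Z.sub_diag.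
  rewrite gnormM; nia.
move/gnorm_eq0; case: b c {h} => [x y] [u v]; rewrite /gsub /g0 /= => - [h1 h2].
by f_equal; lia.
Qed.

Lemma gunitP u : gunit u <-> gnorm u = 1%Z.
Proof.
split=> [[v h]|h].
  have : (gnorm u * gnorm v = 1)%Z by rewrite -gnormM h.
  move=> /Z.mul_eq_1; have := gnorm_ge0 u; lia.
exists (gconj u); move: h; case: u => x y; rewrite /gnorm /gmul /gconj /= => h.
by f_equal; lia.
Qed.

Definition gunits : seq gint := [:: (1, 0)%Z; (-1, 0)%Z; (0, 1)%Z; (0, -1)%Z].

Lemma mem_gunits u : (u \in gunits) = (gnorm u == 1%Z).
Proof.
apply/idP/eqP; first by rewrite !inE => /or4P [] /eqP ->.
case: u => x y; rewrite /gnorm /= => h.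
have hx : (x = 0 \/ x = 1 \/ x = -1)%Z by have : (-1 <= x <= 1)%Z; [nia | lia].
have hy : (y = 0 \/ y = 1 \/ y = -1)%Z by have : (-1 <= y <= 1)%Z; [nia | lia].
by move: h; case: hx => [|[|]] ->; case: hy => [|[|]] -> h; rewrite ?inE //; exfalso; lia.
Qed.

(** * Divisibility, the Euclidean algorithm and primes *)

Lemma gdvd_refl a : gdvd a a. Proof. by exists g1; rewrite gmulr1. Qed.
Lemma gdvd_trans a b c : gdvd a b -> gdvd b c -> gdvd a c.
Proof. by move=> [x ->] [y ->]; exists (gmul x y); rewrite gmulA. Qed.
Lemma gdvd_mulr a b c : gdvd a b -> gdvd a (gmul b c).
Proof. by move=> [x ->]; exists (gmul x c); rewrite gmulA. Qed.
Lemma gdvd_mull a b c : gdvd a b -> gdvd a (gmul c b).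
Proof. by move=> h; rewrite gmulC; apply: gdvd_mulr. Qed.
Lemma gdvd_add a b c : gdvd a b -> gdvd a c -> gdvd a (gadd b c).
Proof. by move=> [x ->] [y ->]; exists (gadd x y); gring. Qed.
Lemma gdvd_sub a b c : gdvd a b -> gdvd a c -> gdvd a (gsub b c).
Proof. by move=> [x ->] [y ->]; exists (gsub x y); gring. Qed.
Lemma gdvd_mul2l a b c : a <> g0 -> gdvd (gmul a b) (gmul a c) -> gdvd b c.
Proof. by move=> ha [x]; rewrite -gmulA => /(gmulI ha) ->; exists x. Qed.
Lemma gdvd_mul2 a b c : gdvd b c -> gdvd (gmul a b) (gmul a c).
Proof. by move=> [x ->]; exists x; rewrite gmulA. Qed.
Lemma gdvd_norm_le a b : b <> g0 -> gdvd a b -> (gnorm a <= gnorm b)%Z.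
Proof.
move=> hb [x e]; move: hb; rewrite e gnormM => hb.
have := gnorm_gt0 (gmul_neq0r hb); have := gnorm_ge0 a; nia.
Qed.
Lemma gdvd_neq0 a b : b <> g0 -> gdvd a b -> a <> g0.
Proof. by move=> hb [x e] ea; apply: hb; rewrite e ea gmul0l. Qed.
Lemma gunit_dvd u a : gunit u -> gdvd u a.
Proof. by move=> [v e]; exists (gmul v a); rewrite gmulA e gmul1. Qed.
Lemma gdvd_unit u a : gunit u -> gdvd a u -> gunit a.
Proof.
move=> [v e] [x h]; exists (gmul x v); by rewrite gmulA -h e.
Qed.

Lemma geuclid a b : b <> g0 -> exists q, (gnorm (gsub a (gmul b q)) < gnorm b)%Z.
Proof.
move=> hb; have hn := gnorm_gt0 hb; set n := gnorm b in hn *.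
(* The quotient [a / b] is [c / n], and [(2 c + n) / (2 n)] rounds [c / n] to a nearest integer.
   Both coordinates are off by at most 1/2, so the remainder has norm at most [n / 2]. *)
set c := gmul a (gconj b); set q1 := ((2 * fst c + n) / (2 * n))%Z.
set q2 := ((2 * snd c + n) / (2 * n))%Z; exists (q1, q2).
have h1 := Z.div_mod (2 * fst c + n) (2 * n) ltac:(lia).
have h2 := Z.div_mod (2 * snd c + n) (2 * n) ltac:(lia).
have r1 := Z.mod_pos_bound (2 * fst c + n) (2 * n) ltac:(lia).
have r2 := Z.mod_pos_bound (2 * snd c + n) (2 * n) ltac:(lia).
rewrite -/q1 in h1; rewrite -/q2 in h2.
set m1 := ((2 * fst c + n) mod (2 * n))%Z in h1 r1.
set m2 := ((2 * snd c + n) mod (2 * n))%Z in h2 r2.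
have key : (gnorm (gsub a (gmul b (q1, q2))) * n =
  (fst c - n * q1) * (fst c - n * q1) + (snd c - n * q2) * (snd c - n * q2))%Z.
  rewrite /c /n /gnorm /gsub /gmul /gconj /=; ring.
have e1 : (2 * (fst c - n * q1) = m1 - n)%Z by lia.
have e2 : (2 * (snd c - n * q2) = m2 - n)%Z by lia.
move: key e1 e2; set g := gnorm _; set u := (fst c - n * q1)%Z; set v := (snd c - n * q2)%Z.
move=> key e1 e2; have : (4 * (u * u) <= n * n)%Z by nia.
have : (4 * (v * v) <= n * n)%Z by nia. nia.
Qed.

Lemma gbezout a b : exists g x y,
  [/\ g = gadd (gmul x a) (gmul y b), gdvd g a & gdvd g b].
Proof.
have [n hn] : exists n : nat, (gnorm b < Z.of_nat n)%Z.
  exists (Z.to_nat (gnorm b)).+1; have := gnorm_ge0 b; lia.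
elim: n a b hn => [|n IH] a b hn; first by have := gnorm_ge0 b; lia.
case: (excluded_middle_informative (b = g0)) => [->|hb].
  exists a, g1, g0; split; first by rewrite gmul1 gmul0 /gadd /g0; case: a => x y /=; f_equal; lia.
  - exact: gdvd_refl.
  - by exists g0; rewrite gmul0.
have [q hq] := geuclid a hb.
have [|g [x [y [e h1 h2]]]] := IH b (gsub a (gmul b q)) _; first lia.
exists g, y, (gsub x (gmul y q)); split => //.
  rewrite e; gring.
have -> : a = gadd (gsub a (gmul b q)) (gmul b q) by case: (a) => ? ?; gring.
by apply: gdvd_add => //; apply: gdvd_mulr.
Qed.

(** Induction on the norm. A nonunit without nonunit divisors of smaller norm is itself prime: if it
    divides [b c], its gcd with [b] is either a unit, and Bezout gives that it divides [c], or an
    associate of [a], and then [a] divides [b]. *)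
Lemma exists_prime_divisor a : a <> g0 -> ~ gunit a -> exists2 p, gprime p & gdvd p a.
Proof.
have [n hn] : exists n : nat, (gnorm a < Z.of_nat n)%Z.
  exists (Z.to_nat (gnorm a)).+1; have := gnorm_ge0 a; lia.
elim: n a hn => [|n IH] a hn ha hu; first by have := gnorm_ge0 a; lia.
case: (excluded_middle_informative
  (exists d, [/\ gdvd d a, ~ gunit d & (gnorm d < gnorm a)%Z])) => [[d [h1 h2 h3]]|hmin].
  have [|||p pp pd] := IH d _ _ _ => //; [lia | exact: gdvd_neq0 h1 |].
  by exists p => //; apply: gdvd_trans h1.
exists a; last exact: gdvd_refl.
split=> //; split=> // b c hbc.
have [g [x [y [e [w h1] h2]]]] := gbezout a b.
case: (excluded_middle_informative (gunit g)) => hg; [right|left].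
  have [v hv] := hg.
  have -> : c = gadd (gmul a (gmul c (gmul v x))) (gmul (gmul b c) (gmul v y)).
    rewrite -[LHS]gmul1 -[g1]/(1%Z, 0%Z) -hv e; gring.
  apply: gdvd_add; first exact/gdvd_mulr/gdvd_refl.
  exact: gdvd_mulr.
have hga : (gnorm a <= gnorm g)%Z.
  apply/Z.nlt_ge => hlt; apply: hmin; exists g; split=> //; by exists w.
have [w' hw'] : gunit w.
  apply/gunitP; move: (ha); rewrite h1 => hgw; move: hga; rewrite h1 gnormM.
  have := gnorm_gt0 (gmul_neq0l hgw); have := gnorm_gt0 (gmul_neq0r hgw); nia.
apply: gdvd_trans h2; exists w'; by rewrite h1 -gmulA hw' gmulr1.
Qed.

Lemma gprime_neq0 p : gprime p -> p <> g0. Proof. by case. Qed.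
Lemma gprime_not_unit p : gprime p -> ~ gunit p. Proof. by case=> _ []. Qed.
Lemma gprime_dvdM p a b : gprime p -> gdvd p (gmul a b) -> gdvd p a \/ gdvd p b.
Proof. by case=> _ [] _; apply. Qed.
Lemma gprime_norm p : gprime p -> (2 <= gnorm p)%Z.
Proof.
move=> h; have := gnorm_gt0 (gprime_neq0 h).
have : gnorm p <> 1%Z by move/gunitP/(gprime_not_unit h). lia.
Qed.

Lemma gprime_dvd_prime p q : gprime p -> gprime q -> gdvd q p -> gdvd p q.
Proof.
move=> hp hq [e h].
have : gdvd p (gmul q e) by rewrite -h; apply: gdvd_refl.
case/(gprime_dvdM hp) => // - [f hf].
case: (gprime_not_unit hq); exists f.
apply: (gmulI (gprime_neq0 hp)); by rewrite -[(1%Z,0%Z)]/g1 gmulr1 {2}h hf gmulCA.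
Qed.

Lemma gprime_unit_mul p u : gprime p -> gunit u -> gprime (gmul u p).
Proof.
move=> hp hu; have [v huv] := hu.
have hdv : forall x, gdvd (gmul u p) x <-> gdvd p x.
  move=> x; split=> [|[y ->]].
    by apply: gdvd_trans; apply/gdvd_mull/gdvd_refl.
  exists (gmul v y); rewrite -[LHS]gmul1 -[g1]/(1%Z, 0%Z) -huv; gring.
split; last split.
- apply: gmul_neq0; last exact: gprime_neq0.
  move=> e; move/gunitP: hu; by rewrite e.
- move/gunitP; rewrite gnormM (proj1 (gunitP u) hu) Z.mul_1_l => /gunitP.
  exact: gprime_not_unit.
- by move=> a b; rewrite !hdv; apply: gprime_dvdM.
Qed.

(** * Splitting off the power of one prime *)

Definition gpow (p : gint) (k : nat) : gint := iter k (gmul p) g1.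

Lemma gpowS p k : gpow p k.+1 = gmul p (gpow p k). Proof. by []. Qed.

Lemma gfactor_prime p a : gprime p -> a <> g0 ->
  exists k m, a = gmul (gpow p k) m /\ ~ gdvd p m.
Proof.
move=> hp; have [n hn] : exists n : nat, (gnorm a < Z.of_nat n)%Z.
  exists (Z.to_nat (gnorm a)).+1; have := gnorm_ge0 a; lia.
elim: n a hn => [|n IH] a hn ha; first by have := gnorm_ge0 a; lia.
case: (excluded_middle_informative (gdvd p a)) => [[b e]|h]; last first.
  by exists 0%nat, a; rewrite /= gmul1.
have hb : b <> g0 by move=> eb; apply: ha; rewrite e eb gmul0.
have [||k [m [eb hm]]] := IH b _ _ => //.
  have := gprime_norm hp; have := gnorm_gt0 hb; move: hn; rewrite e gnormM; nia.
by exists k.+1, m; rewrite gpowS -gmulA -eb.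
Qed.

(** Cancellation of one prime at a time; together with [gfactor_prime] it plays the part of unique
    factorization. *)
Lemma gauss_prime p e x : gprime p -> ~ gdvd p e -> gdvd e (gmul p x) -> gdvd e x.
Proof.
move=> hp he [f h].
have : gdvd p (gmul e f) by rewrite -h; apply/gdvd_mulr/gdvd_refl.
case/(gprime_dvdM hp) => // - [f' hf]; exists f'.
by apply: (gmulI (gprime_neq0 hp)); rewrite h hf gmulCA.
Qed.

Lemma gauss_prime_pow p e k x : gprime p -> ~ gdvd p e ->
  gdvd e (gmul (gpow p k) x) -> gdvd e x.
Proof.
move=> hp he; elim: k => [|k IH]; first by rewrite /= gmul1.
by rewrite gpowS -gmulA => /(gauss_prime hp he)/IH.
Qed.

(** * Balls and the Möbius function *)

Definition gn (a : gint) : nat := Z.to_nat (gnorm a).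
Definition rn (a : gint) : R := INR (gn a).

Lemma gnE a : Z.of_nat (gn a) = gnorm a.
Proof. rewrite /gn Z2Nat.id //; exact: gnorm_ge0. Qed.
Lemma gnM a b : gn (gmul a b) = (gn a * gn b)%N.
Proof. by have := gnE (gmul a b); have := gnE a; have := gnE b; rewrite gnormM; nia. Qed.
Lemma rnM a b : rn (gmul a b) = rn a * rn b.
Proof. by rewrite /rn gnM mult_INR. Qed.
Lemma gn_gt0 a : a <> g0 <-> (0 < gn a)%N.
Proof.
split=> [/gnorm_gt0|h e]; first by have := gnE a; lia.
by move: h; rewrite e.
Qed.
Lemma rn_ge1 a : a <> g0 -> 1 <= rn a.
Proof. by move/gn_gt0 => h; rewrite /rn -[1]/(INR 1); apply: le_INR; lia. Qed.
Lemma gn_dvd_le a b : b <> g0 -> gdvd a b -> (gn a <= gn b)%N.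
Proof. by move=> hb h; have := gdvd_norm_le hb h; have := gnE a; have := gnE b; lia. Qed.
Lemma gn_unit u : gunit u <-> gn u = 1%N.
Proof. by rewrite gunitP; have := gnE u; lia. Qed.

Definition zsym (m : nat) : seq Z := [seq (Z.of_nat i - Z.of_nat m)%Z | i <- iota 0 (m + m).+1].

Lemma mem_zsym m x : (x \in zsym m) = (Z.abs x <=? Z.of_nat m)%Z.
Proof.
apply/mapP/Z.leb_spec0 => [[i]|h].
  rewrite mem_iota => hi ->; lia.
exists (Z.to_nat (x + Z.of_nat m)); last lia.
rewrite mem_iota; lia.
Qed.
Lemma uniq_zsym m : uniq (zsym m).
Proof. by rewrite map_inj_uniq ?iota_uniq // => i j; lia. Qed.

Definition zbox (m : nat) : seq gint := [seq (x, y) | x <- zsym m, y <- zsym m].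
Lemma mem_zbox m a : (a \in zbox m) = (fst a \in zsym m) && (snd a \in zsym m).
Proof.
apply/allpairsP/andP => [[[x y] [/= hx hy ->]] //|[h1 h2]].
by exists a; split=> //; case: (a).
Qed.
Lemma uniq_zbox m : uniq (zbox m).
Proof. by apply: allpairs_uniq; rewrite ?uniq_zsym // => - [a b] [c d] _ _ /= ->. Qed.

Definition sphere (k : nat) : seq gint := [seq a <- zbox k | gn a == k].
Lemma mem_sphere k a : (a \in sphere k) = (gn a == k).
Proof.
rewrite mem_filter; case: eqP => //= h; rewrite mem_zbox !mem_zsym.
have := gnE a; rewrite h /gnorm; case: (a) => x y /= e; apply/andP; split; nia.
Qed.
Lemma uniq_sphere k : uniq (sphere k).
Proof. by apply: filter_uniq; apply: uniq_zbox. Qed.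

Fixpoint ball (n : nat) : seq gint :=
  if n is n'.+1 then ball n' ++ sphere n else [::].

Lemma mem_ball n a : (a \in ball n) = (0 < gn a <= n)%N.
Proof.
elim: n => [|n IH] /=; first by rewrite in_nil; lia.
rewrite mem_cat IH mem_sphere; lia.
Qed.
Lemma uniq_ball n : uniq (ball n).
Proof.
elim: n => [|n IH] //=; rewrite cat_uniq IH uniq_sphere andbT /=.
apply/hasPn => a; rewrite mem_sphere mem_ball; lia.
Qed.
Lemma ball_neq0 n a : a \in ball n -> a <> g0.
Proof. by rewrite mem_ball => h; apply/gn_gt0; lia. Qed.

Lemma reindex_ball n d (P : pred gint) (F : gint -> R) : d <> g0 ->
  \sum_(a <- ball n | asb (gdvd d a) && P a) F a =
  \sum_(e <- ball (n %/ gn d) | P (gmul d e)) F (gmul d e).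
Proof.
move=> hd; rewrite -(big_map (gmul d) P F) -big_filter -[RHS]big_filter.
apply: perm_big; apply: uniq_perm.
- by apply: filter_uniq; apply: uniq_ball.
- apply: filter_uniq; rewrite map_inj_in_uniq ?uniq_ball // => x y _ _; exact: gmulI.
have hn := proj1 (gn_gt0 d) hd.
move=> a; rewrite !mem_filter mem_ball; case: (P a); rewrite ?andbF //= andbT.
apply/andP/mapP => [[/asbP [e ->] h]|[e]].
  exists e => //; rewrite mem_ball leq_divRL //; move: h; rewrite gnM; nia.
rewrite mem_ball leq_divRL // => h ->; split; first by apply/asbP; exists e.
rewrite gnM; nia.
Qed.

(** * Squarefree elements and the Möbius function *)

Definition sqfree (a : gint) : Prop := forall p, gprime p -> ~ gdvd (gmul p p) a.
(** The half-open first quadrant: it contains exactly one of the four associates of every nonzero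
    element. *)
Definition grep (p : gint) : bool := (0 <? fst p)%Z && (0 <=? snd p)%Z.
Definition pdivs (a : gint) : seq gint :=
  [seq p <- ball (gn a) | [&& asb (gprime p), grep p & asb (gdvd p a)]].
(* Primes are counted through their associate in the quadrant [grep]. *)
Definition mu (a : gint) : R := if asb (sqfree a) then (-1) ^ size (pdivs a) else 0.

Lemma mem_pdivs a p : a <> g0 ->
  (p \in pdivs a) = [&& asb (gprime p), grep p & asb (gdvd p a)].
Proof.
move=> ha; rewrite mem_filter andbC mem_ball.
apply: andb_idl => /and3P [/asbP h1 _ /asbP h2]; apply/andP; split.
  by apply/gn_gt0; apply: gprime_neq0.
exact: gn_dvd_le.
Qed.

Lemma Rabs_mu a : Rabs (mu a) <= 1.
Proof.
rewrite /mu; case: asb; last by rewrite Rabs_R0; lra.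
by rewrite pow_1_abs; lra.
Qed.

Lemma mu_unit u : gunit u -> mu u = 1.
Proof.
move=> hu; have h p : gprime p -> ~ gdvd p u.
  by move=> hp /(gdvd_unit hu) /(gprime_not_unit hp).
have hu0 : u <> g0 by apply/gn_gt0; rewrite (proj1 (gn_unit u) hu).
rewrite /mu; have -> : asb (sqfree u).
  apply/asbP => p hp /(gdvd_trans _) hd; apply: (h p hp); apply: hd.
  exact/gdvd_mulr/gdvd_refl.
suff -> : pdivs u = [::] by [].
apply/eqP; rewrite -size_eq0 -leqn0 leqNgt; apply/negP.
rewrite -has_predT => /hasP [p]; rewrite mem_pdivs // => /and3P [/asbP hp _ /asbP] hd _.
exact: h hd.
Qed.

Lemma mu_sq p d : gprime p -> gdvd (gmul p p) d -> mu d = 0.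
Proof.
move=> hp hd; rewrite /mu; case: asbP => // h; case: (h p hp hd).
Qed.

Lemma grep_exists a : a <> g0 -> exists2 u, gunit u & grep (gmul u a).
Proof.
case: a => x y h; have hn : (x <> 0 \/ y <> 0)%Z.
  case: (Z.eq_dec x 0) => [hx|]; last by left.
  right=> hy; apply: h; by rewrite hx hy.
have hu u : u \in gunits -> gunit u by rewrite mem_gunits => /eqP /gunitP.
have hc : (0 < x /\ 0 <= y \/ x < 0 /\ y <= 0 \/ y < 0 /\ 0 <= x \/ 0 < y /\ x <= 0)%Z by lia.
case: hc => [|[|[|]]] hc; [exists (1,0)%Z|exists (-1,0)%Z|exists (0,1)%Z|exists (0,-1)%Z];
  (try by apply: hu; rewrite !inE); rewrite /grep /gmul; cbn [fst snd]; apply/andP; split; lia.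
Qed.

Lemma grep_unique u a : gunit u -> grep a -> grep (gmul u a) -> gmul u a = a.
Proof.
case: a => x y /gunitP/eqP; rewrite -mem_gunits !inE.
case/or4P => /eqP -> /andP [] /=; rewrite /grep /gmul; cbn [fst snd] => h1 h2 /andP [h3 h4];
 f_equal; lia.
Qed.

Lemma gprime_assoc p q : gprime p -> gprime q -> gdvd p q ->
  exists2 u, gunit u & p = gmul u q.
Proof.
move=> hp hq h1; have [v ev] := gprime_dvd_prime hq hp h1.
have [w ew] := h1; exists v; last by rewrite ev gmulC.
exists w; apply: (gmulI (gprime_neq0 hq)).
rewrite -[(1%Z, 0%Z)]/g1 gmulr1 gmulA -ev; by rewrite -ew.
Qed.

(** With [mu_unit], [mu_sq] and the bound [Rabs_mu], this is everything that the divisor sums use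
    about [mu]. *)
Lemma mu_prime p d : gprime p -> d <> g0 -> ~ gdvd p d -> mu (gmul p d) = - mu d.
Proof.
move=> hp hd hpd; have hp0 := gprime_neq0 hp; have hpd0 := gmul_neq0 hp0 hd.
have -> : mu (gmul p d) = if asb (sqfree d) then (-1) ^ size (pdivs (gmul p d)) else 0.
  rewrite /mu; have -> // : asb (sqfree (gmul p d)) = asb (sqfree d).
  apply/asbP/asbP => h q hq hqd; first by apply: (h q hq); apply: gdvd_mull.
  case: (excluded_middle_informative (gdvd p q)) => hpq.
    apply: hpd; apply: (gdvd_mul2l hp0); apply: gdvd_trans hqd.
    by apply: (gdvd_trans (b := gmul p q)); [exact: gdvd_mul2 | rewrite gmulC; exact: gdvd_mul2].
  apply: (h q hq); apply: (gauss_prime hp) hqd.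
  by case/(gprime_dvdM hp).
rewrite /mu; case: asbP => [_|_]; last lra.
(* The divisor gained by passing from [d] to [p d] is not [p] itself but its associate in the
   quadrant. *)
have [u hu hup] := grep_exists hp0.
suff /perm_size -> : perm_eq (pdivs (gmul p d)) (gmul u p :: pdivs d) by rewrite /=; ring.
have hpu := gprime_unit_mul hp hu.
have hdu : gdvd (gmul u p) p.
  have [v huv] := hu; exists v.
  by rewrite -[LHS]gmul1 -[g1]/(1%Z, 0%Z) -huv; gring.
apply: uniq_perm.
- by apply: filter_uniq; apply: uniq_ball.
- rewrite /= filter_uniq ?uniq_ball // andbT mem_pdivs //; apply/negP => /and3P [_ _ /asbP].
  move=> h; apply: hpd; apply: gdvd_trans h; exact/gdvd_mull/gdvd_refl.
move=> q; rewrite inE !mem_pdivs //; apply/and3P/orP.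
  move=> [/asbP hq rq /asbP hqpd].
  case/(gprime_dvdM hq): hqpd => h; [left|right].
    have [v hv ev] := gprime_assoc hq hp h.
    have [w hw] := hu.
    have huq : gunit (gmul v w).
      apply/gunitP; move/gunitP: hv => hv; rewrite gnormM hv.
      have /gunitP -> // : gunit w by exists u; rewrite gmulC.
    have e : q = gmul (gmul v w) (gmul u p).
      by rewrite ev -[p in LHS]gmul1 -[g1]/(1%Z, 0%Z) -hw; gring.
    apply/eqP; rewrite e; apply: grep_unique => //; by rewrite -e.
  by apply/and3P; split=> //; apply/asbP.
case=> [/eqP ->|/and3P [h1 h2 /asbP h3]].
  by split=> //; apply/asbP => //; apply: gdvd_mulr.
by split=> //; apply/asbP; apply: gdvd_mull.
Qed.

(** Divisors run over all associates, whence the factors 4 below. For [G t = L - ln t] this is four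
    times von Mangoldt's function away from the units; for [(L - ln t) ^ 2] it is Selberg's
    weight. *)
Definition dsum (G : R -> R) (a : gint) : R :=
  \sum_(d <- ball (gn a) | asb (gdvd d a)) (mu d * G (rn d)).

Lemma dsum_ball n a (F : gint -> R) : a <> g0 -> (gn a <= n)%N ->
  \sum_(d <- ball n | asb (gdvd d a)) F d = \sum_(d <- ball (gn a) | asb (gdvd d a)) F d.
Proof.
move=> ha hn; rewrite -big_filter -[RHS]big_filter; apply: perm_big; apply: uniq_perm;
  try by apply: filter_uniq; apply: uniq_ball.
move=> d; rewrite !mem_filter !mem_ball; case: asbP => //= /(gn_dvd_le ha); lia.
Qed.

(** The divisors [d] and [p d], for [d] dividing [m], carry opposite signs, and all other divisors
    contain [p ^ 2] and drop out. So each prime of [a] replaces [G] by a difference: one prime kills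
    a constant, two kill a multiple of [ln], three kill its square. *)
Lemma dsum_prime_step G p k m : gprime p -> m <> g0 -> ~ gdvd p m ->
  dsum G (gmul (gpow p k.+1) m) = dsum (fun t => G t - G (rn p * t)) m.
Proof.
move=> hp hm hpm; have hp0 := gprime_neq0 hp.
have hpk j : gpow p j <> g0.
  by elim: j => [|j IH] //; rewrite gpowS; apply: gmul_neq0.
set a := gmul _ m; have ha : a <> g0 by apply: gmul_neq0.
have hma : gdvd m a by exact/gdvd_mull/gdvd_refl.
have ea : a = gmul p (gmul (gpow p k) m) by rewrite /a gpowS gmulA.
have h1 e : ~ gdvd p e -> gdvd e a -> gdvd e m by move=> h h'; exact: (gauss_prime_pow hp h h').
have h2 e : ~ gdvd p e -> gdvd e m -> gdvd (gmul p e) a.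
  by move=> he hem; rewrite ea; apply: gdvd_mul2; apply: gdvd_mull.
have h3 e : gdvd e m -> ~ gdvd p e by move=> hem hpe; apply: hpm; apply: gdvd_trans hem.
have hpm0 := proj1 (gn_gt0 p) hp0.
rewrite /dsum (bigID (fun d => asb (gdvd p d))) /= Rplus_comm.
have -> : \sum_(d <- ball (gn a) | asb (gdvd d a) && ~~ asb (gdvd p d)) (mu d * G (rn d)) =
    \sum_(d <- ball (gn m) | asb (gdvd d m)) (mu d * G (rn d)).
  rewrite -(dsum_ball (n := gn a) _ hm (gn_dvd_le ha hma)); apply: eq_bigl => d.
  apply/andP/asbP => [[/asbP h /asbP h']|h]; first exact: h1.
  by split; apply/asbP; [apply: gdvd_trans h hma | apply: h3].
have -> : \sum_(d <- ball (gn a) | asb (gdvd d a) && asb (gdvd p d)) (mu d * G (rn d)) =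
    \sum_(d <- ball (gn m) | asb (gdvd d m)) (- 1 * (mu d * G (rn p * rn d))).
  under eq_bigl do rewrite andbC.
  rewrite (reindex_ball _ (fun d => asb (gdvd d a))) //.
  rewrite -(dsum_ball (n := gn a %/ gn p) _ hm); last first.
    rewrite leq_divRL // mulnC -gnM; apply: gn_dvd_le => //; apply: h2 => //; exact: gdvd_refl.
  rewrite big_mkcond [RHS]big_mkcond; apply: sum_eq => e /ball_neq0 he _.
  case: asbP => hea; case: asbP => hem.
  - by rewrite (mu_prime hp he (h3 _ hem)) rnM; ring.
  (* Here [p e] divides [a] but [e] does not divide [m]. Then [p] divides [e], and the term vanishes
     because of the square. *)
  - case: (excluded_middle_informative (gdvd p e)) => hpe.
      by rewrite (@mu_sq p) //; [ring | apply: gdvd_mul2].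
    case: hem; apply: (gauss_prime_pow (k := k) hp hpe); apply: (gdvd_mul2l hp0); by rewrite -ea.
  - case: hea; apply: h2 => //; exact: h3.
  - by [].
by rewrite -sum_add; apply: eq_bigr => d _; ring.
Qed.

Lemma dsum_ext F G a : (forall t, 1 <= t -> F t = G t) -> dsum F a = dsum G a.
Proof.
move=> h; rewrite /dsum; apply: sum_eq => d /ball_neq0 hd _; congr (_ * _).
apply: h; exact: rn_ge1.
Qed.

Lemma dsum_unit G u : gunit u -> dsum G u = 4 * G 1.
Proof.
move=> hu; have hn := proj1 (gn_unit u) hu.
rewrite /dsum hn -big_filter.
have e : perm_eq [seq d <- ball 1 | asb (gdvd d u)] gunits.
  apply: uniq_perm; [exact/filter_uniq/uniq_ball | by [] |] => d.
  rewrite mem_filter mem_ball mem_gunits; apply/andP/eqP => [[_ h]|h].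
    have := gnE d; lia.
  split; last by have := gnE d; lia.
  by apply/asbP; apply: gunit_dvd; apply/gunitP.
rewrite (perm_big _ e) (eq_big_seq (fun=> G 1)); first by rewrite sum_const /=; ring.
move=> d; rewrite mem_gunits => /eqP/gunitP hd.
by rewrite mu_unit // /rn (proj1 (gn_unit d) hd) /=; ring.
Qed.

Lemma gfactor_step a : a <> g0 -> ~ gunit a ->
  exists p k m, [/\ gprime p, m <> g0, ~ gdvd p m & a = gmul (gpow p k.+1) m].
Proof.
move=> ha hu; have [p hp hpa] := exists_prime_divisor ha hu.
have [[|k] [m [e hm]]] := gfactor_prime hp ha.
  by case: hm; move: hpa; rewrite e gmul1.
exists p, k, m; split=> //; move=> em; apply: ha; by rewrite e em gmul0.
Qed.

Lemma dsum_const c a : a <> g0 -> ~ gunit a -> dsum (fun=> c) a = 0.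
Proof.
move=> ha /(gfactor_step ha) [p [k [m [hp hm hpm ->]]]].
rewrite dsum_prime_step // /dsum big1 // => d _; ring.
Qed.

Lemma gprime_pow1 p : p = gmul (gpow p 1) g1.
Proof. by rewrite gmulr1 /gpow /= gmulr1. Qed.

Lemma gunit1 : gunit g1. Proof. by exists g1. Qed.
Lemma gprime_ndvd_unit p u : gprime p -> gunit u -> ~ gdvd p u.
Proof. by move=> hp hu /(gdvd_unit hu) /(gprime_not_unit hp). Qed.
Lemma gunit_neq0 u : gunit u -> u <> g0.
Proof. by move/gn_unit => h; apply/gn_gt0; rewrite h. Qed.

Lemma rn_gt0 a : a <> g0 -> 0 < rn a.
Proof. by move/rn_ge1; lra. Qed.

Lemma dsum_ln_prime_pow L p k u : gprime p -> gunit u ->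
  dsum (fun t => L - ln t) (gmul (gpow p k.+1) u) = 4 * ln (rn p).
Proof.
move=> hp hu; have hp0 := rn_gt0 (gprime_neq0 hp).
rewrite dsum_prime_step //; [|exact: gunit_neq0|exact: gprime_ndvd_unit].
rewrite (@dsum_ext _ (fun=> ln (rn p))); first by rewrite dsum_unit.
by move=> t ht; rewrite ln_mult //; lra.
Qed.

(** Removing one prime turns [L - ln t] into the constant [ln (rn p)], and a second prime would kill
    it. Only units and prime powers, up to units, keep a nonzero weight. *)
Lemma dsum_ln_cases L a : a <> g0 ->
  [\/ gunit a, dsum (fun t => L - ln t) a = 0 |
   exists p k u, [/\ gprime p, gunit u & a = gmul (gpow p k.+1) u]].
Proof.
move=> ha; case: (excluded_middle_informative (gunit a)) => hu; first by constructor 1.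
have [p [k [m [hp hm hpm e]]]] := gfactor_step ha hu.
case: (excluded_middle_informative (gunit m)) => hum.
  by constructor 3; exists p, k, m.
constructor 2; rewrite e dsum_prime_step //.
rewrite (@dsum_ext _ (fun=> ln (rn p))); first exact: dsum_const.
by move=> t ht; rewrite ln_mult; [lra | exact/rn_gt0/gprime_neq0 | lra].
Qed.

Lemma rn_prime_ln p : gprime p -> 0 < ln (rn p).
Proof.
move=> hp; rewrite -ln_1; apply: ln_increasing; first lra.
have := gprime_norm hp; rewrite /rn -gnE => h.
rewrite -[1]/(INR 1); apply: lt_INR; lia.
Qed.

Lemma dsum_ln2_step L p k m : gprime p -> m <> g0 -> ~ gdvd p m ->
  dsum (fun t => (L - ln t) ^ 2) (gmul (gpow p k.+1) m) =
  dsum (fun t => ln (rn p) * (2 * L - ln (rn p)) - 2 * ln (rn p) * ln t) m.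
Proof.
move=> hp hm hpm; rewrite dsum_prime_step //; apply: dsum_ext => t ht.
rewrite ln_mult; [ring | exact/rn_gt0/gprime_neq0 | lra].
Qed.

Lemma dsum_ln2_prime L p : gprime p ->
  dsum (fun t => (L - ln t) ^ 2) p = 4 * (ln (rn p) * (2 * L - ln (rn p))).
Proof.
move=> hp; rewrite {1}(gprime_pow1 p) dsum_ln2_step //; last exact: gprime_ndvd_unit gunit1.
by rewrite dsum_unit; [rewrite ln_1; ring | exact: gunit1].
Qed.

(** By the number of distinct primes up to associates: none leaves a square, one leaves
    [4 * ln p * (2 L - ln p)], nonnegative because [ln p <= L], two leave [8 * ln p * ln q], and
    three or more leave 0. *)
Lemma dsum_ln2_ge0 L a : a <> g0 -> ln (rn a) <= L ->
  0 <= dsum (fun t => (L - ln t) ^ 2) a.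
Proof.
move=> ha hL; case: (excluded_middle_informative (gunit a)) => hu.
  rewrite dsum_unit //; have := pow2_ge_0 (L - ln 1); lra.
have [p [k [m [hp hm hpm e]]]] := gfactor_step ha hu.
have hlp := rn_prime_ln hp.
have hpL : ln (rn p) <= L.
  apply: Rle_trans hL; rewrite e rnM gpowS rnM.
  have := rn_gt0 (gprime_neq0 hp) => hp0.
  apply: ln_le => //; rewrite Rmult_assoc -{1}(Rmult_1_r (rn p)).
  apply: Rmult_le_compat_l; first lra.
  rewrite -rnM; apply: rn_ge1; move: ha; rewrite e gpowS -gmulA; exact: gmul_neq0r.
rewrite e dsum_ln2_step //.
case: (excluded_middle_informative (gunit m)) => hum.
  rewrite dsum_unit // ln_1; nra.
have [q [j [m' [hq hm' hqm e']]]] := gfactor_step hm hum.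
rewrite e' dsum_prime_step //.
rewrite (@dsum_ext _ (fun=> 2 * ln (rn p) * ln (rn q))); last first.
  by move=> t ht; rewrite ln_mult; [ring | exact/rn_gt0/gprime_neq0 | lra].
case: (excluded_middle_informative (gunit m')) => hum'.
  rewrite dsum_unit //; have := rn_prime_ln hq; nra.
rewrite dsum_const //; lra.
Qed.

(** * Multiples of a Gaussian integer in a square *)

Definition zint (x : Z) (s : nat) : seq Z := [seq (x + Z.of_nat i)%Z | i <- iota 0%N s].
Lemma mem_zint x s z : (z \in zint x s) = (x <=? z)%Z && (z <? x + Z.of_nat s)%Z.
Proof.
apply/mapP/andP => [[i]|[h1 h2]]; first by rewrite mem_iota => hi ->; lia.
exists (Z.to_nat (z - x)); last lia.
rewrite mem_iota; lia.
Qed.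
Lemma uniq_zint x s : uniq (zint x s).
Proof. by rewrite map_inj_uniq ?iota_uniq // => i j; lia. Qed.

Definition gsquare (c : gint) (s : nat) : seq gint :=
  [seq (x, y) | x <- zint (fst c) s, y <- zint (snd c) s].
Lemma mem_gsquare c s a : (a \in gsquare c s) =
  [&& (fst c <=? fst a)%Z, (fst a <? fst c + Z.of_nat s)%Z,
      (snd c <=? snd a)%Z & (snd a <? snd c + Z.of_nat s)%Z].
Proof.
rewrite andbA -!mem_zint; apply/allpairsP/andP => [[[x y] [/= hx hy ->]] //|[h1 h2]].
by exists a; split=> //; case: (a).
Qed.
Lemma uniq_gsquare c s : uniq (gsquare c s).
Proof. by apply: allpairs_uniq; rewrite ?uniq_zint // => - [a b] [a' b'] _ _ /= ->. Qed.
Lemma size_gsquare c s : size (gsquare c s) = (s * s)%N.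
Proof. by rewrite size_allpairs !size_map !size_iota. Qed.

Definition gmults (d : gint) (s : seq gint) : seq gint := [seq a <- s | asb (gdvd d a)].
Definition grad (d : gint) : nat := Z.to_nat (Z.abs (fst d) + Z.abs (snd d)).
(** The points of [d * [0,1)^2], a fundamental domain for the multiples of [d]. Multiplication by
    the conjugate turns the condition on [r / d] into one on integers. *)
Definition gtile (d : gint) : seq gint :=
  [seq r <- zbox (grad d) | gmul r (gconj d) \in gsquare g0 (gn d)].

Lemma gmul_conj d : gmul d (gconj d) = (gnorm d, 0%Z).
Proof. rewrite /gmul /gconj /gnorm; cbn [fst snd]; f_equal; ring. Qed.
Lemma gnorm_conj d : gnorm (gconj d) = gnorm d.
Proof. rewrite /gnorm /gconj; cbn [fst snd]; ring. Qed.
Lemma gn_conj d : gn (gconj d) = gn d. Proof. by rewrite /gn gnorm_conj. Qed.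
Lemma gconjK d : gconj (gconj d) = d.
Proof. case: d => x y; rewrite /gconj; cbn [fst snd]; f_equal; lia. Qed.
Lemma gconj_neq0 d : d <> g0 -> gconj d <> g0.
Proof. by move/gn_gt0 => h; apply/gn_gt0; rewrite gn_conj. Qed.

Lemma mem_gtile d r : d <> g0 -> (r \in gtile d) = (gmul r (gconj d) \in gsquare g0 (gn d)).
Proof.
move=> hd; rewrite mem_filter; apply: andb_idr.
rewrite mem_gsquare gnE mem_zbox !mem_zsym => /and4P [].
have hn := gnorm_gt0 hd.
have e1 : (gnorm d * fst r = fst (gmul r (gconj d)) * fst d - snd (gmul r (gconj d)) * snd d)%Z.
  rewrite /gnorm /gmul /gconj; cbn [fst snd]; ring.
have e2 : (gnorm d * snd r = fst (gmul r (gconj d)) * snd d + snd (gmul r (gconj d)) * fst d)%Z.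
  rewrite /gnorm /gmul /gconj; cbn [fst snd]; ring.
move: e1 e2; set u := fst (gmul _ _); set v := snd (gmul _ _).
rewrite /g0 /grad; cbn [fst snd]; move: (gnorm d) hn => n hn e1 e2 h1 h2 h3 h4.
have [b1 b2] : (0 <= u < n /\ 0 <= v < n)%Z by lia.
rewrite Z2Nat.id; last lia.
have hux : (Z.abs (u * fst d) <= n * Z.abs (fst d))%Z by rewrite Z.abs_mul; nia.
have huy : (Z.abs (u * snd d) <= n * Z.abs (snd d))%Z by rewrite Z.abs_mul; nia.
have hvx : (Z.abs (v * fst d) <= n * Z.abs (fst d))%Z by rewrite Z.abs_mul; nia.
have hvy : (Z.abs (v * snd d) <= n * Z.abs (snd d))%Z by rewrite Z.abs_mul; nia.
have k1 : (Z.abs (n * fst r) <= n * (Z.abs (fst d) + Z.abs (snd d)))%Z by lia.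
have k2 : (Z.abs (n * snd r) <= n * (Z.abs (fst d) + Z.abs (snd d)))%Z by lia.
move: k1 k2; rewrite !Z.abs_mul (Z.abs_eq n); last lia.
by move=> k1 k2; apply/andP; split; apply/Z.leb_spec0; nia.
Qed.

Lemma uniq_gtile d : uniq (gtile d).
Proof. exact/filter_uniq/uniq_zbox. Qed.

Lemma gtile_bound d r : r \in gtile d ->
  (Z.abs (fst r) <= Z.of_nat (grad d) /\ Z.abs (snd r) <= Z.of_nat (grad d))%Z.
Proof. rewrite mem_filter mem_zbox !mem_zsym => /and3P [_]; lia. Qed.

Lemma gtile_inj d r r' : d <> g0 -> r \in gtile d -> r' \in gtile d ->
  gdvd d (gsub r r') -> r = r'.
Proof.
move=> hd; rewrite !mem_gtile // !mem_gsquare !gnE => h1 h2 [x ex].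
have hn := gnorm_gt0 hd.
have e : gsub (gmul r (gconj d)) (gmul r' (gconj d)) = ((gnorm d * fst x)%Z, (gnorm d * snd x)%Z).
  transitivity (gmul (gsub r r') (gconj d)); first by gring.
  rewrite ex /gnorm; gring.
have e1 := f_equal fst e; have e2 := f_equal snd e; move: e1 e2 h1 h2.
rewrite /gsub /g0; move: (gmul r _) (gmul r' _) => u v; cbn [fst snd] => e1 e2 h1 h2.
have b1 : (- gnorm d < gnorm d * fst x < gnorm d)%Z by lia.
have b2 : (- gnorm d < gnorm d * snd x < gnorm d)%Z by lia.
have x1 : fst x = 0%Z by nia.
have x2 : snd x = 0%Z by nia.
move: ex; rewrite /gmul x1 x2 /gsub; case: (r) (r') => [a b] [a' b'].
cbn [fst snd] => - [? ?]; f_equal; lia.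
Qed.

(** The multiple of [d] whose translated tile contains [a]. *)
Definition gfloor (d a : gint) : gint :=
  gmul d ((fst (gmul a (gconj d)) / gnorm d)%Z, (snd (gmul a (gconj d)) / gnorm d)%Z).
Lemma gfloor_dvd d a : gdvd d (gfloor d a).
Proof. by eexists. Qed.
Lemma gfloor_tile d a : d <> g0 -> gsub a (gfloor d a) \in gtile d.
Proof.
move=> hd; have hn := gnorm_gt0 hd; rewrite mem_gtile // mem_gsquare gnE.
set u := fst (gmul a (gconj d)); set v := snd (gmul a (gconj d)).
have -> : gmul (gsub a (gfloor d a)) (gconj d) = (u mod gnorm d, v mod gnorm d)%Z.
  rewrite !Zmod_eq_full; try lia.
  rewrite /gfloor -/u -/v; set q1 := (u / _)%Z; set q2 := (v / _)%Z.
  rewrite /u /v /gnorm; gring.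
have := Z.mod_pos_bound u (gnorm d) hn; have := Z.mod_pos_bound v (gnorm d) hn.
rewrite /g0; cbn [fst snd]; lia.
Qed.

Lemma gsubK a b : gadd b (gsub a b) = a.
Proof. case: a => x y; gring. Qed.

Lemma gtile_size_mults d : d <> g0 ->
  size (gtile d) = size (gmults (gconj d) (gsquare g0 (gn d))).
Proof.
move=> hd; have hc := gconj_neq0 hd.
rewrite -(size_map (fun r => gmul r (gconj d))); apply/perm_size/uniq_perm.
- rewrite map_inj_in_uniq ?uniq_gtile // => x y _ _.
  by rewrite ![gmul _ (gconj d)]gmulC; apply: gmulI.
- exact/filter_uniq/uniq_gsquare.
move=> a; rewrite mem_filter; apply/mapP/andP => [[r]|[/asbP [r ->] h]].
  rewrite mem_gtile // => h ->; split=> //; apply/asbP; exact/gdvd_mull/gdvd_refl.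
by exists r; rewrite ?mem_gtile // gmulC.
Qed.

(** Exchanging the coordinates sends [a] to [i] times its conjugate, so it preserves the square at
    the origin and maps multiples of the conjugate of [d] to multiples of [d]. *)
Lemma gmults_swap d s : size (gmults (gconj d) (gsquare g0 s)) = size (gmults d (gsquare g0 s)).
Proof.
pose sw (a : gint) : gint := (snd a, fst a).
have swK a : sw (sw a) = a by case: a.
have swM e a : gmul (sw e) a = sw (gmul e (gconj a)) by rewrite /sw; gring.
rewrite -(size_map sw); apply/perm_size/uniq_perm.
- rewrite map_inj_uniq; first exact/filter_uniq/uniq_gsquare.
  exact: (can_inj swK).
- exact/filter_uniq/uniq_gsquare.
have hsq a : (sw a \in gsquare g0 s) = (a \in gsquare g0 s).
  rewrite !mem_gsquare /sw /g0; cbn [fst snd]; lia.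
have hdv e a : gdvd (gconj e) a -> gdvd e (sw a).
  move=> [x ->]; exists (sw x); rewrite /sw; gring.
move=> a; rewrite mem_filter; apply/mapP/andP => [[b]|[/asbP h hs]].
  rewrite mem_filter => /andP [/asbP h1 h2] ->; rewrite hsq; split=> //.
  by apply/asbP; apply: hdv.
exists (sw a); last by rewrite swK.
rewrite mem_filter hsq hs andbT; apply/asbP; apply: hdv.
by rewrite gconjK.
Qed.

(** The square of side [N(d)] represents the residues modulo [N(d)]. Since [d] divides [N(d)],
    reduction preserves divisibility by [d], and every residue is a multiple of [d] plus a tile
    element in exactly one way. *)
Lemma gtile_mults_size d : d <> g0 ->
  (size (gmults d (gsquare g0 (gn d))) * size (gtile d) = gn d * gn d)%N.
Proof.
move=> hd; have hn := gnorm_gt0 hd; rewrite -(size_gsquare g0).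
pose md (a : gint) : gint := (fst a mod gnorm d, snd a mod gnorm d)%Z.
have mdP a : exists x, a = gadd (md a) (gmul d x).
  exists (gmul (gconj d) ((fst a / gnorm d)%Z, (snd a / gnorm d)%Z)).
  rewrite gmulA gmul_conj /md !Zmod_eq_full; try lia.
  case: (a) => x y; gring.
have md_sq a : md a \in gsquare g0 (gn d).
  rewrite mem_gsquare gnE /md /g0; cbn [fst snd].
  have := Z.mod_pos_bound (fst a) _ hn; have := Z.mod_pos_bound (snd a) _ hn; lia.
have md_id a : a \in gsquare g0 (gn d) -> md a = a.
  rewrite mem_gsquare gnE /g0; cbn [fst snd] => h.
  rewrite /md !Z.mod_small; try lia; by case: (a).
have md_eq a b : md a = md b -> forall c, md (gadd a c) = md (gadd b c).
  rewrite /md => - [h1 h2] c; rewrite /gadd; cbn [fst snd].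
  by rewrite Z.add_mod ?h1 -?Z.add_mod ?(Z.add_mod (snd a)) ?h2 -?Z.add_mod; try lia.
have md_dvd a b : md a = md b -> gdvd d (gsub a b).
  have [x ex] := mdP a; have [y ey] := mdP b; move=> e.
  exists (gsub x y); rewrite ex ey e; gring.
pose L := [seq (m, r) | m <- gmults d (gsquare g0 (gn d)), r <- gtile d].
have memL m r : (m, r) \in L -> [/\ gdvd d m, m \in gsquare g0 (gn d) & r \in gtile d].
  by case/allpairsP => - [m' r'] [/=]; rewrite mem_filter => /andP [/asbP ? ?] ? [-> ->].
rewrite -(size_allpairs pair) -/L -(size_map (fun p => md (gadd p.1 p.2))).
apply/perm_size/uniq_perm; last 1 first.
- move=> a; apply/mapP/idP => [[[m r] /memL [_ _ _] ->] //|ha].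
  exists (md (gfloor d a), gsub a (gfloor d a)); last first.
    rewrite /= -{1}(md_id _ ha) -{1}(gsubK a (gfloor d a)).
    by apply: md_eq; rewrite (md_id _ (md_sq _)).
  apply: allpairs_f; last exact: gfloor_tile.
  rewrite mem_filter md_sq andbT; apply/asbP.
  have [x ex] := mdP (gfloor d a).
  have -> : md (gfloor d a) = gsub (gfloor d a) (gmul d x).
    rewrite {2}ex; case: (md _) => ? ?; gring.
  by apply: gdvd_sub; [exact: gfloor_dvd | exists x].
- rewrite map_inj_in_uniq.
    apply: allpairs_uniq; rewrite ?uniq_gtile ?filter_uniq ?uniq_gsquare //.
    by move=> - [? ?] [? ?] _ _ /= [-> ->].
  move=> - [m r] [m' r'] /memL [h1 h2 h3] /memL [h1' h2' h3'] /= e.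
  have er : r = r'.
    apply: (gtile_inj hd h3 h3').
    have -> : gsub r r' = gadd (gsub (gadd m r) (gadd m' r')) (gsub m' m) by gring.
    by apply: gdvd_add; [exact: md_dvd | exact: gdvd_sub].
  move: e; rewrite -er => /md_eq /(_ (gsub g0 r)).
  have -> : gadd (gadd m r) (gsub g0 r) = m by case: (m) => ? ?; gring.
  have -> : gadd (gadd m' r) (gsub g0 r) = m' by case: (m') => ? ?; gring.
  by rewrite !md_id // => ->.
- exact: uniq_gsquare.
Qed.

(** Multiplication by the conjugate and the reflection identify the two factors in
    [gtile_mults_size], so the size of the tile has square [N(d) ^ 2]. *)
Lemma size_gtile d : d <> g0 -> size (gtile d) = gn d.
Proof.
move=> hd; have := gtile_mults_size hd.
rewrite -gmults_swap -gtile_size_mults //; nia.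
Qed.

Lemma grad_le d : (grad d * grad d <= 2 * gn d)%N.
Proof.
suff : (Z.of_nat (grad d) * Z.of_nat (grad d) <= 2 * gnorm d)%Z by have := gnE d; nia.
rewrite /grad Z2Nat.id; last lia.
rewrite /gnorm; case: d => x y; cbn [fst snd].
have := Z.square_nonneg (Z.abs x - Z.abs y).
rewrite -(Z.abs_square x) -(Z.abs_square y); nia.
Qed.

(** The tiles attached to the multiples in the square are disjoint and stay in the square enlarged
    by [grad d] on every side. Conversely, in [gmults_lower], they cover the square shrunk by as
    much. *)
Lemma gmults_upper d c s : d <> g0 ->
  (size (gmults d (gsquare c s)) * gn d <= (s + 2 * grad d) * (s + 2 * grad d))%N.
Proof.
move=> hd; set r0 := grad d.
rewrite -(size_gsquare ((fst c - Z.of_nat r0)%Z, (snd c - Z.of_nat r0)%Z)) -(size_gtile hd).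
pose L := [seq (m, r) | m <- gmults d (gsquare c s), r <- gtile d].
have memL m r : (m, r) \in L -> [/\ gdvd d m, m \in gsquare c s & r \in gtile d].
  by case/allpairsP => - [m' r'] [/=]; rewrite mem_filter => /andP [/asbP ? ?] ? [-> ->].
rewrite -(size_allpairs pair) -/L -(size_map (fun p => gadd p.1 p.2)).
apply: uniq_leq_size.
- rewrite map_inj_in_uniq.
    apply: allpairs_uniq; rewrite ?uniq_gtile ?filter_uniq ?uniq_gsquare //.
    by move=> - [? ?] [? ?] _ _ /= [-> ->].
  move=> - [m r] [m' r'] /memL [h1 h2 h3] /memL [h1' h2' h3'] /= e.
  have er : r = r'.
    apply: (gtile_inj hd h3 h3').
    have -> : gsub r r' = gadd (gsub (gadd m r) (gadd m' r')) (gsub m' m) by gring.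
    apply: gdvd_add; last exact: gdvd_sub.
    by rewrite e; exists g0; rewrite gmul0; gring.
  move: e; rewrite -er /gadd; case: (m) (m') => [? ?] [? ?]; cbn [fst snd] => - [? ?].
  by f_equal; f_equal; lia.
- move=> a /mapP [[m r] /memL [_ h2 /gtile_bound h3] ->].
  move: h2; rewrite !mem_gsquare /gadd; cbn [fst snd]; rewrite -/r0 in h3; lia.
Qed.

Lemma gmults_lower d c s : d <> g0 -> (2 * grad d <= s)%N ->
  ((s - 2 * grad d) * (s - 2 * grad d) <= size (gmults d (gsquare c s)) * gn d)%N.
Proof.
move=> hd; set r0 := grad d => hs.
rewrite -(size_gsquare ((fst c + Z.of_nat r0)%Z, (snd c + Z.of_nat r0)%Z)) -(size_gtile hd).
rewrite -(size_allpairs (fun m r => gadd m r)); apply: uniq_leq_size.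
  exact: uniq_gsquare.
move=> a; rewrite mem_gsquare => h; apply/allpairsP.
exists (gfloor d a, gsub a (gfloor d a)); split => /=; last by rewrite gsubK.
- rewrite mem_filter; apply/andP; split; first exact/asbP/gfloor_dvd.
  have := gtile_bound (gfloor_tile a hd); rewrite -/r0 mem_gsquare.
  move: h; cbn [fst snd]; rewrite /gsub; cbn [fst snd]; lia.
- exact: gfloor_tile.
Qed.

(** Dividing [(s + 2 grad d) ^ 2] and its counterpart by [N(d)], with [grad d <= 2 * sqrt N(d)],
    leaves a boundary term and a constant. The latter matters for [d] so large that a square may
    contain no multiple. *)
Lemma gmults_count d c s : d <> g0 ->
  Rabs (INR (size (gmults d (gsquare c s))) - INR s * INR s / rn d)
    <= 8 * (INR s / sqrt (rn d)) + 8.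
Proof.
move=> hd; have hn := rn_ge1 hd.
have hu := INR_le (gmults_upper c s hd).
have hr := INR_le (grad_le d).
have hl : (INR s * INR s - 4 * INR s * INR (grad d) <= INR (size (gmults d (gsquare c s))) * rn d).
  case: (leqP (2 * grad d) s) => hs.
    have := INR_le (gmults_lower c hd hs).
    rewrite !INRM INRB // INRM -[INR 2]/2 -/(rn d); have := pos_INR (grad d); nra.
  have h2 := INR_lt hs; rewrite INRM -[INR 2]/2 in h2.
  have := pos_INR s; have := pos_INR (size (gmults d (gsquare c s))).
  set x := INR (size _); move=> hx hs0.
  have : 0 <= x * rn d by nra. nra.
move: hu hr hl; rewrite !(INRM, INRD) -[INR 2]/2 -/(rn d).
set x := INR (size _); set r := INR (grad d); set t := INR s; set n := rn d in hn *.
have ht : 0 <= t by apply: pos_INR.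
have hr0 : 0 <= r by apply: pos_INR.
move=> hu hr hl; set q := sqrt n.
have hq1 : 1 <= q by rewrite -sqrt_1; apply: sqrt_le_1_alt.
have hqq : q * q = n by apply: sqrt_sqrt; lra.
have hrq : r <= 2 * q by apply: Rsqr_incr_0_var; [rewrite /Rsqr; nra | nra].
have e : (x - t * t / n) * n = x * n - t * t by field; lra.
have e2 : (8 * (t / q) + 8) * n = 8 * t * q + 8 * n.
  by rewrite -hqq; field; lra.
apply: Rabs_le; split; apply: (Rmult_le_reg_r n); try lra.
  rewrite e Ropp_mult_distr_l_reverse e2; nra.
rewrite e e2; nra.
Qed.

(** * Counting Gaussian integers in discs *)

(** The area of the unit disc, that is pi. It stays symbolic and cancels in the final comparison. *)
Definition cK : R := 4 * RInt (fun u => sqrt (1 - u * u)) 0 1.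

Lemma continuous_circle (r : R) x : continuous (fun t => sqrt (r - t * t)) x.
Proof.
apply: continuous_comp; last exact: continuous_sqrt.
apply: (continuous_minus (fun _ => r) (fun t => t * t)); first exact: continuous_const.
by apply: (continuous_mult (fun t : R => t) (fun t : R => t)); exact: continuous_id.
Qed.

Lemma ex_RInt_circle r a b : ex_RInt (fun t => sqrt (r - t * t)) a b.
Proof. by apply: ex_RInt_continuous => z _; exact: continuous_circle. Qed.

Lemma cK_gt0 : 0 < cK.
Proof.
apply: Rmult_lt_0_compat; first lra.
apply: RInt_gt_0 => [|x hx|x _]; first lra.
  by apply: sqrt_lt_R0; nra.
exact: continuous_circle.
Qed.

Lemma RInt_split (f : R -> R) a b c : ex_RInt f a b -> ex_RInt f b c ->
  RInt f a b + RInt f b c = RInt f a c.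
Proof. by move=> h1 h2; apply: (RInt_Chasles f). Qed.

(** Beyond [sqrt r] the integrand is the root of a negative number, which is 0 by convention, so
    every endpoint past the radius gives the area of a quarter disc. *)
Lemma RInt_circle r b : 0 < r -> sqrt r <= b ->
  RInt (fun t => sqrt (r - t * t)) 0 b = r * (cK / 4).
Proof.
move=> hr hb; set s := sqrt r in hb *; have hs : 0 < s by apply: sqrt_lt_R0.
have hss : s * s = r by apply: sqrt_sqrt; lra.
rewrite -(RInt_split (b := s)); [|exact: ex_RInt_circle|exact: ex_RInt_circle].
have -> : RInt (fun t => sqrt (r - t * t)) s b = 0.
  rewrite (RInt_ext _ (fun=> 0)); first by rewrite RInt_const /scal /= /mult /= Rmult_0_r.
  move=> x; rewrite Rmin_left // Rmax_right // => hx; apply: sqrt_neg_0; nra.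
have -> : RInt (fun t => sqrt (r - t * t)) 0 s =
          RInt (fun y => scal s (sqrt (r - (s * y + 0) * (s * y + 0)))) 0 1.
  rewrite (RInt_comp_lin (fun t => sqrt (r - t * t)) s 0 0 1); last exact: ex_RInt_circle.
  by rewrite Rmult_0_r Rplus_0_r Rmult_1_r Rplus_0_r.
rewrite (RInt_ext _ (fun y => scal r (sqrt (1 - y * y)))); last first.
  move=> x _; rewrite /scal /= /mult /= Rplus_0_r.
  have -> : r - s * x * (s * x) = r * (1 - x * x) by rewrite -hss; ring.
  rewrite sqrt_mult_alt; last lra. by rewrite -/s -Rmult_assoc hss.
rewrite RInt_scal; last exact: ex_RInt_circle.
rewrite /scal /= /mult /= /cK; field.
Qed.

Lemma sum_iotaS (f : nat -> R) k : \sum_(i <- iota 0%N k.+1) f i = \sum_(i <- iota 0%N k) f i + f k.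
Proof.
by rewrite -addn1 iotaD big_cat /= big_seq1 add0n.
Qed.

Lemma sum_le_RInt (f : R -> R) k :
  (forall a b, ex_RInt f a b) -> (forall x y, 0 <= x -> x <= y -> f y <= f x) ->
  \sum_(i <- iota 0%N k) f (INR i.+1) <= RInt f 0 (INR k) <= \sum_(i <- iota 0%N k) f (INR i).
Proof.
move=> hi hd; elim: k => [|k [IH1 IH2]].
  by rewrite !big_nil RInt_point /zero /=; lra.
rewrite !sum_iotaS -(@RInt_split f 0 (INR k) (INR k.+1)) //.
have hk := pos_INR k.
have eC (y : R) : y = RInt (fun=> y) (INR k) (INR k.+1).
  by rewrite RInt_const INRS /scal /= /mult /=; ring.
have h1 : f (INR k.+1) <= RInt f (INR k) (INR k.+1).
  rewrite (eC (f (INR k.+1))).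
  apply: RInt_le; [rewrite INRS; lra | exact: ex_RInt_const | exact: hi |].
  by move=> x hx; apply: hd; lra.
have h2 : RInt f (INR k) (INR k.+1) <= f (INR k).
  rewrite (eC (f (INR k))).
  apply: RInt_le; [rewrite INRS; lra | exact: hi | exact: ex_RInt_const |].
  by move=> x hx; apply: hd; lra.
lra.
Qed.

Lemma sum_zsym (g : Z -> R) m :
  \sum_(y <- zsym m) g y = \sum_(i <- iota 0%N m.+1) g (Z.of_nat i) + \sum_(i <- iota 1%N m) g (- Z.of_nat i)%Z.
Proof.
rewrite -(big_map Z.of_nat xpredT g) -(big_map (fun i => (- Z.of_nat i)%Z) xpredT g) -big_cat.
apply: perm_big; apply: uniq_perm.
- exact: uniq_zsym.
- rewrite cat_uniq !map_inj_uniq ?iota_uniq ?andbT /=; try by move=> i j; lia.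
  apply/hasPn => x /mapP [i]; rewrite mem_iota => hi ->; apply/negP.
  rewrite /= inE => /orP [/eqP|/mapP [j]]; first lia.
  rewrite mem_iota; lia.
move=> x; rewrite mem_zsym mem_cat; apply/idP/orP => [h|].
  case: (Z.leb_spec0 0 x) => hx; [left|right]; apply/mapP; exists (Z.to_nat (Z.abs x));
  rewrite ?mem_iota; lia.
by case=> /mapP [i]; rewrite mem_iota => hi ->; lia.
Qed.

Definition drow (n : nat) (y : Z) : nat := Z.to_nat (Z.sqrt (Z.of_nat n - y * y)).
Definition disc (n : nat) : seq gint := [seq (x, y) | y <- zsym (Nat.sqrt n), x <- zsym (drow n y)].

Lemma abs_le_sqrt (x : Z) n : (Z.abs x <=? Z.of_nat (Nat.sqrt n))%Z = (x * x <=? Z.of_nat n)%Z.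
Proof.
have := Nat.sqrt_spec n (Nat.le_0_l n); set m := Nat.sqrt n => - [h1 h2].
rewrite -(Z.abs_square x); apply/Z.leb_spec0/Z.leb_spec0 => h; nia.
Qed.

Lemma size_disc n : size (disc n) = (size (ball n)).+1.
Proof.
rewrite -[RHS]/(size (g0 :: ball n)); apply/perm_size/uniq_perm.
- apply: allpairs_uniq_dep; rewrite ?uniq_zsym //.
    by move=> y _; apply: uniq_zsym.
  by move=> - [a b] [c d] _ _ /= [-> ->].
- by rewrite cons_uniq uniq_ball andbT mem_ball.
move=> [x y]; have -> : ((x, y) \in disc n) = (x * x + y * y <=? Z.of_nat n)%Z.
  apply/allpairsPdep/idP => [[y' [x' [h1 h2 [-> ->]]]]|h].
    move: h1 h2; rewrite !mem_zsym abs_le_sqrt /drow => h1.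
    have := Z.sqrt_spec (Z.of_nat n - y' * y') ltac:(lia).
    move: (Z.sqrt _) (Z.sqrt_nonneg (Z.of_nat n - y' * y')) => r hr hr2; nia.
  exists y, x; split=> //; first by rewrite mem_zsym abs_le_sqrt; nia.
  rewrite mem_zsym /drow.
  have := Z.sqrt_spec (Z.of_nat n - y * y) ltac:(nia).
  move: (Z.sqrt _) (Z.sqrt_nonneg (Z.of_nat n - y * y)) => r hr hr2.
  apply/Z.leb_spec0; rewrite Z2Nat.id //; rewrite -(Z.abs_square x) in h; nia.
rewrite inE mem_ball; have := gnE (x, y); rewrite /gnorm /=.
case: eqP => [[-> ->]|hne] /= h; first lia.
have : (0 < gn (x, y))%N by apply/gn_gt0.
lia.
Qed.

Lemma INR_size_disc n :
  INR (size (disc n)) = \sum_(y <- zsym (Nat.sqrt n)) (2 * INR (drow n y) + 1).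
Proof.
rewrite /disc size_allpairs_dep sumnE (big_morph INR INRD (erefl : INR 0 = 0)) big_map.
apply: eq_bigr => y _; rewrite /zsym size_map size_iota INRS INRD; ring.
Qed.

Lemma Nat_sqrt_bounds n : INR (Nat.sqrt n) <= sqrt (INR n) < INR (Nat.sqrt n) + 1.
Proof.
have [h1 h2] := Nat.sqrt_spec n (Nat.le_0_l n).
have p := pos_INR (Nat.sqrt n).
split.
  rewrite -(sqrt_square (INR (Nat.sqrt n))) //; apply: sqrt_le_1_alt.
  by rewrite -mult_INR; apply: le_INR.
rewrite -(sqrt_square (INR (Nat.sqrt n) + 1)); last lra.
apply: sqrt_lt_1_alt; split; first exact: pos_INR.
by rewrite -S_INR -mult_INR; apply: lt_INR.
Qed.

Lemma drow_bounds n y : (y \in zsym (Nat.sqrt n)) ->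
  Rabs (2 * INR (drow n y) + 1 - 2 * sqrt (INR n - IZR y * IZR y)) <= 1.
Proof.
rewrite mem_zsym abs_le_sqrt => h.
have -> : drow n y = Nat.sqrt (Z.to_nat (Z.of_nat n - y * y)).
  rewrite /drow -[in LHS](Z2Nat.id (Z.of_nat n - y * y)); last lia.
  set k := Z.to_nat (Z.of_nat n - y * y); have [k1 k2] := Nat.sqrt_spec k (Nat.le_0_l k).
  rewrite (Z.sqrt_unique (Z.of_nat k) (Z.of_nat (Nat.sqrt k))) ?Nat2Z.id //; lia.
have := Nat_sqrt_bounds (Z.to_nat (Z.of_nat n - y * y)).
have -> : INR (Z.to_nat (Z.of_nat n - y * y)) = INR n - IZR y * IZR y.
  rewrite INR_IZR_INZ Z2Nat.id; last lia.
  by rewrite minus_IZR mult_IZR -INR_IZR_INZ.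
by move=> hb; apply: Rabs_le; lra.
Qed.

(** Gauss's count by rows: each of the [2 m + 1] rows costs at most 1, and the sum of the
    half-chords over one quadrant differs from the integral by at most the longest of them,
    [sqrt n]. *)
Lemma ball_count n : Rabs (INR (size (ball n)) - cK * INR n) <= 6 * sqrt (INR n).
Proof.
case: n => [|n0]; first by rewrite /= Rmult_0_r Rminus_0_r Rabs_R0 sqrt_0; lra.
set n := n0.+1; have hn : 1 <= INR n by apply: INR_ge1.
set m := Nat.sqrt n; set s := sqrt (INR n).
have hs : 1 <= s by rewrite -sqrt_1; apply: sqrt_le_1_alt.
have [hm1 hm2] := Nat_sqrt_bounds n; rewrite -/m -/s in hm1 hm2.
pose f t := sqrt (INR n - t * t).
have hd x y : 0 <= x -> x <= y -> f y <= f x by move=> *; apply: sqrt_le_1_alt; nra.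
have [h1 h2] := sum_le_RInt m.+1 (ex_RInt_circle (INR n)) hd.
have [h3 _] := sum_le_RInt m (ex_RInt_circle (INR n)) hd.
have eI : RInt f 0 (INR m.+1) = INR n * (cK / 4).
  by apply: RInt_circle; [lra | rewrite INRS; rewrite -/s; lra].
have hI : RInt f 0 (INR m) <= RInt f 0 (INR m.+1).
  rewrite -(@RInt_split f 0 (INR m) (INR m.+1)); try exact: ex_RInt_circle.
  have : 0 <= RInt f (INR m) (INR m.+1).
    apply: RInt_ge_0; [rewrite INRS; lra | exact: ex_RInt_circle | move=> x _; exact: sqrt_pos].
  lra.
set T := \sum_(i <- iota 0%N m) f (INR i.+1) in h3.
have eS : \sum_(i <- iota 0%N m.+1) f (INR i) = s + T.
  rewrite /= big_cons; have -> : f (INR 0) = s by rewrite /f Rmult_0_l Rminus_0_r.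
  by rewrite (iotaDl 1 0 m) big_map.
have eZ : \sum_(y <- zsym m) f (IZR y) = s + 2 * T.
  rewrite sum_zsym (eq_bigr (fun i => f (INR i))); last by move=> i _; rewrite -INR_IZR_INZ.
  rewrite eS (iotaDl 1 0 m) big_map (eq_bigr (fun i => f (INR i.+1))); first by rewrite -/T; ring.
  move=> i _; rewrite opp_IZR -INR_IZR_INZ add1n /f; congr sqrt; ring.
have hsz : Rabs (INR (size (disc n)) - 2 * (s + 2 * T)) <= 2 * INR m + 1.
  rewrite -eZ -sum_Z INR_size_disc -/m -sum_sub; apply: Rle_trans (Rabs_sum _ _ _) _.
  apply: Rle_trans (_ : \sum_(y <- zsym m) 1 <= _).
    by apply: sum_le => y hy _; apply: drow_bounds.
  rewrite sum_const size_map size_iota INRS INRD; lra.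
move: hsz; rewrite size_disc INRS => /Rabs_le_between hsz.
rewrite -/f in h1 h2 h3; rewrite eS in h2.
apply: Rabs_le; lra.
Qed.

(** * Harmonic sums over discs *)

Definition bK (n : nat) : R := INR (size (ball n)).

Lemma sum_ballS (F : gint -> R) n :
  \sum_(a <- ball n.+1) F a = \sum_(a <- ball n) F a + \sum_(a <- sphere n.+1) F a.
Proof. by rewrite /= big_cat. Qed.

Lemma sum_sphere (f : R -> R) n :
  \sum_(a <- sphere n.+1) f (rn a) = (bK n.+1 - bK n) * f (INR n.+1).
Proof.
rewrite (eq_big_seq (fun=> f (INR n.+1))); last first.
  by move=> a; rewrite mem_sphere /rn => /eqP ->.
have e : bK n.+1 = bK n + INR (size (sphere n.+1)) by rewrite /bK size_cat INRD.
have -> : bK n.+1 - bK n = INR (size (sphere n.+1)) by rewrite e; ring.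
exact: sum_const.
Qed.

Lemma bK_le n : bK n <= (cK + 6) * INR n.
Proof.
have /Rabs_le_between h := ball_count n.
suff : sqrt (INR n) <= INR n by rewrite /bK; lra.
case: n {h} => [|n]; first by rewrite sqrt_0 /=; lra.
have h1 : 1 <= INR n.+1 by apply: INR_ge1.
have := sqrt_le_1_alt _ _ h1; rewrite sqrt_1.
have := sqrt_sqrt (INR n.+1); nra.
Qed.

Lemma sum_ball_le (f : R -> R) n :
  (forall k, (0 < k)%N -> 0 <= f (INR k)) ->
  (forall k, (0 < k)%N -> f (INR k.+1) <= f (INR k)) ->
  \sum_(a <- ball n) f (rn a) <= (cK + 6) * \sum_(k <- iota 0%N n) f (INR k.+1).
Proof.
(* Summation by parts; the added term is the nonnegative boundary term, kept so that the induction
   closes. *)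
move=> hp hd; suff : \sum_(a <- ball n) f (rn a) + ((cK + 6) * INR n - bK n) * f (INR n)
    <= (cK + 6) * \sum_(k <- iota 0%N n) f (INR k.+1).
  case: n => [|n]; first by rewrite !big_nil; lra.
  have := bK_le n.+1; have := hp n.+1 isT; nra.
elim: n => [|n IH]; first by rewrite !big_nil /bK /= ; lra.
rewrite sum_ballS sum_sphere sum_iotaS INRS -INRS.
have : 0 <= ((cK + 6) * INR n - bK n) * (f (INR n) - f (INR n.+1)).
  case: n {IH} => [|n]; first by rewrite /bK /=; lra.
  have := bK_le n.+1; have := hd n.+1 isT; nra.
move: IH; set x := \sum_(_ <- _) _; set y := \sum_(_ <- _) _.
move: (f (INR n.+1)) (f (INR n)) => f1 f0; rewrite INRS; nra.
Qed.

(** * Inequalities for roots and logarithms, and convergence with a rate *)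

Lemma sqrt_ge1 x : 1 <= x -> 1 <= sqrt x.
Proof. by move=> h; rewrite -{1}sqrt_1; apply: sqrt_le_1_alt. Qed.

Lemma sqrt_over x : 0 < x -> sqrt x / x = 1 / sqrt x.
Proof.
move=> hx; have := sqrt_sqrt x ltac:(lra); have := sqrt_lt_R0 x hx.
move: (sqrt x) => s hs <-; field; lra.
Qed.

Lemma ln_le_sub1 x : 0 < x -> ln x <= x - 1.
Proof. by move=> hx; have := exp_ineq1_le (ln x); rewrite exp_ln //; lra. Qed.

Lemma ln_sub_bounds a b : 0 < a -> a <= b -> (b - a) / b <= ln b - ln a <= (b - a) / a.
Proof.
move=> ha hab; have hb : 0 < b by lra.
have h1 := ln_le_sub1 (Rdiv_lt_0_compat _ _ hb ha).
have h2 := ln_le_sub1 (Rdiv_lt_0_compat _ _ ha hb).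
rewrite ln_div // in h1; rewrite ln_div // in h2.
have -> : (b - a) / b = 1 - a / b by field; lra.
have -> : (b - a) / a = b / a - 1 by field; lra.
lra.
Qed.

Lemma inv_sqrt_step n : (0 < n)%N ->
  1 / (INR n * sqrt (INR n)) <= 4 * (1 / sqrt (INR n) - 1 / sqrt (INR n.+1)).
Proof.
move=> hn; have h1 := INR_ge1 hn; rewrite INRS; set x := INR n in h1 *.
have hu := sqrt_ge1 h1; have hv := @sqrt_ge1 (x + 1) ltac:(lra).
have eu := sqrt_sqrt x ltac:(lra); have ev := sqrt_sqrt (x + 1) ltac:(lra).
move: hu hv eu ev; set u := sqrt x; set v := sqrt (x + 1) => hu hv eu ev.
rewrite -{1}eu; have -> : 1 / u - 1 / v = 1 / (u * v * (u + v)).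
  have e : (v - u) * (v + u) = 1 by nra.
  by apply: (Rmult_eq_reg_r (u * v * (u + v))); [field_simplify; nra | nra].
have hvu : 2 * v <= 3 * u by nra.
have -> : 4 * (1 / (u * v * (u + v))) = 1 / (u * v * (u + v) / 4) by field; nra.
apply: Rmult_le_compat_l; first lra.
apply: Rinv_le_contravar; first nra.
have : 4 * (v * (u + v)) <= 15 * (u * u) by nra.
nra.
Qed.

(** With [t n = 4 C / sqrt n], the sequence [u - t] increases and [u + t] decreases, so [L] lies
    between them at every index. This produces the analogues of Euler's constant. *)
Lemma cauchy_rate (u : nat -> R) C : 0 <= C ->
  (forall n, (0 < n)%N -> Rabs (u n.+1 - u n) <= C * (1 / (INR n * sqrt (INR n)))) ->
  exists L, forall n, (0 < n)%N -> Rabs (u n - L) <= 4 * C * (1 / sqrt (INR n)).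
Proof.
move=> hC hu; pose t n := 4 * C * (1 / sqrt (INR n)).
have ht n : (0 < n)%N -> 0 <= t n.
  move=> hn; apply: Rmult_le_pos; first lra.
  apply: Rdiv_le_0_compat; first lra.
  by apply: sqrt_lt_R0; have := INR_ge1 hn; lra.
have step n : (0 < n)%N -> u n - t n <= u n.+1 - t n.+1 /\ u n.+1 + t n.+1 <= u n + t n.
  move=> hn; have := inv_sqrt_step hn; have /Rabs_le_between := hu n hn.
  rewrite /t; set p := 1 / (_ * _); set q := 1 / _; set r := 1 / _ => h1 h2.
  have : C * p <= C * (4 * (q - r)) by apply: Rmult_le_compat_l.
  lra.
have mono n k : (0 < n)%N -> u n - t n <= u (n + k)%N - t (n + k)%N /\ u (n + k)%N + t (n + k)%N <= u n + t n.
  move=> hn; elim: k => [|k IH]; first by rewrite addn0; lra.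
  have := step (n + k)%N ltac:(lia); rewrite addnS; lra.
have cross n m : (0 < n)%N -> (0 < m)%N -> u n - t n <= u m + t m.
  move=> hn hm; have [h1 _] := mono n m hn; have [_ h2] := mono m n hm.
  have := ht (n + m)%N ltac:(lia); move: h2; rewrite [(m + n)%N]addnC; lra.
pose E x := exists2 n, (0 < n)%N & x = u n - t n.
have [L [hL1 hL2]] : {L | is_lub E L}.
  apply: completeness; last by exists (u 1%N - t 1%N), 1%N.
  by exists (u 1%N + t 1%N) => x [n hn ->]; apply: cross.
exists L => n hn; have h1 : u n - t n <= L by apply: hL1; exists n.
have h2 : L <= u n + t n by apply: hL2 => x [m hm ->]; apply: cross.
by apply: Rabs_le; rewrite -/(t n); lra.
Qed.

Definition H1 (n : nat) : R := \sum_(a <- ball n) (1 / rn a).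
(** The two arguments are separate because [y] will be a quotient [INR n / rn d] and the radius of
    the ball its integer part. *)
Definition H2 (y : R) (n : nat) : R := \sum_(a <- ball n) (ln (y / rn a) / rn a).

Lemma H1S n : H1 n.+1 = H1 n + (bK n.+1 - bK n) / INR n.+1.
Proof. rewrite /H1 sum_ballS (sum_sphere (fun x => 1 / x)); field; rewrite INRS; have := pos_INR n; lra. Qed.

Lemma inv_sq_le x : 1 <= x -> 1 / (x * x) <= 1 / (x * sqrt x).
Proof.
move=> hx; have h1 := sqrt_ge1 hx; have e := sqrt_sqrt x ltac:(lra).
apply: Rmult_le_compat_l; first lra; apply: Rinv_le_contravar; nra.
Qed.

Lemma H1_asymp : exists C g, 0 <= C /\
  forall n, (0 < n)%N -> Rabs (H1 n - cK * ln (INR n) - g) <= C * (1 / sqrt (INR n)).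
Proof.
have hc := cK_gt0.
(* Subtracting [bK n / INR n] is summation by parts: the increments then involve only the circle
   error [bK n - cK * INR n], of size [sqrt n], divided by [n (n + 1)]. *)
pose u n := H1 n - bK n / INR n - cK * ln (INR n).
have [||L hL] := @cauchy_rate u (6 + cK).
- lra.
- move=> n hn; have hn1 := INR_ge1 hn.
  have /Rabs_le_between hK := ball_count n; rewrite -/(bK n) in hK.
  have := @ln_sub_bounds (INR n) (INR n.+1) ltac:(lra) ltac:(rewrite INRS; lra).
  rewrite /u H1S INRS; set x := INR n in hn1 hK *; set D := ln (x + 1) - ln x => hD.
  have hs := sqrt_ge1 hn1; have es := sqrt_sqrt x ltac:(lra).
  have -> : H1 n + (bK n.+1 - bK n) / (x + 1) - bK n.+1 / (x + 1) - cK * ln (x + 1) -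
    (H1 n - bK n / x - cK * ln x) = (bK n - cK * x) * (1 / (x * (x + 1))) + cK * (1 / (x + 1) - D).
    by rewrite /D; field; lra.
  have i1 : 1 / (x * (x + 1)) <= 1 / (x * x).
    apply: Rmult_le_compat_l; first lra; apply: Rinv_le_contravar; nra.
  have i0 : 0 < 1 / (x * (x + 1)) by apply: Rdiv_lt_0_compat; nra.
  have i2 := inv_sq_le hn1.
  have i3 : sqrt x * (1 / (x * x)) = 1 / (x * sqrt x) by transitivity (sqrt x / x * (1 / x)); [field; lra | rewrite sqrt_over; [field; lra | lra]].
  have d1 : (x + 1 - x) / (x + 1) = 1 / (x + 1) by field; lra.
  have d2 : (x + 1 - x) / x = 1 / (x + 1) + 1 / (x * (x + 1)) by field; lra.
  rewrite d1 d2 in hD.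
  have j1 : Rabs ((bK n - cK * x) * (1 / (x * (x + 1)))) <= 6 * (1 / (x * sqrt x)).
    rewrite Rabs_mult (Rabs_right (1 / _)); last lra.
    have : Rabs (bK n - cK * x) <= 6 * sqrt x by apply: Rabs_le; lra.
    move: (Rabs_pos (bK n - cK * x)); nra.
  have j2 : Rabs (cK * (1 / (x + 1) - D)) <= cK * (1 / (x * sqrt x)).
    rewrite Rabs_mult (Rabs_right cK); last lra.
    apply: Rmult_le_compat_l; [lra | apply: Rabs_le; lra].
  apply: Rle_trans (Rabs_triang _ _) _; lra.
(* The summand [cK] in the constant is the limit of [bK n / INR n], which [u] leaves out. *)
exists (4 * (6 + cK) + 6), (L + cK); split; first lra.
move=> n hn; have hn1 := INR_ge1 hn; have /Rabs_le_between := hL n hn.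
have /Rabs_le_between hK := ball_count n; rewrite -/(bK n) in hK.
rewrite /u; set x := INR n in hn1 hK *.
have hs := sqrt_ge1 hn1; have es := sqrt_sqrt x ltac:(lra).
have k1 : bK n / x - cK = (bK n - cK * x) / x by field; lra.
have k2 : sqrt x / x = 1 / sqrt x by apply: sqrt_over; lra.
have k3 : Rabs (bK n / x - cK) <= 6 * (1 / sqrt x).
  rewrite k1 -k2 Rabs_div; last lra. rewrite (Rabs_right x); last lra.
  have -> : 6 * (sqrt x / x) = (6 * sqrt x) / x by field; lra.
  apply: Rmult_le_compat_r; first by left; apply: Rinv_0_lt_compat; lra.
  by apply: Rabs_le; lra.
by move/Rabs_le_between: k3 => k3 h; apply: Rabs_le; lra.
Qed.

Lemma sum_ball_ln (y : R) n : 0 < y ->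
  H2 y n = \sum_(a <- ball n) ((ln y - ln (rn a)) * (1 / rn a)).
Proof.
move=> hy; apply: sum_eq => a /ball_neq0 /rn_gt0 ha _.
by rewrite ln_div //; field; lra.
Qed.

Lemma H2_shift y z n : 0 < y -> 0 < z -> H2 z n = H2 y n + H1 n * (ln z - ln y).
Proof.
move=> hy hz; rewrite !sum_ball_ln // /H1 -sum_Zr -sum_add; apply: eq_bigr => a _; ring.
Qed.

Lemma H2S y n : 0 < y -> H2 y n.+1 = H2 y n + (bK n.+1 - bK n) * ((ln y - ln (INR n.+1)) * (1 / INR n.+1)).
Proof.
by move=> hy; rewrite !sum_ball_ln // sum_ballS (sum_sphere (fun x => (ln y - ln x) * (1 / x))).
Qed.

(** The points of norm [n + 1] enter with [ln 1 = 0], so raising both arguments adds [H1 n * D],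
    where [D] is the increment of [ln]. The chosen quadratic in [ln] removes its main part and
    leaves the error of [H1] times [D], and [D ^ 2]. *)
Lemma H2_asymp C g : 0 <= C ->
  (forall n, (0 < n)%N -> Rabs (H1 n - cK * ln (INR n) - g) <= C * (1 / sqrt (INR n))) ->
  exists C' g', 0 <= C' /\ forall n, (0 < n)%N ->
    Rabs (H2 (INR n) n - cK / 2 * ln (INR n) ^ 2 - g * ln (INR n) - g') <= C' * (1 / sqrt (INR n)).
Proof.
move=> hC h1; have hc := cK_gt0.
pose u n := H2 (INR n) n - cK / 2 * ln (INR n) ^ 2 - g * ln (INR n).
have [||L hL] := @cauchy_rate u (C + cK).
- lra.
- move=> n hn; have hn1 := INR_ge1 hn; have h := h1 n hn.
  have := @ln_sub_bounds (INR n) (INR n.+1) ltac:(lra) ltac:(rewrite INRS; lra).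
  have hx1 : 0 < INR n.+1 by rewrite INRS; lra.
  rewrite /u H2S // (@H2_shift (INR n) (INR n.+1)) //; last lra.
  rewrite INRS; set x := INR n in hn1 h *.
  have -> : ln (x + 1) = ln x + (ln (x + 1) - ln x) by ring.
  set D := ln (x + 1) - ln x; have eD : ln x + D - ln x = D by ring.
  rewrite eD => hD.
  set e := H1 n - cK * ln x - g in h.
  have -> : H2 x n + H1 n * D + (bK n.+1 - bK n) * ((ln x + D - (ln x + D)) * (1 / (x + 1)))
    - cK / 2 * (ln x + D) ^ 2 - g * (ln x + D) - (H2 x n - cK / 2 * ln x ^ 2 - g * ln x)
    = e * D + (- cK / 2) * (D * D) by rewrite /e; field; lra.
  have hs := sqrt_ge1 hn1; have es := sqrt_sqrt x ltac:(lra).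
  have D0 : 0 <= D.
    apply: Rle_trans (proj1 hD); apply: Rdiv_le_0_compat; lra.
  have D1 : D <= 1 / x by apply: Rle_trans (proj2 hD) _; right; field; lra.
  have i0 : 0 < 1 / x by apply: Rdiv_lt_0_compat; lra.
  have j1 : Rabs (e * D) <= C * (1 / (x * sqrt x)).
    rewrite Rabs_mult (Rabs_right D); last lra.
    have -> : C * (1 / (x * sqrt x)) = C * (1 / sqrt x) * (1 / x) by field; lra.
    by apply: Rmult_le_compat => //; exact: Rabs_pos.
  have j2 : Rabs (- cK / 2 * (D * D)) <= cK * (1 / (x * sqrt x)).
    have i2 := inv_sq_le hn1.
    have e2 : 1 / (x * x) = (1 / x) * (1 / x) by field; lra.
    have : 0 <= D * D <= 1 / (x * sqrt x) by nra.
    move=> hDD; apply: Rabs_le; nra.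
  apply: Rle_trans (Rabs_triang _ _) _; lra.
exists (4 * (C + cK)), L; split; first lra.
by move=> n hn; apply: hL.
Qed.

Lemma harmonic_asymp : exists C g g', 0 <= C /\ forall n y, (0 < n)%N -> INR n <= y < INR n + 1 ->
  [/\ Rabs (bK n / y - cK) <= C * (1 / sqrt y),
      Rabs (H1 n - cK * ln y - g) <= C * (1 / sqrt y) &
      Rabs (H2 y n - cK / 2 * ln y ^ 2 - g * ln y - g') <= C * (1 / sqrt y)].
Proof.
have hc := cK_gt0.
have [C1 [g [hC1 h1]]] := H1_asymp.
have [C2 [g' [hC2 h2]]] := H2_asymp hC1 h1.
exists (6 + 4 * cK + 4 * C1 + 2 * C2), g, g'; split; first lra.
move=> n y hn hy; have hn1 := INR_ge1 hn.
have /Rabs_le_between hK := ball_count n; rewrite -/(bK n) in hK.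
have := h1 n hn; have := h2 n hn.
have := @ln_sub_bounds (INR n) y ltac:(lra) ltac:(lra).
rewrite (@H2_shift (INR n) y); [|lra|lra].
set x := INR n in hn1 hK hy *.
have hs := sqrt_ge1 hn1; have es := sqrt_sqrt x ltac:(lra).
have hy1 : 1 <= y by lra.
have hsy := sqrt_ge1 hy1; have esy := sqrt_sqrt y ltac:(lra).
have hxy : sqrt x <= sqrt y by apply: sqrt_le_1_alt; lra.
have hxy2 : sqrt y <= 2 * sqrt x by nra.
have -> : ln y = ln x + (ln y - ln x) by ring.
set D := ln y - ln x; have eD : ln x + D - ln x = D by ring.
rewrite eD => hD.
set i := 1 / sqrt y; have i0 : 0 < i by apply: Rdiv_lt_0_compat; lra.
have ix : 1 / sqrt x <= 2 * i.
  rewrite /i; have -> : 2 * (1 / sqrt y) = 1 / (sqrt y / 2) by field; lra.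
  apply: Rmult_le_compat_l; first lra; apply: Rinv_le_contravar; lra.
have ix0 : 0 < 1 / sqrt x by apply: Rdiv_lt_0_compat; lra.
have D0 : 0 <= D by apply: Rle_trans (proj1 hD); apply: Rdiv_le_0_compat; lra.
have i0x : 0 < 1 / x by apply: Rdiv_lt_0_compat; lra.
have i1x : 1 / x <= 1 / sqrt x.
  apply: Rmult_le_compat_l; first lra; apply: Rinv_le_contravar; nra.
have i11 : 1 / x <= 1.
  rewrite -[X in _ <= X](Rmult_1_l 1) -{3}Rinv_1; apply: Rmult_le_compat_l; first lra.
  apply: Rinv_le_contravar; lra.
have D1 : D <= 1 / x.
  apply: Rle_trans (proj2 hD) _; apply: Rmult_le_compat_r; last lra.
  by left; apply: Rinv_0_lt_compat; lra.
set e1 := H1 n - cK * ln x - g => b2 b1.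
split.
- have -> : bK n / y - cK = (bK n - cK * y) / y by field; lra.
  rewrite Rabs_div; last lra. rewrite (Rabs_right y); last lra.
  apply: Rle_trans (_ : ((6 + cK) * sqrt y) / y <= _).
    apply: Rmult_le_compat_r; first by left; apply: Rinv_0_lt_compat; lra.
    apply: Rabs_le; nra.
  have -> : (6 + cK) * sqrt y / y = (6 + cK) * i by rewrite /i -sqrt_over; [field; lra | lra].
  nra.
- have -> : H1 n - cK * (ln x + D) - g = e1 - cK * D by rewrite /e1; ring.
  move/Rabs_le_between: b1 => b1; apply: Rabs_le; nra.
- set e2 := H2 x n - _ - _ - _ in b2.
  have -> : H2 x n + H1 n * D - cK / 2 * (ln x + D) ^ 2 - g * (ln x + D) - g' =
    e2 + (e1 * D - cK / 2 * (D * D)) by rewrite /e2 /e1; field.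
  apply: Rle_trans (Rabs_triang _ _) _.
  have j : Rabs (e1 * D - cK / 2 * (D * D)) <= (2 * C1 + cK) * i.
    have jj : Rabs (e1 * D) <= 2 * C1 * i.
      rewrite Rabs_mult (Rabs_right D); last lra.
      have := Rabs_pos e1; nra.
    have DD : 0 <= D * D <= 2 * i by nra.
    have : 0 <= cK * (D * D) <= cK * (2 * i) by nra.
    by move/Rabs_le_between: jj => jj cDD; apply: Rabs_le; lra.
  have : C2 * (1 / sqrt x) <= C2 * (2 * i) by apply: Rmult_le_compat_l.
  nra.
Qed.

(** * Weighted Möbius sums *)

(** Fourth root. Weakening an error [1 / sqrt y] to [1 / q4 y] makes room for a factor [ln y]. *)
Definition q4 (x : R) : R := sqrt (sqrt x).

Lemma q4_ge1 x : 1 <= x -> 1 <= q4 x.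
Proof. by move=> h; apply/sqrt_ge1/sqrt_ge1. Qed.
Lemma q4_sq x : q4 x * q4 x = sqrt x.
Proof. by apply: sqrt_sqrt; apply: sqrt_pos. Qed.
Lemma q4_4 x : 0 <= x -> q4 x ^ 4 = x.
Proof.
move=> hx; have -> : q4 x ^ 4 = (q4 x * q4 x) * (q4 x * q4 x) by ring.
by rewrite q4_sq sqrt_sqrt.
Qed.
Lemma q4_div x y : 0 <= x -> 0 < y -> q4 (x / y) = q4 x / q4 y.
Proof. by move=> hx hy; rewrite /q4 sqrt_div // sqrt_div //; [exact: sqrt_pos | exact: sqrt_lt_R0]. Qed.
Lemma q4_gt0 x : 0 < x -> 0 < q4 x.
Proof. by move=> hx; apply/sqrt_lt_R0/sqrt_lt_R0. Qed.

Lemma ln_sqrt x : 0 < x -> ln (sqrt x) = ln x / 2.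
Proof.
move=> hx; have h := sqrt_lt_R0 _ hx.
have : ln (sqrt x * sqrt x) = ln x by rewrite sqrt_sqrt //; lra.
rewrite ln_mult //; lra.
Qed.
Lemma ln_le_sqrt x : 0 < x -> ln x <= 2 * sqrt x.
Proof. by move=> hx; have := ln_le_sub1 (sqrt_lt_R0 _ hx); rewrite ln_sqrt //; lra. Qed.
Lemma ln_le_q4 x : 0 < x -> ln x <= 4 * q4 x.
Proof. by move=> hx; have := ln_le_sqrt (sqrt_lt_R0 _ hx); rewrite ln_sqrt //  /q4; lra. Qed.
Lemma ln_ge0 x : 1 <= x -> 0 <= ln x.
Proof. by move=> hx; rewrite -ln_1; apply: ln_le; lra. Qed.

Lemma sum_q4 n : \sum_(k <- iota 0%N n) (1 / q4 (INR k.+1) ^ 3) <= 4 * q4 (INR n).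
Proof.
elim: n => [|n IH]; first by rewrite big_nil /q4 /= !sqrt_0; lra.
rewrite sum_iotaS.
suff : 1 / q4 (INR n.+1) ^ 3 <= 4 * (q4 (INR n.+1) - q4 (INR n)) by lra.
have hn := pos_INR n; have e1 := q4_4 hn; have e2 := q4_4 (pos_INR n.+1).
rewrite {1}INRS in e2.
have hu : 1 <= q4 (INR n.+1) by apply/q4_ge1/INR_ge1.
have hv : 0 <= q4 (INR n) by apply: sqrt_pos.
have huv : q4 (INR n) <= q4 (INR n.+1).
  by apply/sqrt_le_1_alt/sqrt_le_1_alt; rewrite INRS; lra.
move: hu hv huv e1; rewrite INRS in e2 *; move: e2.
move: (q4 (INR n + 1)) (q4 (INR n)) => u v e2 hu hv huv e1.
apply: (Rmult_le_reg_r (u ^ 3)); first by apply: pow_lt; lra.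
have -> : 1 / u ^ 3 * u ^ 3 = 1 by field; lra.
have e : (u - v) * (u ^ 3 + u ^ 2 * v + u * v ^ 2 + v ^ 3) = 1 by nra.
have h2 : u ^ 2 * v <= u ^ 3 by nra.
have h3 : u * v ^ 2 <= u ^ 3 by nra.
have h4 : v ^ 3 <= u ^ 3 by apply: pow_incr.
nra.
Qed.

Definition C0 : R := cK + 6.
Lemma C0_gt0 : 0 < C0. Proof. by have := cK_gt0; rewrite /C0; lra. Qed.

Lemma sum_ball_q4 n : \sum_(a <- ball n) (1 / q4 (rn a) ^ 3) <= 4 * C0 * q4 (INR n).
Proof.
have h : \sum_(a <- ball n) (1 / q4 (rn a) ^ 3) <= C0 * \sum_(k <- iota 0%N n) (1 / q4 (INR k.+1) ^ 3).
  apply: (sum_ball_le (f := fun x => 1 / q4 x ^ 3)) => k hk.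
    have := q4_gt0 (x := INR k) ltac:(have := INR_ge1 hk; lra) => h.
    by apply: Rdiv_le_0_compat; [lra | apply: pow_lt].
  have h := q4_gt0 (x := INR k) ltac:(have := INR_ge1 hk; lra).
  apply: Rmult_le_compat_l; first lra; apply: Rinv_le_contravar; first exact: pow_lt.
  apply: pow_incr; split; first lra.
  by apply/sqrt_le_1_alt/sqrt_le_1_alt; rewrite INRS; lra.
apply: Rle_trans h _; have := C0_gt0; have := sum_q4 n; nra.
Qed.

Lemma ball_quot n d : d \in ball n ->
  (0 < n %/ gn d)%N /\ INR (n %/ gn d) <= INR n / rn d < INR (n %/ gn d) + 1.
Proof.
rewrite mem_ball => /andP [h1 h2]; split; first by rewrite divn_gt0.
have hd : 0 < rn d by rewrite /rn; have := INR_ge1 h1; lra.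
have a1 := INR_le (leq_divM n (gn d)).
have a2 := INR_lt (ltn_ceil n h1).
rewrite INRM -/(rn d) in a1; rewrite INRM INRS -/(rn d) in a2.
split.
  apply: (Rmult_le_reg_r (rn d)) => //; have -> : INR n / rn d * rn d = INR n by field; lra.
  exact: a1.
apply: (Rmult_lt_reg_r (rn d)) => //; have -> : INR n / rn d * rn d = INR n by field; lra.
exact: a2.
Qed.

Lemma ball_quot_ge1 n d : d \in ball n -> 1 <= INR n / rn d.
Proof. by move/ball_quot => [h1 [h2 _]]; apply: Rle_trans h2; apply: INR_ge1. Qed.

(** After [Rabs_mu] the sum is at most [C * n^(-1/4)] times that of [N(d)^(-3/4)], which is of order
    [n^(1/4)]. Errors that decay in [n / N(d)] thus add up to a bounded amount. *)
Lemma mobius_sum_err n (e : gint -> R) C : 0 <= C ->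
  (forall d, d \in ball n -> Rabs (e d) <= C * (1 / q4 (INR n / rn d))) ->
  Rabs (\sum_(d <- ball n) (mu d / rn d * e d)) <= 4 * C0 * C.
Proof.
move=> hC he; case: n he => [|n0] he.
  by rewrite big_nil Rabs_R0; have := C0_gt0; nra.
set n := n0.+1 in he *; have hn : 1 <= INR n by apply: INR_ge1.
have hq := q4_gt0 (x := INR n) ltac:(lra).
apply: Rle_trans (Rabs_sum _ _ _) _.
apply: Rle_trans (_ : \sum_(d <- ball n) (C / q4 (INR n) * (1 / q4 (rn d) ^ 3)) <= _).
  apply: sum_le => d hd _; have hd0 := rn_gt0 (ball_neq0 hd).
  rewrite Rabs_mult; have hr : Rabs (mu d / rn d) <= 1 / rn d.
    rewrite Rabs_div; last lra. rewrite (Rabs_right (rn d)); last lra.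
    apply: Rmult_le_compat_r; last exact: Rabs_mu.
    by left; apply: Rinv_0_lt_compat.
  apply: Rle_trans (Rmult_le_compat _ _ _ _ (Rabs_pos _) (Rabs_pos _) hr (he d hd)) _.
  right; rewrite q4_div; [|lra|lra].
  have := q4_4 (Rlt_le _ _ hd0); have := q4_gt0 hd0; move: (q4 (rn d)) => q hq0 <-.
  by field; lra.
rewrite sum_Z; apply: Rle_trans (_ : C / q4 (INR n) * (4 * C0 * q4 (INR n)) <= _).
  by apply: Rmult_le_compat_l; [apply: Rdiv_le_0_compat | exact: sum_ball_q4].
by right; field; lra.
Qed.

Lemma mem_units_ball n a : (0 < n)%N -> (a \in [seq a <- ball n | gn a == 1%N]) = (a \in gunits).
Proof.
move=> hn; rewrite mem_filter mem_ball mem_gunits; have := gnE a; have := gnorm_ge0 a.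
by move=> h1 h2; apply/andP/eqP; lia.
Qed.

Lemma sum_units n (F : gint -> R) c : (0 < n)%N ->
  (forall a, gunit a -> F a = c) -> \sum_(a <- ball n | gn a == 1%N) F a = 4 * c.
Proof.
move=> hn hF; rewrite -big_filter (perm_big gunits); last first.
  by apply: uniq_perm => [|//|a]; [exact/filter_uniq/uniq_ball | exact: mem_units_ball].
rewrite (eq_big_seq (fun=> c)); first by rewrite sum_const /=; ring.
by move=> a; rewrite mem_gunits => /eqP /gunitP; apply: hF.
Qed.

(** Collect the terms by the product [m = d a]. The sum of [mu] over the divisors of [m] is 4 for
    units and 0 otherwise, and there are four units. *)
Lemma mobius_inversion (g : R -> R) n : (0 < n)%N ->
  \sum_(d <- ball n) (mu d / rn d *
     \sum_(a <- ball (n %/ gn d)) (g (INR n / rn d / rn a) / rn a)) = 16 * g (INR n).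
Proof.
move=> hn.
rewrite (eq_big_seq (fun d => \sum_(m <- ball n | asb (gdvd d m)) (mu d * (g (INR n / rn m) / rn m)))).
  rewrite (exchange_big_dep xpredT) //=.
  rewrite (eq_big_seq (fun m => if gn m == 1%N then 4 * g (INR n) else 0)).
    by rewrite -big_mkcond (sum_units (c := 4 * g (INR n))) //; ring.
  move=> m hm; have hm0 := ball_neq0 hm; rewrite sum_Zr.
  have -> : \sum_(d <- ball n | asb (gdvd d m)) mu d = dsum (fun=> 1) m.
    rewrite dsum_ball //; last by move: hm; rewrite mem_ball => /andP [].
    by apply: eq_bigr => d _; ring.
  case: eqP => [h|h]; last first.
    by rewrite dsum_const //; [ring | move/gn_unit].
  rewrite dsum_unit; last by apply/gn_unit.
  have -> : rn m = 1 by rewrite /rn h.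
  have -> : INR n / 1 = INR n by field.
  by field.
move=> d hd; have hd0 := ball_neq0 hd.
under [RHS]eq_bigl do rewrite -[asb _]andbT.
rewrite (reindex_ball _ xpredT) // -sum_Z; apply: sum_eq => a /ball_neq0 /rn_gt0 ha _.
have hd1 := rn_gt0 hd0; rewrite rnM.
have -> : INR n / (rn d * rn a) = INR n / rn d / rn a by field; lra.
by field; lra.
Qed.

Definition Mj (j n : nat) : R := \sum_(d <- ball n) (mu d / rn d * ln (INR n / rn d) ^ j).

Lemma inv_sqrt_le_q4 y : 1 <= y -> 1 / sqrt y <= 1 / q4 y.
Proof.
move=> hy; have h := q4_ge1 hy; rewrite -q4_sq; apply: Rmult_le_compat_l; first lra.
apply: Rinv_le_contravar; nra.
Qed.

(** Inversion is applied to [1 / y], [1] and [ln y]. The inner sums are [cK], [cK ln y + g] and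
    [cK/2 ln^2 y + g ln y + g'] up to errors, which gives a triangular system for the three sums
    with right sides [16 / n], [16] and [16 ln n]. *)
Lemma Mj_bounds : exists B, 0 <= B /\ forall n, (0 < n)%N ->
  [/\ Rabs (Mj 0 n) <= B, Rabs (Mj 1 n) <= B & Rabs (Mj 2 n - 32 / cK * ln (INR n)) <= B].
Proof.
have hc := cK_gt0; have hC0 := C0_gt0.
have [C [g [g' [hC hH]]]] := harmonic_asymp.
pose E := 4 * C0 * C; have hE : 0 <= E by rewrite /E; nra.
pose B0 := (16 + E) / cK.
have hB0 : 0 <= B0 by apply: Rdiv_le_0_compat; lra.
pose B1 := (16 + E + Rabs g * B0) / cK.
have hB1 : 0 <= B1 by apply: Rdiv_le_0_compat => //; have := Rabs_pos g; nra.
pose B2 := 2 * (E + Rabs g * B1 + Rabs g' * B0) / cK.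
have hB2 : 0 <= B2.
  by apply: Rdiv_le_0_compat => //; have := Rabs_pos g; have := Rabs_pos g'; nra.
exists (B0 + B1 + B2); split; first lra.
move=> n hn; have hn1 := INR_ge1 hn.
have hH' d (hd : d \in ball n) : let y := INR n / rn d in let m := (n %/ gn d)%N in
  [/\ Rabs (bK m / y - cK) <= C * (1 / q4 y), Rabs (H1 m - cK * ln y - g) <= C * (1 / q4 y)
    & Rabs (H2 y m - cK / 2 * ln y ^ 2 - g * ln y - g') <= C * (1 / q4 y)].
  move=> y m; have [h1 h2] := ball_quot hd; have [a1 a2 a3] := hH _ _ h1 h2.
  have hy := ball_quot_ge1 hd.
  have : C * (1 / sqrt y) <= C * (1 / q4 y) by apply: Rmult_le_compat_l => //; apply: inv_sqrt_le_q4.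
  by move=> h; split; apply: Rle_trans h.
have i0 := mobius_inversion (fun y => 1 / y) hn.
have i1 := mobius_inversion (fun=> 1) hn.
have i2 := mobius_inversion ln hn.
have e0 : cK * Mj 0 n = 16 / INR n - \sum_(d <- ball n) (mu d / rn d * (bK (n %/ gn d) / (INR n / rn d) - cK)).
  have -> : 16 / INR n = 16 * (1 / INR n) by field; lra.
  rewrite -i0 -sum_Z -sum_sub; apply: sum_eq => d hd _.
  have hd0 := rn_gt0 (ball_neq0 hd).
  have -> : \sum_(a <- ball (n %/ gn d)) (1 / (INR n / rn d / rn a) / rn a) = bK (n %/ gn d) / (INR n / rn d).
    rewrite (eq_big_seq (fun=> 1 / (INR n / rn d))); last first.
      by move=> a /ball_neq0 /rn_gt0 ha; field; lra.
    by rewrite sum_const -/(bK _); field; lra.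
  by rewrite /=; ring.
have e1 : cK * Mj 1 n + g * Mj 0 n = 16 - \sum_(d <- ball n) (mu d / rn d * (H1 (n %/ gn d) - cK * ln (INR n / rn d) - g)).
  have -> : 16 = 16 * 1 by ring.
  rewrite -i1 -!sum_Z -sum_add -sum_sub; apply: sum_eq => d hd _.
  by rewrite -/(H1 _) /=; ring.
have e2 : cK / 2 * Mj 2 n + g * Mj 1 n + g' * Mj 0 n = 16 * ln (INR n) - \sum_(d <- ball n)
   (mu d / rn d * (H2 (INR n / rn d) (n %/ gn d) - cK / 2 * ln (INR n / rn d) ^ 2 - g * ln (INR n / rn d) - g')).
  rewrite -i2 -!sum_Z -!sum_add -sum_sub; apply: sum_eq => d hd _.
  by rewrite -/(H2 _ _) /=; field; have := rn_gt0 (ball_neq0 hd); lra.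
have r0 : Rabs (cK * Mj 0 n) <= 16 + E.
  have : Rabs (\sum_(d <- ball n) (mu d / rn d * (bK (n %/ gn d) / (INR n / rn d) - cK))) <= E by apply: mobius_sum_err => // d /hH' [].
  move/Rabs_le_between; rewrite e0 => h; have : 0 < 16 / INR n <= 16.
    split; first by apply: Rdiv_lt_0_compat; lra.
    apply: (Rmult_le_reg_r (INR n)); first lra.
    have -> : 16 / INR n * INR n = 16 by field; lra.
    lra.
  by move=> h'; apply: Rabs_le; lra.
have b0 : Rabs (Mj 0 n) <= B0.
  move: r0; rewrite Rabs_mult (Rabs_right cK); last lra.
  by move=> h; apply: (Rmult_le_reg_l cK) => //; rewrite /B0; have -> : cK * ((16 + E) / cK) = 16 + E by field; lra.
have gb j x B : Rabs (Mj j n) <= B -> Rabs (x * Mj j n) <= Rabs x * B.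
  by move=> h; rewrite Rabs_mult; apply: Rmult_le_compat_l => //; apply: Rabs_pos.
have b1 : Rabs (Mj 1 n) <= B1.
  have : Rabs (\sum_(d <- ball n) (mu d / rn d * (H1 (n %/ gn d) - cK * ln (INR n / rn d) - g))) <= E by apply: mobius_sum_err => // d /hH' [].
  move/Rabs_le_between => h; have /Rabs_le_between h' := gb 0%N g _ b0.
  have : Rabs (cK * Mj 1 n) <= 16 + E + Rabs g * B0 by apply: Rabs_le; lra.
  rewrite Rabs_mult (Rabs_right cK); last lra.
  move=> h2; apply: (Rmult_le_reg_l cK) => //; rewrite /B1.
  by have -> : cK * ((16 + E + Rabs g * B0) / cK) = 16 + E + Rabs g * B0 by field; lra.
split; [lra | lra |].
  have : Rabs (\sum_(d <- ball n) (mu d / rn d * (H2 (INR n / rn d) (n %/ gn d) - cK / 2 * ln (INR n / rn d) ^ 2 - g * ln (INR n / rn d) - g'))) <= E by apply: mobius_sum_err => // d /hH' [].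
move/Rabs_le_between => h; have /Rabs_le_between h' := gb 0%N g' _ b0.
have /Rabs_le_between h'' := gb 1%N g _ b1.
apply: Rle_trans (_ : B2 <= _); last lra.
have : Rabs (cK / 2 * (Mj 2 n - 32 / cK * ln (INR n))) <= E + Rabs g * B1 + Rabs g' * B0.
  have -> : cK / 2 * (Mj 2 n - 32 / cK * ln (INR n)) = cK / 2 * Mj 2 n - 16 * ln (INR n) by field; lra.
  by apply: Rabs_le; lra.
rewrite Rabs_mult (Rabs_right (cK / 2)); last lra.
move=> h2; apply: (Rmult_le_reg_l (cK / 2)); first lra.
by have -> : cK / 2 * B2 = E + Rabs g * B1 + Rabs g' * B0 by rewrite /B2; field; lra.
Qed.

(** * Mertens' estimate *)

Lemma exchange_dsum (P : pred gint) (w G : gint -> R) n :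
  \sum_(a <- ball n | P a) (w a * \sum_(d <- ball n | asb (gdvd d a)) (mu d * G d)) =
  \sum_(d <- ball n) (mu d * G d * \sum_(a <- ball n | asb (gdvd d a) && P a) w a).
Proof.
rewrite (eq_bigr (fun a => \sum_(d <- ball n | asb (gdvd d a)) (mu d * G d * w a))); last first.
  by move=> a _; rewrite -sum_Z; apply: eq_bigr => d _; ring.
rewrite (exchange_big_dep xpredT) //=; apply: eq_bigr => d _.
by rewrite sum_Z; congr (_ * _); apply: eq_bigl => a; rewrite andbC.
Qed.

Lemma dsum_eq_ball G n a : a \in ball n ->
  dsum G a = \sum_(d <- ball n | asb (gdvd d a)) (mu d * G (rn d)).
Proof.
move=> ha; rewrite /dsum (dsum_ball (n := n)) //; first exact: ball_neq0 ha.
by move: ha; rewrite mem_ball => /andP [].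
Qed.

(** Summing over the multiples of [d] first produces [mu d / N(d) * ln (n / N(d)) * H1], hence
    [cK * Mj 2 + g * Mj 1] up to a bounded error. *)
Lemma sum_dsum_ln : exists B, 0 <= B /\ forall n, (0 < n)%N ->
  Rabs (\sum_(a <- ball n) (1 / rn a * dsum (fun t => ln (INR n) - ln t) a) - 32 * ln (INR n)) <= B.
Proof.
have hc := cK_gt0; have hC0 := C0_gt0.
have [C [g [g' [hC hH]]]] := harmonic_asymp.
have [B [hB hM]] := Mj_bounds.
exists (cK * B + Rabs g * B + 4 * C0 * (4 * C)); split.
  have := Rabs_pos g; nra.
move=> n hn; have hn1 := INR_ge1 hn; have [_ b1 b2] := hM n hn.
pose e d := ln (INR n / rn d) * (H1 (n %/ gn d) - cK * ln (INR n / rn d) - g).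
have -> : \sum_(a <- ball n) (1 / rn a * dsum (fun t => ln (INR n) - ln t) a) =
   cK * Mj 2 n + g * Mj 1 n + \sum_(d <- ball n) (mu d / rn d * e d).
  rewrite (eq_big_seq (fun a => 1 / rn a * \sum_(d <- ball n | asb (gdvd d a)) (mu d * (ln (INR n) - ln (rn d))))); last first.
    by move=> a ha; rewrite (dsum_eq_ball _ ha).
  rewrite (exchange_dsum xpredT _ (fun d => ln (INR n) - ln (rn d))).
  rewrite -!sum_Z -!sum_add; apply: sum_eq => d hd _.
  have hd0 := rn_gt0 (ball_neq0 hd).
  rewrite (reindex_ball _ xpredT) //; last exact: ball_neq0 hd.
  rewrite (eq_big_seq (fun a => 1 / rn d * (1 / rn a))); last first.
    by move=> a /ball_neq0 /rn_gt0 ha; rewrite rnM; field; lra.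
  rewrite sum_Z -/(H1 _) -ln_div //; last lra.
  by rewrite /e /=; field; lra.
have he : Rabs (\sum_(d <- ball n) (mu d / rn d * e d)) <= 4 * C0 * (4 * C).
  apply: mobius_sum_err => [|d hd]; first lra.
  have [h1 h2] := ball_quot hd; have [_ h _] := hH _ _ h1 h2.
  have hy := ball_quot_ge1 hd; move: h; rewrite /e; set y := INR n / rn d in hy *.
  set x := H1 _ - _ - _ => h; rewrite Rabs_mult.
  have hq := q4_ge1 hy; have hl := ln_le_q4 (x := y) ltac:(lra); have hl0 := ln_ge0 hy.
  rewrite (Rabs_right (ln y)); last lra.
  apply: Rle_trans (_ : 4 * q4 y * (C * (1 / sqrt y)) <= _).
    by apply: Rmult_le_compat => //; exact: Rabs_pos.
  right; rewrite -q4_sq; field; lra.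
have hg : Rabs (g * Mj 1 n) <= Rabs g * B.
  by rewrite Rabs_mult; apply: Rmult_le_compat_l => //; apply: Rabs_pos.
have hcM : Rabs (cK * (Mj 2 n - 32 / cK * ln (INR n))) <= cK * B.
  by rewrite Rabs_mult (Rabs_right cK); [apply: Rmult_le_compat_l; lra | lra].
have -> : cK * Mj 2 n + g * Mj 1 n + \sum_(d <- ball n) (mu d / rn d * e d) - 32 * ln (INR n) =
   cK * (Mj 2 n - 32 / cK * ln (INR n)) + (g * Mj 1 n + \sum_(d <- ball n) (mu d / rn d * e d)) by field; lra.
apply: Rle_trans (Rabs_triang _ _) _.
have := Rabs_triang (g * Mj 1 n) (\sum_(d <- ball n) (mu d / rn d * e d)).
lra.
Qed.

Lemma sum_inv_x_sqrt n : \sum_(k <- iota 0%N n) (1 / (INR k.+1 * sqrt (INR k.+1))) <= 4.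
Proof.
suff : \sum_(k <- iota 0%N n) (1 / (INR k.+1 * sqrt (INR k.+1))) <= 4 - 4 * (1 / sqrt (INR n.+1)).
  have : 0 < 1 / sqrt (INR n.+1).
    by apply: Rdiv_lt_0_compat; [lra | apply: sqrt_lt_R0; have := @INR_ge1 n.+1 isT; lra].
  lra.
elim: n => [|n IH]; first by rewrite big_nil /= sqrt_1; lra.
by rewrite sum_iotaS; have := @inv_sqrt_step n.+1 isT; lra.
Qed.

Lemma sum_ball_inv_x_sqrt n : \sum_(a <- ball n) (1 / (rn a * sqrt (rn a))) <= 4 * C0.
Proof.
have hk k : (0 < k)%N -> 0 < INR k * sqrt (INR k).
  move=> /INR_ge1 h; have := sqrt_ge1 h; nra.
have : \sum_(a <- ball n) (1 / (rn a * sqrt (rn a))) <=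
    C0 * \sum_(k <- iota 0%N n) (1 / (INR k.+1 * sqrt (INR k.+1))).
  apply: (sum_ball_le (f := fun x => 1 / (x * sqrt x))) => k h.
    by apply: Rdiv_le_0_compat; [lra | exact: hk].
  apply: Rmult_le_compat_l; first lra; apply: Rinv_le_contravar; first exact: hk.
  have h1 := INR_ge1 h; have := sqrt_ge1 h1.
  have : sqrt (INR k) <= sqrt (INR k.+1) by apply: sqrt_le_1_alt; rewrite INRS; lra.
  by rewrite INRS; nra.
by have := sum_inv_x_sqrt n; have := C0_gt0; nra.
Qed.

Lemma rn_pow p k : rn (gpow p k) = rn p ^ k.
Proof. by elim: k => [|k IH] //; rewrite gpowS rnM IH. Qed.

Lemma rn_unit u : gunit u -> rn u = 1.
Proof. by move/gn_unit => h; rewrite /rn h. Qed.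

Lemma sum_geom x n : 2 <= x ->
  \sum_(k <- iota 0%N n) (1 / x ^ k.+2) <= 2 * (1 / x ^ 2).
Proof.
move=> hx; have hp k : 0 < x ^ k by apply: pow_lt; lra.
suff : \sum_(k <- iota 0%N n) (1 / x ^ k.+2) <= 2 * (1 / x ^ 2) - 2 * (1 / x ^ n.+2).
  have : 0 < 1 / x ^ n.+2 by apply: Rdiv_lt_0_compat => //; lra.
  lra.
elim: n => [|n IH]; first by rewrite big_nil; lra.
rewrite sum_iotaS; suff : 2 * (1 / x ^ n.+3) <= 1 / x ^ n.+2 by lra.
have -> : 1 / x ^ n.+2 = x * (1 / x ^ n.+3).
  by rewrite -[x ^ n.+3]/(x * x ^ n.+2); have := hp n.+2; move: (x ^ _) => t ht; field; lra.
have : 0 < 1 / x ^ n.+3 by apply: Rdiv_lt_0_compat => //; lra.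
nra.
Qed.

Lemma rn_prime_ge2 p : gprime p -> 2 <= rn p.
Proof.
move=> hp; have := gprime_norm hp; rewrite -gnE => h.
by rewrite -[2]/(INR 2); apply: INR_le; lia.
Qed.

Definition primes_in (n : nat) : seq gint := [seq p <- ball n | asb (gprime p)].

(* The weight vanishes off prime powers, so only exponents at least two occur. *)
Lemma sum_proper_powers n :
  \sum_(a <- ball n | [&& gn a != 1%N & ~~ asb (gprime a)])
     (1 / rn a * dsum (fun t => ln (INR n) - ln t) a) <= 256 * C0.
Proof.
pose F a := 1 / rn a * dsum (fun t => ln (INR n) - ln t) a.
(* A triple [(p, (u, k))] stands for [u p ^ (k + 2)]. Associates give several triples for the same
   element, which is harmless for an upper bound. *)
pose t := [seq (p, x) | p <- primes_in n, x <- [seq (u, k) | u <- gunits, k <- iota 0%N n]].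
pose phi (j : gint * (gint * nat)) := gmul (gpow j.1 j.2.2.+2) j.2.1.
have Fphi p u k : gprime p -> gunit u -> F (phi (p, (u, k))) = 4 * ln (rn p) * (1 / rn p ^ k.+2).
  move=> hp hu; rewrite /F /phi (dsum_ln_prime_pow _ _ hp hu) rnM rn_pow [in rn u]/rn.
  rewrite (proj1 (gn_unit u) hu) /=; have := rn_prime_ge2 hp; move: (pow_nonzero (rn p) k).
  by move=> h1 h2; field; split; [apply: h1; lra | lra].
have mem_t p u k : (p, (u, k)) \in t -> gprime p /\ gunit u.
  case/allpairsP => - [p' x'] []; cbn [fst snd]; rewrite mem_filter => /andP [/asbP hp _].
  case/allpairsP => - [u' k'] []; cbn [fst snd] => hu _ -> [-> -> _]; split=> //.
  by move: hu; rewrite mem_gunits => /eqP /gunitP.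
have hF0 : forall j, j \in t -> 0 <= F (phi j).
  move=> [p [u k]] /mem_t [hp hu]; rewrite Fphi //.
  have := rn_prime_ln hp; have := pow_lt (rn p) k.+2; have := rn_prime_ge2 hp => h1 h2 h3.
  apply: Rmult_le_pos; first lra. by apply: Rdiv_le_0_compat; [lra | apply: h2; lra].
rewrite (bigID (fun a => asb (F a = 0))) /=.
rewrite big1; last by move=> a /andP [_ /asbP].
rewrite Rplus_0_l -big_filter.
apply: Rle_trans (_ : \sum_(j <- t) F (phi j) <= _).
  apply: sum_le_image => //; first exact/filter_uniq/uniq_ball.
  move=> a; rewrite mem_filter => /andP [/andP [/andP [h1 /asbP h2] /asbP h3] ha].
  have ha0 := ball_neq0 ha.
  case: (dsum_ln_cases (ln (INR n)) ha0) => [hu|h0|[p [k [u [hp hu e]]]]].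
  - by case/negP: h1; apply/eqP/gn_unit.
  - by case: h3; rewrite /F h0; ring.
  case: k e => [|k] e.
    by case: h2; rewrite e gmulC /gpow /= gmulr1; apply: gprime_unit_mul.
  have hp2 := rn_prime_ge2 hp.
  have hpow : rn p ^ k.+2 <= INR n.
    have -> : rn p ^ k.+2 = rn a.
      by rewrite e rnM rn_pow (rn_unit hu) Rmult_1_r.
    by move: ha; rewrite mem_ball => /andP [_ /INR_le].
  exists (p, (u, k)) => //; apply: allpairs_f.
    rewrite mem_filter mem_ball (introT (asbP _) hp) /=; apply/andP; split.
      exact/gn_gt0/gprime_neq0.
    have : (INR (gn p) <= INR n).
      rewrite -/(rn p); apply: Rle_trans hpow; rewrite -{1}(pow_1 (rn p)); apply: Rle_pow; [lra | lia].
    by move/INR_leE; lia.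
  apply: allpairs_f; first by rewrite mem_gunits; apply/eqP/gunitP.
  rewrite mem_iota /= add0n.
  (* The range of [k] suffices since [k < 2 ^ (k + 2) <= N(p) ^ (k + 2) <= n]. *)
  have : (INR k < INR n).
    apply: Rlt_le_trans hpow.
    have : 2 ^ k.+2 <= rn p ^ k.+2 by apply: pow_incr; lra.
    have : INR k < 2 ^ k.+2.
      elim: (k) => [|j IHj]; first by rewrite /=; lra.
      rewrite INRS -[2 ^ j.+3]/(2 * 2 ^ j.+2); have : 1 <= 2 ^ j.+2 by apply: pow_R1_Rle; lra.
      lra.
    lra.
  by move/INR_ltE; lia.
rewrite big_allpairs.
(* The constant is [4 * 4 * 2 * 2]: four units, the weight [4 ln N(p)], the geometric series at most
   [2 / N(p) ^ 2], and [ln N(p) <= 2 * sqrt N(p)]. *)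
apply: Rle_trans (_ : \sum_(p <- primes_in n) (64 * (1 / (rn p * sqrt (rn p)))) <= _).
  apply: sum_le => p; rewrite mem_filter => /andP [/asbP hp _] _.
  rewrite big_allpairs.
  have hp0 := rn_prime_ln hp; have hp2 := rn_prime_ge2 hp.
  rewrite (eq_big_seq (fun=> 4 * ln (rn p) * \sum_(k <- iota 0%N n) (1 / rn p ^ k.+2))); last first.
    move=> u; rewrite mem_gunits => /eqP/gunitP hu.
    by rewrite -sum_Z; apply: eq_bigr => k _; apply: Fphi.
  rewrite sum_const -[INR (size gunits)]/(1 + 1 + 1 + 1).
  have hg := sum_geom n hp2; have hl := ln_le_sqrt (x := rn p) ltac:(lra).
  have hi : 0 < 1 / rn p ^ 2 by apply: Rdiv_lt_0_compat; [lra | apply: pow_lt; lra].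
  apply: Rle_trans (_ : 4 * (4 * (2 * sqrt (rn p)) * (2 * (1 / rn p ^ 2))) <= _).
    have := sqrt_pos (rn p); nra.
  have hs := sqrt_lt_R0 (rn p) ltac:(lra); have es := sqrt_sqrt (rn p) ltac:(lra).
  right; move: es hs; move: (sqrt (rn p)) => q <- hq; field; lra.
rewrite sum_Z; have : \sum_(p <- primes_in n) (1 / (rn p * sqrt (rn p))) <= 4 * C0.
  apply: Rle_trans (sum_ball_inv_x_sqrt n); apply: sum_le_subset.
  - exact/filter_uniq/uniq_ball.
  - by move=> p; rewrite mem_filter => /andP [].
  - move=> p /ball_neq0 /rn_gt0 hp; apply: Rdiv_le_0_compat; first lra.
    by apply: Rmult_lt_0_compat => //; apply: sqrt_lt_R0.
move=> h; apply: Rle_trans (Rmult_le_compat_l 64 _ _ _ h) _; lra.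
Qed.

Definition PM (n : nat) : R := \sum_(p <- ball n | asb (gprime p)) (ln (rn p) / rn p).

Lemma dsum_ln_ge0 L a : a <> g0 -> ~ gunit a -> 0 <= dsum (fun t => L - ln t) a.
Proof.
move=> ha hu; case: (dsum_ln_cases L ha) => [//|->|[p [k [u [hp hu' ->]]]]]; first lra.
by rewrite dsum_ln_prime_pow //; have := rn_prime_ln hp; lra.
Qed.

(** Of the total [32 ln n] the four units take [16 ln n] and higher prime powers a bounded amount.
    Each prime has weight [4 ln N(p)], so the remaining [16 ln n] is four times [PM n]. *)
Lemma mertens : exists B, 0 <= B /\ forall n, (0 < n)%N -> Rabs (PM n - 4 * ln (INR n)) <= B.
Proof.
have [B [hB h]] := sum_dsum_ln; have hC0 := C0_gt0.
exists (B + 64 * C0); split; first lra.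
move=> n hn; have := h n hn => {h}.
rewrite (bigID (fun a => gn a == 1%N)) /= (sum_units (c := 4 * ln (INR n))) //; last first.
  move=> u hu; rewrite dsum_unit // /rn (proj1 (gn_unit u) hu) -[INR 1]/1 ln_1; field.
rewrite (bigID (fun a => asb (gprime a))) /=.
have -> : \sum_(i <- ball n | (gn i != 1%N) && asb (gprime i)) (1 / rn i * dsum (fun t => ln (INR n) - ln t) i)
   = 4 * PM n.
  rewrite /PM -sum_Z big_mkcond [RHS]big_mkcond; apply: sum_eq => p /ball_neq0 /rn_gt0 hp0 _.
  case: asbP => hp; rewrite ?andbF //= andbT.
  have -> /= : gn p != 1%N by apply/eqP => /gn_unit; exact: gprime_not_unit.
  rewrite {2}(gprime_pow1 p) dsum_ln_prime_pow //; last exact: gunit1.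
  by field; lra.
have := sum_proper_powers n; set x := \sum_(_ <- _ | _) _ => hx.
have hx0 : 0 <= x.
  apply: sum_ge0 => a /ball_neq0 ha /andP [hu _]; apply: Rmult_le_pos.
    by apply: Rdiv_le_0_compat; [lra | exact: rn_gt0].
  by apply: dsum_ln_ge0 => // /gn_unit hu1; rewrite hu1 in hu.
by move/Rabs_le_between => hy; apply: Rabs_le; lra.
Qed.

(** * Upper bound for primes in squares *)

Lemma ln_sq_le_q4 y : 1 <= y -> ln y ^ 2 <= 64 * q4 y.
Proof.
move=> hy; have h0 := ln_ge0 hy; have hq := q4_ge1 hy.
have h : ln y <= 8 * sqrt (q4 y).
  have := ln_le_sqrt (x := q4 y) ltac:(lra); rewrite /q4 !ln_sqrt; try lra.
  by apply: sqrt_lt_R0; lra.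
have := sqrt_pos (q4 y); have := sqrt_sqrt (q4 y) ltac:(lra); nra.
Qed.

(** Since [ln^2 y] is at most [64 y^(1/4)], the terms are of order [(n / N(d))^(3/4)] and sum to
    [O(n)] with no logarithm, against a main term of the sieve of order [n ln n]. *)
Lemma sum_sieve_err n (e : gint -> R) C : (0 < n)%N -> 0 <= C ->
  (forall d, d \in ball n -> Rabs (e d) <= C * sqrt (INR n / rn d)) ->
  Rabs (\sum_(d <- ball n) (mu d * ln (INR n / rn d) ^ 2 * e d)) <= 256 * C0 * C * INR n.
Proof.
move=> hn hC he; have hn1 := INR_ge1 hn; have hq := q4_gt0 (x := INR n) ltac:(lra).
apply: Rle_trans (Rabs_sum _ _ _) _.
apply: Rle_trans (_ : \sum_(d <- ball n) (64 * C * q4 (INR n) ^ 3 * (1 / q4 (rn d) ^ 3)) <= _).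
  apply: sum_le => d hd _; have hd0 := rn_gt0 (ball_neq0 hd).
  have hy := ball_quot_ge1 hd; have h1 := he d hd; have h2 := ln_sq_le_q4 hy.
  rewrite 2!Rabs_mult (Rabs_right (_ ^ 2)); last by have := pow2_ge_0 (ln (INR n / rn d)); lra.
  apply: Rle_trans (_ : 1 * (64 * q4 (INR n / rn d)) * (C * sqrt (INR n / rn d)) <= _).
    apply: Rmult_le_compat; [|exact: Rabs_pos| |exact: h1].
      by apply: Rmult_le_pos; [exact: Rabs_pos | exact: pow2_ge_0].
    by apply: Rmult_le_compat => //; [exact: Rabs_pos | exact: pow2_ge_0 | exact: Rabs_mu].
  right; rewrite -q4_sq q4_div; [|lra|lra].
  by have := q4_gt0 hd0; move: (q4 (rn d)) => q hq0; field; lra.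
rewrite sum_Z; apply: Rle_trans (_ : 64 * C * q4 (INR n) ^ 3 * (4 * C0 * q4 (INR n)) <= _).
  apply: Rmult_le_compat_l; last exact: sum_ball_q4.
  by apply: Rmult_le_pos; [lra | apply: pow_le; lra].
by right; rewrite -{3}(q4_4 (x := INR n)) ?/=; [ring | lra].
Qed.

(** Zero is a multiple of everything but lies in no ball; leaving it out changes a count by at most
    1. *)
Lemma size_nonzero (s : seq gint) : uniq s ->
  INR (size s) - 1 <= INR (size [seq a <- s | a != g0]) <= INR (size s).
Proof.
move=> us; rewrite size_filter; have := count_predC (fun a => a == g0) s.
have := count_uniq_mem g0 us; rewrite -/(count _ s).
have -> : count (pred1 g0) s = count (fun a => a == g0) s by [].
have -> : count (fun a => a != g0) s = count (predC (fun a => a == g0)) s by [].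
move: (count _ s) (count (predC _) s) => x y hx <-; rewrite INRD.
have : INR x <= 1 by rewrite hx -[1]/(INR 1); apply: INR_le; case: (_ \in _).
by have := pos_INR x; lra.
Qed.

Lemma count_square_multiples g d c s n : g <> g0 -> d <> g0 ->
  (forall a, a \in gsquare c s -> (gn a <= n)%N) ->
  \sum_(a <- ball n | asb (gdvd d a) && (gmul g a \in gsquare c s)) 1 =
  INR (size [seq a <- gmults (gmul g d) (gsquare c s) | a != g0]).
Proof.
move=> hg hd hn; rewrite -big_filter sum_const Rmult_1_r; congr INR.
rewrite -(size_map (gmul g)); apply/perm_size/uniq_perm.
- rewrite map_inj_in_uniq; first exact/filter_uniq/uniq_ball.
  by move=> a b _ _; apply: gmulI.
- exact/filter_uniq/filter_uniq/uniq_gsquare.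
move=> a; rewrite !mem_filter; apply/mapP/and3P => [[b]|[/eqP ha /asbP [b eb] haQ]].
  rewrite mem_filter => /andP [/andP [/asbP h1 h2] h3] ->; split=> //.
    by apply/eqP; apply: gmul_neq0 => //; exact: ball_neq0 h3.
  by apply/asbP; apply: gdvd_mul2.
exists (gmul d b); last by rewrite gmulA.
have e : gmul g (gmul d b) = a by rewrite gmulA.
rewrite mem_filter e haQ andbT; apply/andP; split.
  by apply/asbP; exists b.
have ha2 : gmul d b <> g0 by move=> h; apply: ha; rewrite -e h gmul0.
rewrite mem_ball (proj1 (gn_gt0 _) ha2) /=; apply: leq_trans (hn a haQ).
by rewrite -e; apply: gn_dvd_le; [rewrite e | apply/gdvd_mull/gdvd_refl].
Qed.

(** A prime [p] has weight [4 ln p (2 L - ln p)], at least [4 L ln p], with logarithms of norms. The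
    weights total [32 L / cK] times the area over [N(g)], up to [O(n)]; dividing by [4 L] gives
    [8 / cK], twice the mean density [4 / cK] of primes. *)
Lemma sieve_square : exists C, 0 <= C /\ forall g c s n, g <> g0 -> (1 < n)%N ->
  (s * s <= n)%N -> (forall a, a \in gsquare c s -> (gn a <= n)%N) ->
  \sum_(p <- ball n | asb (gprime p) && (gmul g p \in gsquare c s)) ln (rn p) <=
  8 / cK * (INR s * INR s / rn g) + C * (INR n / ln (INR n)).
Proof.
have hc := cK_gt0; have hC0 := C0_gt0; have [B [hB hM]] := Mj_bounds.
(* Here 17 is [8 + 8] from [gmults_count] and 1 for the excluded zero. *)
exists ((B + 256 * C0 * 17) / 4); split; first lra.
move=> g c s n hg hn hs hQ; have hn1 : 1 < INR n by rewrite -[1]/(INR 1); apply: INR_lt.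
have hn0 : (0 < n)%N by lia.
have hL : 0 < ln (INR n) by rewrite -ln_1; apply: ln_increasing; lra.
have [_ _ /Rabs_le_between b2] := hM n hn0.
set L := ln (INR n) in hL b2 *.
have hg1 := rn_ge1 hg.
have hssn : INR s * INR s <= INR n by rewrite -INRM; apply: INR_le.
have hss : 0 <= INR s * INR s / rn g <= INR n.
  have := pos_INR s => hs0; split; first by apply: Rdiv_le_0_compat; nra.
  apply: (Rmult_le_reg_r (rn g)); first lra.
  have -> : INR s * INR s / rn g * rn g = INR s * INR s by field; lra.
  nra.
have hs1 : INR s <= sqrt (INR n).
  by rewrite -(sqrt_square (INR s)); [apply: sqrt_le_1_alt | exact: pos_INR].
pose D a := dsum (fun t => (L - ln t) ^ 2) a.
have hlow : 4 * L * \sum_(p <- ball n | asb (gprime p) && (gmul g p \in gsquare c s)) ln (rn p)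
    <= \sum_(a <- ball n | gmul g a \in gsquare c s) (1 * D a).
  have hln a : a \in ball n -> ln (rn a) <= L.
    move=> ha; apply: ln_le; first exact/rn_gt0/(ball_neq0 ha).
    by move: ha; rewrite mem_ball => /andP [_ /INR_le].
  have hD0 a : a \in ball n -> 0 <= 1 * D a.
    by move=> ha; rewrite Rmult_1_l; apply: dsum_ln2_ge0; [exact: ball_neq0 ha | exact: hln].
  rewrite -sum_Z; apply: Rle_trans (_ : \sum_(p <- ball n | asb (gprime p) && (gmul g p \in gsquare c s)) (1 * D p) <= _).
    apply: sum_le => p hp /andP [/asbP pp _]; rewrite /D dsum_ln2_prime //.
    by have := rn_prime_ln pp; have := hln p hp; nra.
  by apply: sum_le_pred => [a _ /andP []//|a ha _]; apply: hD0.
have heq : \sum_(a <- ball n | gmul g a \in gsquare c s) (1 * D a) =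
    INR s * INR s / rn g * Mj 2 n + \sum_(d <- ball n) (mu d * ln (INR n / rn d) ^ 2 *
       (INR (size [seq a <- gmults (gmul g d) (gsquare c s) | a != g0]) - INR s * INR s / rn (gmul g d))).
  transitivity (\sum_(a <- ball n | gmul g a \in gsquare c s)
      (1 * \sum_(d <- ball n | asb (gdvd d a)) (mu d * (L - ln (rn d)) ^ 2))).
    by apply: sum_eq => a ha _; rewrite /D (dsum_eq_ball _ ha).
  rewrite (exchange_dsum _ _ (fun d => (L - ln (rn d)) ^ 2)).
  rewrite -sum_Z -sum_add; apply: sum_eq => d hd _; have hd0 := rn_gt0 (ball_neq0 hd).
  rewrite count_square_multiples //; last exact: ball_neq0 hd.
  rewrite /L -ln_div //; last lra.
  by rewrite rnM; field; lra.
have herr : Rabs (\sum_(d <- ball n) (mu d * ln (INR n / rn d) ^ 2 *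
       (INR (size [seq a <- gmults (gmul g d) (gsquare c s) | a != g0]) - INR s * INR s / rn (gmul g d))))
     <= 256 * C0 * 17 * INR n.
  apply: sum_sieve_err => // [|d hd]; first lra.
  have hd0 := ball_neq0 hd; have hgd := gmul_neq0 hg hd0; have hd1 := rn_gt0 hd0.
  have /Rabs_le_between := gmults_count c s hgd.
  have := size_nonzero (filter_uniq (fun a => asb (gdvd (gmul g d) a)) (uniq_gsquare c s)).
  rewrite -/(gmults _ _); set x := INR (size _); set y := INR (size _) => h1 h2.
  have hy := ball_quot_ge1 hd; have hsy := sqrt_ge1 hy.
  have h3 : INR s / sqrt (rn (gmul g d)) <= sqrt (INR n / rn d).
    rewrite sqrt_div; [|lra|lra]; apply: Rmult_le_compat => //; first exact: pos_INR.
      by left; apply: Rinv_0_lt_compat; apply/sqrt_lt_R0/rn_gt0.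
    apply: Rinv_le_contravar; first exact: sqrt_lt_R0.
    by apply: sqrt_le_1_alt; rewrite rnM; nra.
  by apply: Rabs_le; lra.
move/Rabs_le_between: herr => herr; rewrite heq in hlow.
set T := \sum_(_ <- _ | _) _ in hlow *; set S := INR s * INR s / rn g in hlow hss *.
have h1 : S * Mj 2 n <= S * (32 / cK * L) + INR n * B by nra.
have h2 : 4 * L * T <= S * (32 / cK * L) + (B + 256 * C0 * 17) * INR n by lra.
apply: (Rmult_le_reg_l (4 * L)); first lra.
apply: Rle_trans h2 _; right; field; lra.
Qed.

(** * A prime-free disc in every window *)

Lemma Cmod_gtoC a : Cmod (gtoC a) = sqrt (rn a).
Proof.
rewrite /Cmod /rn INR_IZR_INZ gnE /gnorm /gtoC; cbn [fst snd].
by congr sqrt; rewrite plus_IZR !mult_IZR; ring.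
Qed.
Lemma gtoC_mul a b : gtoC (gmul a b) = Cmult (gtoC a) (gtoC b).
Proof.
rewrite /gtoC /gmul /Cmult; cbn [fst snd].
by rewrite minus_IZR plus_IZR !mult_IZR.
Qed.
Lemma Cmod_sq (w : C) : Cmod w * Cmod w = fst w * fst w + snd w * snd w.
Proof. rewrite /Cmod sqrt_sqrt; [ring | nra]. Qed.
Lemma rn_Cmod a : rn a = Cmod (gtoC a) * Cmod (gtoC a).
Proof. by rewrite Cmod_gtoC sqrt_sqrt // /rn; apply: pos_INR. Qed.

(** Convertible with [Cdist], but expressed by [Cmod] to inherit its triangle inequality and
    multiplicativity. *)
Definition Cdst (w v : C) : R := Cmod (Cminus w v).
Lemma Cdst_triangle u v w : Cdst u w <= Cdst u v + Cdst v w.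
Proof.
rewrite /Cdst; have -> : Cminus u w = Cplus (Cminus u v) (Cminus v w) by ring.
exact: Cmod_triangle.
Qed.
Lemma Cdst_sym u v : Cdst u v = Cdst v u.
Proof. by rewrite /Cdst -Cmod_opp; congr Cmod; ring. Qed.
Lemma Cmod_Cdst u v : Cmod u <= Cmod v + Cdst u v.
Proof.
have {1}-> : u = Cplus v (Cminus u v) by ring.
exact: Cmod_triangle.
Qed.
Lemma Cdst_refl (u : C) : Cdst u u = 0.
Proof. by rewrite /Cdst (_ : Cminus u u = RtoC 0) ?Cmod_0 //; ring. Qed.
Lemma Cdst_ge0 u v : 0 <= Cdst u v. Proof. exact: Cmod_ge_0. Qed.
Lemma Cdst_le (u v : C) r : 0 <= r ->
  (fst u - fst v) * (fst u - fst v) + (snd u - snd v) * (snd u - snd v) <= r * r -> Cdst u v <= r.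
Proof.
move=> hr h; apply: Rsqr_incr_0_var => //; rewrite /Rsqr /Cdst Cmod_sq; exact: h.
Qed.

(** * The mass of primes in a window of norms *)

Definition wmass (g : gint) (x z : nat) : R :=
  \sum_(p <- ball z | asb (gprime p) && (x < gn (gmul g p) <= z)%N) (ln (rn p) / rn p).

Lemma PM_quot g m z : g <> g0 -> (m <= z)%N ->
  \sum_(p <- ball z | asb (gprime p) && (gn (gmul g p) <= m)%N) (ln (rn p) / rn p) = PM (m %/ gn g).
Proof.
move=> hg hm; have hg1 := proj1 (gn_gt0 g) hg.
rewrite /PM -big_filter -[RHS]big_filter; apply/perm_big/uniq_perm;
  try exact/filter_uniq/uniq_ball.
move=> p; rewrite !mem_filter; case: (asb _) => //=.
rewrite !mem_ball leq_divRL // gnM; have := leq_pmull (gn p) hg1.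
by rewrite [(gn p * _)%N]mulnC; lia.
Qed.

Lemma wmassE g x z : g <> g0 -> (x <= z)%N -> wmass g x z = PM (z %/ gn g) - PM (x %/ gn g).
Proof.
move=> hg hx; rewrite -(PM_quot hg (leqnn z)) -(PM_quot hg hx).
rewrite [X in _ = X - _](bigID (fun p => (gn (gmul g p) <= x)%N)) /=.
rewrite /wmass; set A := \sum_(_ <- _ | _) _; set B := \sum_(_ <- _ | _) _.
have -> : B = \sum_(p <- ball z | asb (gprime p) && (gn (gmul g p) <= x)%N) (ln (rn p) / rn p).
  by apply: eq_bigl => p; case: (asb _) => //=; lia.
have -> : A = \sum_(p <- ball z | asb (gprime p) && (gn (gmul g p) <= z)%N && ~~ (gn (gmul g p) <= x)%N) (ln (rn p) / rn p).
  by apply: eq_bigl => p; case: (asb _) => //=; lia.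
ring.
Qed.

Lemma ln_quot g m : (0 < g)%N -> (g <= m)%N ->
  ln (INR m) - ln (INR g) - 1 <= ln (INR (m %/ g)) <= ln (INR m) - ln (INR g).
Proof.
move=> hg hm; have h1 := INR_ge1 hg; have h2 := INR_le hm.
have hq : (0 < m %/ g)%N by rewrite divn_gt0.
have hq1 := INR_ge1 hq.
have a1 := INR_le (leq_divM m g); have a2 := INR_lt (ltn_ceil m hg).
rewrite INRM in a1; rewrite INRM INRS in a2.
rewrite -ln_div; [|lra|lra].
set q := INR (m %/ g) in hq1 a1 a2 *.
have e : INR m / INR g * INR g = INR m by field; lra.
have hr0 : 0 < INR m / INR g by apply: Rdiv_lt_0_compat; lra.
have b1 : q <= INR m / INR g by apply: (Rmult_le_reg_r (INR g)); lra.
have b2 : INR m / INR g <= q + 1 by apply: (Rmult_le_reg_r (INR g)); lra.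
split; last by apply: ln_le; lra.
have := @ln_sub_bounds q (INR m / INR g) ltac:(lra) b1 => - [_ h].
apply: Rplus_le_reg_r (1 - ln q) _ _ _.
have : (INR m / INR g - q) / q <= 1.
  apply: (Rmult_le_reg_r q); first lra.
  have -> : (INR m / INR g - q) / q * q = INR m / INR g - q by field; lra.
  lra.
lra.
Qed.

(** The weight in [wmass] is that of [p] and not of [g p], so the main term is the same for all [g]:
    passing to [x / N(g)] and [z / N(g)] leaves the difference of logarithms unchanged. The two
    roundings cost at most 4. *)
Lemma wmass_bounds : exists B, 0 <= B /\ forall g x z, g <> g0 -> (gn g <= x)%N -> (x <= z)%N ->
  Rabs (wmass g x z - 4 * (ln (INR z) - ln (INR x))) <= B.
Proof.
have [B [hB hM]] := mertens; exists (2 * B + 4); split; first lra.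
move=> g x z hg hx hz; have hg1 := proj1 (gn_gt0 g) hg; rewrite wmassE //.
have /Rabs_le_between := hM (z %/ gn g) ltac:(rewrite divn_gt0; lia).
have /Rabs_le_between := hM (x %/ gn g) ltac:(rewrite divn_gt0; lia).
have := ln_quot hg1 hx; have := @ln_quot (gn g) z hg1 ltac:(lia).
by move=> *; apply: Rabs_le; lra.
Qed.

Lemma wmass_prime g x z : 0 < wmass g x z ->
  exists p, gprime p /\ (x < gn (gmul g p) <= z)%N.
Proof.
move=> h; apply: Classical_Prop.NNPP => hn; move: h; rewrite /wmass big1; first lra.
by move=> p /andP [/asbP h1 h2]; case: hn; exists p.
Qed.

Lemma prime_in_window : exists L, (1 < L)%N /\ forall g x, g <> g0 -> (gn g <= x)%N ->
  exists p, gprime p /\ (x < gn (gmul g p) <= L * x)%N.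
Proof.
have [B [hB hW]] := wmass_bounds.
(* With this choice [4 * ln L] exceeds the error [B] of the window mass. *)
pose L := (Z.to_nat (up (exp (B / 4 + 1)))).
have hL : exp (B / 4 + 1) < INR L.
  have [h _] := archimed (exp (B / 4 + 1)); rewrite INR_IZR_INZ Z2Nat.id //.
  by apply: le_IZR; have := exp_pos (B / 4 + 1); lra.
have hL1 : (1 < L)%N.
  apply: INR_ltE; apply: Rlt_trans hL; rewrite -[INR 1]/1; have := exp_ineq1_le (B / 4 + 1); lra.
exists L; split=> // g x hg hx.
have hg1 := proj1 (gn_gt0 g) hg.
apply: wmass_prime; have hz : (x <= L * x)%N by apply: leq_pmull; lia.
have /Rabs_le_between := hW g x (L * x)%N hg hx hz.
have hx1 : 1 <= INR x by apply: INR_ge1; lia.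
have hl : B / 4 + 1 < ln (INR L) by rewrite -(ln_exp (B / 4 + 1)); apply: ln_increasing => //; exact: exp_pos.
rewrite INRM ln_mult; [lra| |lra]. have := exp_pos (B / 4 + 1); lra.
Qed.

(** Rotation by a unit changes neither primality nor the norm. With both endpoints in one quadrant,
    a segment cannot pass close to the origin. *)
Lemma prime_in_window_grep L g x : (forall g x, g <> g0 -> (gn g <= x)%N ->
  exists p, gprime p /\ (x < gn (gmul g p) <= L * x)%N) -> g <> g0 -> (gn g <= x)%N ->
  exists p, [/\ gprime p, (x < gn (gmul g p) <= L * x)%N & grep (gmul g p)].
Proof.
move=> h hg hx; have [p [hp hw]] := h g x hg hx.
have [u hu hr] := grep_exists (gmul_neq0 hg (gprime_neq0 hp)).
exists (gmul u p); split; first exact: gprime_unit_mul.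
  by rewrite gmulCA gnM (proj1 (gn_unit u) hu) mul1n.
by rewrite gmulCA.
Qed.

Lemma first_change (P : nat -> Prop) n : P 0%N -> ~ P n -> exists k, [/\ (k < n)%N, P k & ~ P k.+1].
Proof.
elim: n => [//|n IH] h0 hn; case: (excluded_middle_informative (P n)) => h.
  by exists n.
by have [k [h1 h2 h3]] := IH h0 h; exists k; split=> //; lia.
Qed.

Definition separated (g b : gint) (k : R) : Prop := forall p q, gprime p -> gprime q ->
  k * Cmod (gtoC (gmul b q)) <= Cdst (gtoC (gmul g p)) (gtoC (gmul b q)).

(** Walk from a point of [g P] to one of [b P] in steps of at most [r * sqrt x]. Where nearness to
    [g P] is first seen to fail after one step, the new point is not near [b P] either: the two
    nearby points would be within three steps of each other, against separation. *)
Lemma prime_free_disc g b k L : g <> g0 -> b <> g0 -> 0 < k -> separated g b k ->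
  (forall g x, g <> g0 -> (gn g <= x)%N -> exists p, gprime p /\ (x < gn (gmul g p) <= L * x)%N) ->
  exists r, 0 < r <= 1 / 10 /\ forall x, (0 < x)%N -> (gn g <= x)%N -> (gn b <= x)%N ->
  exists w : C, [/\ 2 * INR x <= Cmod w * Cmod w, Cmod w * Cmod w <= 4 * INR L * INR x &
    forall p, gprime p -> r * sqrt (INR x) < Cdst w (gtoC (gmul g p)) /\
                          r * sqrt (INR x) < Cdst w (gtoC (gmul b p))].
Proof.
move=> hg hb hk hsep hL.
(* The bound [k / 4] makes three radii smaller than [k * sqrt x]; the bound [1 / 10] keeps points
   near the walk at modulus at least [sqrt x]. *)
pose r := Rmin (1 / 10) (k / 4).
have hr : 0 < r <= 1 / 10.
  by split; [apply: Rmin_glb_lt; lra | apply: Rmin_l].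
have hrk : r <= k / 4 by apply: Rmin_r.
exists r; split=> // x hx0 hgx hbx; have hx1 := INR_ge1 hx0.
set q := sqrt (INR x); have hq : 0 < q by apply: sqrt_lt_R0; lra.
have eq : q * q = INR x by apply: sqrt_sqrt; lra.
(* Norms above [4 x] at the ends leave at least [2 x] along the segment: the cross terms are
   nonnegative in the quadrant and [(1 - s)^2 + s^2 >= 1/2]. *)
have [p1 [hp1 w1 g1']] := @prime_in_window_grep L g (4 * x)%N hL hg ltac:(lia).
have [p2 [hp2 w2 g2']] := @prime_in_window_grep L b (4 * x)%N hL hb ltac:(lia).
set a := gtoC (gmul g p1); set c := gtoC (gmul b p2).
have bnd v : (4 * x < gn v <= L * (4 * x))%N -> 4 * INR x <= Cmod (gtoC v) * Cmod (gtoC v) <= 4 * INR L * INR x.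
  move=> /andP [h1 h2]; rewrite -rn_Cmod /rn; have := INR_le h2; have := INR_lt h1.
  rewrite !INRM -[INR 4]/(2 + 1 + 1) => h3 h4; split; lra.
have [a1 a2] := bnd _ w1; have [c1 c2] := bnd _ w2; rewrite -/a -/c in a1 a2 c1 c2.
have pos v : grep v -> 0 <= fst (gtoC v) /\ 0 <= snd (gtoC v).
  by rewrite /grep /gtoC => /andP [h1 h2]; split; apply: IZR_le; lia.
have [ax ay] := pos _ g1'; have [cx cy] := pos _ g2'; rewrite -/a -/c in ax ay cx cy.
pose D := Cdst c a.
pose n := (Z.to_nat (up (D / (r * q)))).+1.
have hrq : 0 < r * q by nra.
have hn : D <= INR n * (r * q).
  have [h _] := archimed (D / (r * q)).
  have : D / (r * q) <= INR n.
    rewrite /n INRS INR_IZR_INZ Z2Nat.id; first lra.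
    apply: le_IZR; have : 0 <= D / (r * q) by apply: Rdiv_le_0_compat => //; exact: Cdst_ge0.
    lra.
  move=> h2; have -> : D = D / (r * q) * (r * q) by field; lra.
  nra.
have hn1 : 1 <= INR n by apply: INR_ge1.
pose t j := INR j / INR n.
pose W j : C := (fst a + t j * (fst c - fst a), snd a + t j * (snd c - snd a)).
have step j : Cdst (W j.+1) (W j) <= r * q.
  apply: Rle_trans (_ : D / INR n <= _); last first.
    by apply: (Rmult_le_reg_r (INR n)); [lra | have -> : D / INR n * INR n = D by field; lra]; lra.
  have hD0 : 0 <= D by exact: Cdst_ge0.
  apply: Cdst_le; first by apply: Rdiv_le_0_compat; lra.
  rewrite /W /t INRS; cbn [fst snd].
  have -> : D / INR n * (D / INR n) = D * D / (INR n * INR n) by field; lra.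
  rewrite /D /Cdst Cmod_sq /Cminus /Cplus /Copp; cbn [fst snd].
  by right; field; lra.
have tb j : (j <= n)%N -> 0 <= t j <= 1.
  move=> /INR_le h; split; first by apply: Rdiv_le_0_compat; [exact: pos_INR | lra].
  by apply: (Rmult_le_reg_r (INR n)); [lra | rewrite /t; have -> : INR j / INR n * INR n = INR j by field; lra]; lra.
have wlow j : (j <= n)%N -> 2 * INR x <= Cmod (W j) * Cmod (W j) /\ Cmod (W j) * Cmod (W j) <= 4 * INR L * INR x.
  move=> /tb; rewrite Cmod_sq /W; cbn [fst snd]; move: (t j) => s hs.
  rewrite Cmod_sq in a1 a2; rewrite Cmod_sq in c1 c2.
  move: ax ay cx cy a1 a2 c1 c2; case: (a) (c) => [u1 u2] [v1 v2]; cbn [fst snd].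
  move=> ax ay cx cy a1 a2 c1 c2; split.
    have e1 : (u1 + s * (v1 - u1)) * (u1 + s * (v1 - u1)) =
       (1 - s) * (1 - s) * (u1 * u1) + s * s * (v1 * v1) + 2 * (s * (1 - s)) * (u1 * v1) by ring.
    have e2 : (u2 + s * (v2 - u2)) * (u2 + s * (v2 - u2)) =
       (1 - s) * (1 - s) * (u2 * u2) + s * s * (v2 * v2) + 2 * (s * (1 - s)) * (u2 * v2) by ring.
    have s1 : 0 <= s * (1 - s) by nra.
    have u1v1 : 0 <= u1 * v1 by nra.
    have u2v2 : 0 <= u2 * v2 by nra.
    have k1 : 0 <= s * (1 - s) * (u1 * v1) by nra.
    have k2 : 0 <= s * (1 - s) * (u2 * v2) by nra.
    have k3 : (1 - s) * (1 - s) * (4 * INR x) <= (1 - s) * (1 - s) * (u1 * u1 + u2 * u2) by apply: Rmult_le_compat_l; nra.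
    have k4 : s * s * (4 * INR x) <= s * s * (v1 * v1 + v2 * v2) by apply: Rmult_le_compat_l; nra.
    have k0 : 1 / 2 <= (1 - s) * (1 - s) + s * s by have := Rle_0_sqr (s - 1 / 2); rewrite /Rsqr; lra.
    have := Rmult_le_compat_r (4 * INR x) _ _ ltac:(lra) k0; lra.
  have f1 : (u1 + s * (v1 - u1)) * (u1 + s * (v1 - u1)) = (1 - s) * (u1 * u1) + s * (v1 * v1) - s * (1 - s) * ((u1 - v1) * (u1 - v1)) by ring.
  have f2 : (u2 + s * (v2 - u2)) * (u2 + s * (v2 - u2)) = (1 - s) * (u2 * u2) + s * (v2 * v2) - s * (1 - s) * ((u2 - v2) * (u2 - v2)) by ring.
  have s1 : 0 <= s * (1 - s) by nra.
  have k1 : 0 <= s * (1 - s) * ((u1 - v1) * (u1 - v1)) by apply: Rmult_le_pos => //; exact: Rle_0_sqr.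
  have k2 : 0 <= s * (1 - s) * ((u2 - v2) * (u2 - v2)) by apply: Rmult_le_pos => //; exact: Rle_0_sqr.
  have k3 : (1 - s) * (u1 * u1 + u2 * u2) <= (1 - s) * (4 * INR L * INR x) by apply: Rmult_le_compat_l; lra.
  have k4 : s * (v1 * v1 + v2 * v2) <= s * (4 * INR L * INR x) by apply: Rmult_le_compat_l; lra.
  lra.
pose near j := exists2 p, gprime p & Cdst (W j) (gtoC (gmul g p)) <= r * q.
have near0 : near 0%N.
  exists p1 => //; have -> : W 0%N = a by rewrite /W /t /Rdiv Rmult_0_l !Rmult_0_l !Rplus_0_r; case: (a).
  have -> : Cdst a (gtoC (gmul g p1)) = 0.
    exact: Cdst_refl.
  nra.
have hW n' : 2 * INR x <= Cmod (W n') * Cmod (W n') -> 7 / 5 * q <= Cmod (W n').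
  move=> h; have h0 := Cmod_ge_0 (W n'); apply: Rnot_lt_le => h2; nra.
have nearn : ~ near n.
  move=> [p hp]; have -> : W n = c.
    rewrite /W /t; have -> : INR n / INR n = 1 by field; lra.
    by rewrite [RHS]surjective_pairing; f_equal; ring.
  rewrite Cdst_sym => h; have := hsep p p2 hp hp2; rewrite -/c => h2.
  have hc0 := Cmod_ge_0 c; have hc : 2 * q <= Cmod c by apply: Rnot_lt_le => h3; nra.
  have : k * (2 * q) <= k * Cmod c by apply: Rmult_le_compat_l; lra.
  nra.
have [j [hj [p' hp' nj] nj1]] := first_change near0 nearn.
have [wl wu] := wlow j.+1 hj; exists (W j.+1); split=> // p hp; split.
  by apply: Rnot_le_lt => h; apply: nj1; exists p.
apply: Rnot_le_lt => h.
have h2 := hsep p' p hp' hp.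
have h3 := Cdst_triangle (gtoC (gmul g p')) (W j) (gtoC (gmul b p)).
have h4 := Cdst_triangle (W j) (W j.+1) (gtoC (gmul b p)).
have h5 := step j; rewrite Cdst_sym in h5; rewrite Cdst_sym in nj.
have h6 := Cmod_Cdst (W j.+1) (gtoC (gmul b p)).
have h7 := hW _ wl.
have : k * q <= k * Cmod (gtoC (gmul b p)) by apply: Rmult_le_compat_l; nra.
nra.
Qed.

(** * The deficit in a window *)

Lemma sum_partition (I J : eqType) (s : seq I) (t : seq J) (h : I -> J) (P : pred I) (F : I -> R) :
  uniq t -> (forall a, a \in s -> P a -> h a \in t) ->
  \sum_(a <- s | P a) F a = \sum_(i <- t) \sum_(a <- s | P a && (h a == i)) F a.
Proof.
move=> ut hst; rewrite (exchange_big_dep P) /=; last by move=> i a _ /andP [].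
rewrite big_seq_cond [RHS]big_seq_cond; apply: eq_bigr => a /andP [ha pa].
rewrite (eq_bigl (fun i => i == h a)); last by move=> i; rewrite pa eq_sym.
by rewrite -big_filter (filter_pred1_uniq ut) ?big_seq1 //; apply: hst.
Qed.

(** The label of the grid square of side [s] containing [a]; [corner] is the inverse operation. *)
Definition idx (s : nat) (a : gint) : gint := ((fst a / Z.of_nat s)%Z, (snd a / Z.of_nat s)%Z).
Definition corner (s : nat) (i : gint) : gint := ((Z.of_nat s * fst i)%Z, (Z.of_nat s * snd i)%Z).

Lemma mem_square_idx s i a : (0 < s)%N -> (a \in gsquare (corner s i) s) = (idx s a == i).
Proof.
move=> hs; rewrite mem_gsquare /corner /idx; case: a i => [x y] [u v]; cbn [fst snd].
have hx := Z.div_mod x (Z.of_nat s) ltac:(lia); have rx := Z.mod_pos_bound x (Z.of_nat s) ltac:(lia).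
have hy := Z.div_mod y (Z.of_nat s) ltac:(lia); have ry := Z.mod_pos_bound y (Z.of_nat s) ltac:(lia).
have key n q r w : (0 < n)%Z -> (0 <= r < n)%Z ->
    (n * w <= n * q + r < n * w + n)%Z <-> (q = w)%Z.
  move=> hn hr; split=> [h|->]; last lia.
  have : (n * (w - q) < n)%Z by lia.
  have : (n * (q - w) < n)%Z by lia.
  nia.
move: hx hy rx ry; set q1 := (x / _)%Z; set q2 := (y / _)%Z; move: (x mod _)%Z (y mod _)%Z => r1 r2 hx hy rx ry.
have k1 := key (Z.of_nat s) q1 r1 u ltac:(lia) rx; have k2 := key (Z.of_nat s) q2 r2 v ltac:(lia) ry.
apply/and4P/eqP => [[h1 h2 h3 h4]|[e1 e2]].
  by f_equal; [apply/k1; lia | apply/k2; lia].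
by move/k1: e1 => e1; move/k2: e2 => e2; split; lia.
Qed.

Lemma idx_close s a a' : (0 < s)%N -> idx s a = idx s a' -> Cdst (gtoC a) (gtoC a') <= 3 / 2 * INR s.
Proof.
move=> hs e; have hs1 := INR_ge1 hs.
have : a \in gsquare (corner s (idx s a)) s by rewrite mem_square_idx.
have : a' \in gsquare (corner s (idx s a)) s by rewrite e mem_square_idx.
rewrite !mem_gsquare => h1 h2.
have b1 : Rabs (fst (gtoC a) - fst (gtoC a')) <= INR s.
  by rewrite /gtoC; cbn [fst snd]; rewrite -minus_IZR -abs_IZR INR_IZR_INZ; apply: IZR_le; lia.
have b2 : Rabs (snd (gtoC a) - snd (gtoC a')) <= INR s.
  by rewrite /gtoC; cbn [fst snd]; rewrite -minus_IZR -abs_IZR INR_IZR_INZ; apply: IZR_le; lia.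
apply: Cdst_le; first lra.
by move/Rabs_le_between: b1 => b1; move/Rabs_le_between: b2 => b2; nra.
Qed.

Lemma Cmod_ge_sqrt x v : (x <= gn v)%N -> sqrt (INR x) <= Cmod (gtoC v).
Proof. by move=> h; rewrite Cmod_gtoC; apply: sqrt_le_1_alt; apply: INR_le. Qed.

(** Points of a square are at distance at most [3/2 * s], since [3/2] exceeds the root of 2, and
    this is at most [3 / (8 K)] times [sqrt x]. *)
Lemma idx_norm_close (K s x : nat) v a : (3 <= K)%N -> (0 < s)%N -> 4 * INR K * INR s <= sqrt (INR x) ->
  (x <= gn v)%N -> idx s v = idx s a ->
  rn a <= (1 + 1 / INR K) * rn v /\ rn v <= (1 + 1 / INR K) * rn a.
Proof.
move=> hK hs hsx hxv e; have hK3 := INR_le hK; rewrite -[INR 3]/(1 + 1 + 1) in hK3.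
have hd := idx_close hs e; have hd' := hd; rewrite Cdst_sym in hd'.
have h1 := Cmod_Cdst (gtoC a) (gtoC v); have h2 := Cmod_Cdst (gtoC v) (gtoC a).
have hv := Cmod_ge_sqrt hxv; have ha0 := Cmod_ge_0 (gtoC a).
have hs1 := INR_ge1 hs.
rewrite !rn_Cmod; move: h1 h2 hv ha0; move: (Cmod _) (Cmod (gtoC a)) => V A h1 h2 hv ha0.
set t := 1 / INR K; have ht : 0 < t <= 1 / 3.
  split; first by apply: Rdiv_lt_0_compat; lra.
  by apply: Rmult_le_compat_l; [lra | apply: Rinv_le_contravar; lra].
have hst : 3 / 2 * INR s <= 3 / 8 * t * V.
  have -> : 3 / 2 * INR s = 3 / 8 * t * (4 * INR K * INR s) by rewrite /t; field; lra.
  by apply: Rmult_le_compat_l; lra.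
have hV : 0 < V by have := sqrt_pos (INR x); nra.
split.
  have : A <= V * (1 + 3 / 8 * t) by lra.
  have : (1 + 3 / 8 * t) * (1 + 3 / 8 * t) <= 1 + t by nra.
  move=> k1 k2; have : A * A <= (V * (1 + 3 / 8 * t)) * (V * (1 + 3 / 8 * t)) by nra.
  have : V * V * ((1 + 3 / 8 * t) * (1 + 3 / 8 * t)) <= V * V * (1 + t) by apply: Rmult_le_compat_l; nra.
  lra.
have : V * (1 - 3 / 8 * t) <= A by lra.
have : 1 <= (1 + t) * ((1 - 3 / 8 * t) * (1 - 3 / 8 * t)) by nra.
have k0 : 0 <= V * (1 - 3 / 8 * t) by nra.
move=> k1 k2; have k3 : (V * (1 - 3 / 8 * t)) * (V * (1 - 3 / 8 * t)) <= A * A by apply: Rmult_le_compat.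
have k4 : V * V * 1 <= V * V * ((1 + t) * ((1 - 3 / 8 * t) * (1 - 3 / 8 * t))) by apply: Rmult_le_compat_l; nra.
have := Rmult_le_compat_l (1 + t) _ _ ltac:(lra) k3; lra.
Qed.

(** * The mass of primes in one grid square and in one window *)

Definition sieve_bound (Cs : R) : Prop := forall g c s n, g <> g0 -> (1 < n)%N ->
  (s * s <= n)%N -> (forall a, a \in gsquare c s -> (gn a <= n)%N) ->
  \sum_(p <- ball n | asb (gprime p) && (gmul g p \in gsquare c s)) ln (rn p) <=
  8 / cK * (INR s * INR s / rn g) + Cs * (INR n / ln (INR n)).

Lemma sum_ball_mono (P : pred gint) (F : gint -> R) m n : (m <= n)%N ->
  (forall a, a \in ball n -> P a -> 0 <= F a) ->
  \sum_(a <- ball m | P a) F a <= \sum_(a <- ball n | P a) F a.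
Proof.
move=> hmn hF; rewrite -big_filter -[X in _ <= X]big_filter; apply: sum_le_subset.
- exact/filter_uniq/uniq_ball.
- by move=> a; rewrite !mem_filter !mem_ball => /and3P [-> -> /=]; lia.
- by move=> a; rewrite mem_filter => /andP [h1 h2]; apply: hF.
Qed.

(** Restating the sieve bound through the sum of [1 / N(a)] over the same square lets the bounds of
    many squares be added without shape considerations. Norms are constant on a square up to
    [1 + 1 / K]; this is paid once for the primes and once for the area. *)
Lemma square_mass (Cs : R) K s x z u v : sieve_bound Cs -> 0 <= Cs ->
  (3 <= K)%N -> (0 < s)%N -> 4 * INR K * INR s <= sqrt (INR x) -> (0 < x)%N ->
  u <> g0 -> (x < gn v <= z)%N ->
  \sum_(p <- ball z | asb (gprime p) && (x < gn (gmul u p) <= z)%N && (idx s (gmul u p) == idx s v))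
     (ln (rn p) / rn p) <=
  8 / cK * (1 + 1 / INR K) ^ 2 * \sum_(a <- ball (2 * z) | idx s a == idx s v) (1 / rn a)
   + (1 + 1 / INR K) * rn u * Cs * (INR (2 * z) / ln (INR (2 * z)) / INR x).
Proof.
move=> hC hC0 hK hs hsx hx0 hu /andP [hxv hvz].
have hc := cK_gt0; have hK3 := INR_le hK; rewrite -[INR 3]/(1 + 1 + 1) in hK3.
set Y := (2 * z)%N; set eta := 1 / INR K; have het : 0 < eta <= 1.
  split; first by apply: Rdiv_lt_0_compat; lra.
  have := Rinv_le_contravar 1 (INR K) ltac:(lra) ltac:(lra); rewrite Rinv_1 /eta; lra.
have hu1 := rn_ge1 hu.
have hv0 : v <> g0 by apply/gn_gt0; lia.
have hv1 := rn_ge1 hv0.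
have hxr : INR x <= rn v by apply: INR_le; lia.
have hx1 := INR_ge1 hx0.
have cl a : idx s a = idx s v -> rn a <= (1 + eta) * rn v /\ rn v <= (1 + eta) * rn a.
  by move=> e; apply: (idx_norm_close hK hs hsx) => //; lia.
have inY a : idx s a = idx s v -> (0 < gn a <= Y)%N.
  move=> /cl [h1 h2]; apply/andP; split.
    by apply: INR_ltE; rewrite -[INR 0]/0 -/(rn a); nra.
  apply: INR_leE; rewrite -/(rn a) /Y INRM -[INR 2]/2.
  have : rn v <= INR z by apply: INR_le.
  nra.
have hY1 : (1 < Y)%N by rewrite /Y; lia.
have hlnY : 0 < ln (INR Y).
  by rewrite -ln_1; apply: ln_increasing; [lra | rewrite -[1]/(INR 1); apply: INR_lt].
have hssY : (s * s <= Y)%N.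
  have : INR s * INR s <= INR x.
    have hs1 := INR_ge1 hs; have e := sqrt_sqrt (INR x) ltac:(lra).
    rewrite -e; have : INR s <= sqrt (INR x) by nra.
    nra.
  rewrite -INRM => /INR_leE; rewrite /Y; lia.
have hth := hC u (corner s (idx s v)) s Y hu hY1 hssY
  (fun a h => proj2 (andP (inY a (eqP (etrans (esym (mem_square_idx (idx s v) a hs)) h))))).
set th := \sum_(_ <- _ | _) _ in hth.
(* On the square [1 / N(p) = N(u) / N(u p)] is at most [(1 + eta) * N(u) / N(v)]; the factor [N(u)]
   cancels the one in the sieve bound. *)
have hT : \sum_(p <- ball z | asb (gprime p) && (x < gn (gmul u p) <= z)%N && (idx s (gmul u p) == idx s v))
     (ln (rn p) / rn p) <= (1 + eta) * rn u / rn v * th.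
  rewrite /th -sum_Z.
  apply: Rle_trans (_ : \sum_(p <- ball z | asb (gprime p) && (gmul u p \in gsquare (corner s (idx s v)) s))
     ((1 + eta) * rn u / rn v * ln (rn p)) <= _).
    apply: Rle_trans (_ : \sum_(p <- ball z | asb (gprime p) && (x < gn (gmul u p) <= z)%N && (idx s (gmul u p) == idx s v))
     ((1 + eta) * rn u / rn v * ln (rn p)) <= _).
      apply: sum_le => p _ /andP [/andP [/asbP hp hw] /eqP e].
      have [_ h] := cl _ e; rewrite rnM in h; have hl := rn_prime_ln hp.
      have hp0 := rn_gt0 (gprime_neq0 hp).
      rewrite /Rdiv [ln _ * _]Rmult_comm; apply: Rmult_le_compat_r; first lra.
      apply: (Rmult_le_reg_r (rn p * rn v)); first nra.
      have -> : / rn p * (rn p * rn v) = rn v by field; lra.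
      have -> : (1 + eta) * rn u * / rn v * (rn p * rn v) = (1 + eta) * (rn u * rn p) by field; lra.
      exact: h.
    apply: sum_le_pred => [p _|p _ /andP [/asbP hp _]].
      by rewrite mem_square_idx // => /andP [/andP [-> _] ->].
    apply: Rmult_le_pos; last by left; apply: rn_prime_ln.
    by apply: Rdiv_le_0_compat; nra.
  apply: sum_ball_mono => [|p _ /andP [/asbP hp _]]; first by rewrite /Y; lia.
  apply: Rmult_le_pos; last by left; apply: rn_prime_ln.
  by apply: Rdiv_le_0_compat; nra.
have hsq : INR s * INR s / rn v <= (1 + eta) * \sum_(a <- ball Y | idx s a == idx s v) (1 / rn a).
  rewrite -sum_Z; apply: Rle_trans (_ : \sum_(a <- ball Y | idx s a == idx s v) (1 / rn v) <= _); last first.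
    apply: sum_le => a /ball_neq0 /rn_gt0 ha /eqP /cl [h _].
    apply: (Rmult_le_reg_r (rn a * rn v)); first nra.
    have -> : 1 / rn v * (rn a * rn v) = rn a by field; lra.
    have -> : (1 + eta) * (1 / rn a) * (rn a * rn v) = (1 + eta) * rn v by field; lra.
    exact: h.
  rewrite -big_filter.
  have hp : perm_eq [seq a <- ball Y | idx s a == idx s v] (gsquare (corner s (idx s v)) s).
    apply: uniq_perm; [exact/filter_uniq/uniq_ball | exact: uniq_gsquare |].
    move=> a; rewrite mem_filter mem_ball mem_square_idx //.
    by apply: andb_idr => /eqP /inY.
  rewrite (perm_big _ hp) sum_const size_gsquare INRM.
  by right; field; lra.
apply: Rle_trans hT _.
have hA : 0 <= (1 + eta) * rn u / rn v by apply: Rdiv_le_0_compat; nra.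
apply: Rle_trans (Rmult_le_compat_l _ _ _ hA hth) _.
have -> : (1 + eta) * rn u / rn v * (8 / cK * (INR s * INR s / rn u) + Cs * (INR Y / ln (INR Y))) =
   8 / cK * (1 + eta) * (INR s * INR s / rn v) + (1 + eta) * rn u * Cs * (INR Y / ln (INR Y) / rn v).
  by field; lra.
apply: Rplus_le_compat.
  have -> : 8 / cK * (1 + eta) ^ 2 * \sum_(a <- ball Y | idx s a == idx s v) (1 / rn a) =
    8 / cK * (1 + eta) * ((1 + eta) * \sum_(a <- ball Y | idx s a == idx s v) (1 / rn a)) by ring.
  apply: Rmult_le_compat_l => //; apply: Rmult_le_pos; last lra.
  by left; apply: Rdiv_lt_0_compat; lra.
apply: Rmult_le_compat_l; first by apply: Rmult_le_pos; nra.
apply: Rmult_le_compat_l; last by apply: Rinv_le_contravar; lra.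
by apply: Rdiv_le_0_compat => //; apply: pos_INR.
Qed.

Lemma H1_sub x y n : (x <= y)%N -> (y <= n)%N ->
  \sum_(a <- ball n | (x < gn a <= y)%N) (1 / rn a) = H1 y - H1 x.
Proof.
move=> hxy hyn; have e m : (m <= n)%N -> H1 m = \sum_(a <- ball n | (gn a <= m)%N) (1 / rn a).
  move=> hm; rewrite /H1 -[RHS]big_filter; apply/perm_big/uniq_perm.
  - exact: uniq_ball.
  - exact/filter_uniq/uniq_ball.
  - by move=> a; rewrite mem_filter !mem_ball; lia.
rewrite (e y hyn) (e x) ?(leq_trans hxy) //.
rewrite [X in _ = X - _](bigID (fun a => (gn a <= x)%N)) /=.
have -> : \sum_(a <- ball n | (gn a <= y)%N && (gn a <= x)%N) (1 / rn a) = \sum_(a <- ball n | (gn a <= x)%N) (1 / rn a).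
  by apply: eq_bigl => a; lia.
have -> : \sum_(a <- ball n | (gn a <= y)%N && ~~ (gn a <= x)%N) (1 / rn a) = \sum_(a <- ball n | (x < gn a <= y)%N) (1 / rn a).
  by apply: eq_bigl => a; lia.
ring.
Qed.

(** The disc of radius [r / 2 * sqrt x] contains a square whose side is the integer part of
    [r * sqrt x / 4], hence at least [r * sqrt x / 8], and each of its points weighs at least
    [1 / (16 L x)]. *)
Lemma disc_sum_ge (w : C) r L x n : 0 < r <= 1 / 10 -> (0 < x)%N -> (16 * L * x <= n)%N ->
  8 <= r * sqrt (INR x) -> 2 * INR x <= Cmod w * Cmod w -> Cmod w * Cmod w <= 4 * INR L * INR x ->
  r ^ 2 / (64 * (16 * INR L)) <=
  \sum_(a <- ball n | (x < gn a <= 16 * L * x)%N && asb (Cdst w (gtoC a) <= r / 2 * sqrt (INR x))) (1 / rn a).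
Proof.
move=> hr hx hn hrq hw1 hw2; have hx1 := INR_ge1 hx.
set q := sqrt (INR x) in hrq *; have hq : 0 < q by apply: sqrt_lt_R0; lra.
have eq : q * q = INR x by apply: sqrt_sqrt; lra.
have [s [hs1 hs2]] := nfloor_ex (r * q / 4) ltac:(lra).
pose c : gint := (up (fst w), up (snd w)).
have [u1 u2] := archimed (fst w); have [v1 v2] := archimed (snd w).
have hL : 0 < INR L.
  apply: Rnot_le_lt => h; have : 4 * INR L * INR x <= 0 by nra.
  lra.
have hd a : a \in gsquare c s -> Cdst w (gtoC a) <= r / 2 * q.
  rewrite mem_gsquare /c => /and4P []; cbn [fst snd].
  move=> /Z.leb_spec0 /IZR_le b1 /Z.ltb_spec0 b2 /Z.leb_spec0 /IZR_le b3 /Z.ltb_spec0 b4.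
  have {}b2 : IZR (fst a) + 1 <= IZR (up (fst w)) + INR s.
    by rewrite INR_IZR_INZ -!plus_IZR; apply: IZR_le; lia.
  have {}b4 : IZR (snd a) + 1 <= IZR (up (snd w)) + INR s.
    by rewrite INR_IZR_INZ -!plus_IZR; apply: IZR_le; lia.
  apply: Cdst_le; first nra.
  rewrite /gtoC; cbn [fst snd].
  have : 0 <= IZR (fst a) - fst w <= r * q / 4 by lra.
  have : 0 <= IZR (snd a) - snd w <= r * q / 4 by lra.
  move: (IZR (fst a)) (IZR (snd a)) => a1 a2 h1 h2.
  have k1 : (a1 - fst w) * (a1 - fst w) <= (r * q / 4) * (r * q / 4) by apply: Rmult_le_compat; lra.
  have k2 : (a2 - snd w) * (a2 - snd w) <= (r * q / 4) * (r * q / 4) by apply: Rmult_le_compat; lra.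
  have k3 : 0 <= (r * q) * (r * q) by exact: Rle_0_sqr.
  lra.
have hgn a : a \in gsquare c s -> (x < gn a <= 16 * L * x)%N.
  move=> /hd h; have h1 := Cmod_Cdst w (gtoC a); have h2 := Cmod_Cdst (gtoC a) w.
  rewrite Cdst_sym in h2; have hw0 := Cmod_ge_0 w; have ha0 := Cmod_ge_0 (gtoC a).
  have hqw : 7 / 5 * q <= Cmod w by apply: Rnot_lt_le => h3; nra.
  have hrq2 : r / 2 * q <= 1 / 20 * q by apply: Rmult_le_compat_r; lra.
  apply/andP; split.
    apply: INR_ltE; rewrite -/(rn a) rn_Cmod -eq; nra.
  apply: INR_leE; rewrite -/(rn a) rn_Cmod !INRM.
  have -> : INR 16 = 16 by rewrite INR_IZR_INZ.
  have h3 : Cmod (gtoC a) <= 21 / 20 * Cmod w by lra.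
  have h4 : Cmod (gtoC a) * Cmod (gtoC a) <= (21 / 20 * Cmod w) * (21 / 20 * Cmod w) by apply: Rmult_le_compat.
  nra.
rewrite -big_filter.
have hzL : 0 < 16 * INR L * INR x by nra.
apply: Rle_trans (_ : \sum_(a <- gsquare c s) (1 / (16 * INR L * INR x)) <= _).
  rewrite sum_const size_gsquare INRM.
  have h8 : r * q / 8 <= INR s by lra.
  have h9 : (r * q / 8) * (r * q / 8) <= INR s * INR s by apply: Rmult_le_compat; lra.
  have -> : r ^ 2 / (64 * (16 * INR L)) = (r * q / 8) * (r * q / 8) * (1 / (16 * INR L * INR x)).
    by rewrite -eq; field; lra.
  by apply: Rmult_le_compat_r => //; apply: Rdiv_le_0_compat; lra.
apply: Rle_trans (_ : \sum_(a <- gsquare c s) (1 / rn a) <= _).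
  apply: sum_le => a /hgn /andP [h1 h2] _; have := INR_le h2; have := INR_lt h1; rewrite -/(rn a) !INRM.
  have -> : INR 16 = 16 by rewrite INR_IZR_INZ.
  move=> h3 h4; apply: Rmult_le_compat_l; first lra.
  by apply: Rinv_le_contravar; lra.
apply: sum_le_subset; first exact: uniq_gsquare.
  move=> a ha; have h := hgn a ha; rewrite mem_filter h mem_ball /=.
  by rewrite (introT (asbP _) (hd a ha)) /=; lia.
move=> a; rewrite mem_filter => /andP [_ /ball_neq0 /rn_gt0 ha].
by apply: Rdiv_le_0_compat; lra.
Qed.

(** Only grid squares containing a point of [g P] or [b P] in the window are charged, and separation
    lets each be charged for one set alone. A charged square has a point outside the empty disc and
    diameter below [r / 2 * sqrt x], so it misses the concentric disc of half the radius, whose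
    harmonic mass is thereby saved. *)
Lemma window_upper g b k r L Cs K s m x : g <> g0 -> b <> g0 -> separated g b k ->
  sieve_bound Cs -> 0 <= Cs -> (0 < L)%N -> 0 < r <= 1 / 10 -> (3 <= K)%N ->
  3 / (8 * INR K) < k -> 3 / (8 * INR K) < r / 2 -> (0 < s)%N -> 4 * INR K * INR s <= sqrt (INR x) ->
  (0 < x)%N -> 8 <= r * sqrt (INR x) ->
  (forall a, a \in ball (2 * (16 * L * x)) -> idx s a \in zbox m) ->
  (exists w : C, [/\ 2 * INR x <= Cmod w * Cmod w, Cmod w * Cmod w <= 4 * INR L * INR x &
    forall p, gprime p -> r * sqrt (INR x) < Cdst w (gtoC (gmul g p)) /\
                          r * sqrt (INR x) < Cdst w (gtoC (gmul b p))]) ->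
  wmass g x (16 * L * x) + wmass b x (16 * L * x) <=
  8 / cK * (1 + 1 / INR K) ^ 2 *
    (H1 ((K.+1 * (16 * L * x)) %/ K) - H1 ((K * x) %/ K.+1) - r ^ 2 / (64 * (16 * INR L)))
  + INR (size (zbox m)) * ((1 + 1 / INR K) * (rn g + rn b) * Cs *
      (INR (2 * (16 * L * x)) / ln (INR (2 * (16 * L * x))) / INR x)).
Proof.
move=> hg hb hsep hC hC0 hL hr hK hKk hKr hs hsx hx hrq hm [w [w1 w2 w3]].
set z := (16 * L * x)%N in hm *.
have hxz : (x <= z)%N by rewrite /z; apply: leq_pmull; lia.
have hx1 := INR_ge1 hx; have hK3 := INR_le hK; rewrite -[INR 3]/(1 + 1 + 1) in hK3.
set q := sqrt (INR x) in hsx hrq w3 *; have hq : 0 < q by apply: sqrt_lt_R0; lra.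
have hc := cK_gt0.
set A := 8 / cK * (1 + 1 / INR K) ^ 2.
have hA : 0 <= A.
  apply: Rmult_le_pos; [by left; apply: Rdiv_lt_0_compat; lra | exact: pow2_ge_0].
set F := INR (2 * z) / ln (INR (2 * z)) / INR x.
have hz2 : 1 < INR (2 * z).
  by rewrite -[1]/(INR 1); apply: INR_lt; lia.
have hF : 0 <= F.
  apply: Rdiv_le_0_compat; last lra; apply: Rdiv_le_0_compat; first lra.
  by rewrite -ln_1; apply: ln_increasing; lra.
have hKi : 0 < 1 / INR K by apply: Rdiv_lt_0_compat; lra.
have hE u : u <> g0 -> 0 <= (1 + 1 / INR K) * rn u * Cs * F.
  by move/rn_ge1 => h; do 3?[apply: Rmult_le_pos => //]; lra.
have hs32 : 3 / 2 * INR s <= 3 / (8 * INR K) * q.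
  have -> : 3 / 2 * INR s = 3 / (8 * INR K) * (4 * INR K * INR s) by field; lra.
  by apply: Rmult_le_compat_l => //; left; apply: Rdiv_lt_0_compat; lra.
pose T u i := \sum_(p <- ball z | asb (gprime p) && (x < gn (gmul u p) <= z)%N && (idx s (gmul u p) == i))
     (ln (rn p) / rn p).
pose S i := \sum_(a <- ball (2 * z) | idx s a == i) (1 / rn a).
pose hits u i := exists p, [/\ gprime p, (x < gn (gmul u p) <= z)%N & idx s (gmul u p) = i].
pose hit i := hits g i \/ hits b i.
have hWT u : wmass u x z = \sum_(i <- zbox m) T u i.
  apply: sum_partition; first exact: uniq_zbox.
  by move=> p _ /andP [_ hw]; apply: hm; rewrite mem_ball; lia.
have T0 u i : ~ hits u i -> T u i = 0.
  move=> hn; rewrite /T big1 // => p /andP [/andP [/asbP h1 h2] /eqP h3].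
  by case: hn; exists p.
have T1 u i : u <> g0 -> hits u i -> T u i <= A * S i + (1 + 1 / INR K) * rn u * Cs * F.
  move=> hu [p [hp hw <-]]; exact: (square_mass hC hC0 hK hs hsx hx hu hw).
have S0 i : 0 <= S i.
  by apply: sum_ge0 => a /ball_neq0 /rn_gt0 ha _; apply: Rdiv_le_0_compat; lra.
(* The case of a square met by both sets is impossible: its diameter is less than [k * sqrt x]. *)
have hcell i : T g i + T b i <= A * (if asb (hit i) then S i else 0) +
    (1 + 1 / INR K) * (rn g + rn b) * Cs * F.
  have eg := hE g hg; have eb := hE b hb.
  case: (excluded_middle_informative (hits g i)) => h1;
  case: (excluded_middle_informative (hits b i)) => h2.
  - case: h1 => p [hp /andP [hw _] ei]; case: h2 => p' [hp' /andP [hw' _] ei'].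
    have h3 := hsep p p' hp hp'.
    have h4 : Cdst (gtoC (gmul g p)) (gtoC (gmul b p')) <= 3 / 2 * INR s.
      by apply: idx_close => //; rewrite ei ei'.
    have h5 := Cmod_ge_sqrt (ltnW hw'); rewrite -/q in h5.
    exfalso; have : 3 / (8 * INR K) * q < k * q by apply: Rmult_lt_compat_r.
    have : k * q <= k * Cmod (gtoC (gmul b p')).
      apply: Rmult_le_compat_l => //; apply: Rlt_le; apply: Rlt_trans hKk.
      by apply: Rdiv_lt_0_compat; lra.
    lra.
  - have := T1 g i hg h1; rewrite (T0 b i h2); case: asbP => [_|[]]; last by left.
    lra.
  - have := T1 b i hb h2; rewrite (T0 g i h1); case: asbP => [_|[]]; last by right.
    lra.
  - rewrite (T0 g i h1) (T0 b i h2); case: asbP => _; last by lra.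
    by have := Rmult_le_pos _ _ hA (S0 i); lra.
rewrite !hWT -sum_add.
apply: Rle_trans (_ : \sum_(i <- zbox m) (A * (if asb (hit i) then S i else 0) +
    (1 + 1 / INR K) * (rn g + rn b) * Cs * F) <= _).
  by apply: sum_le => i _ _; apply: hcell.
rewrite sum_add sum_const sum_Z; apply: Rplus_le_compat_r; apply: Rmult_le_compat_l => //.
have -> : \sum_(i <- zbox m) (if asb (hit i) then S i else 0) =
    \sum_(a <- ball (2 * z) | asb (hit (idx s a))) (1 / rn a).
  rewrite [RHS](sum_partition (t := zbox m) (h := idx s)); [|exact: uniq_zbox|by move=> a ha _; apply: hm].
  apply: eq_bigr => i _; case: asbP => h.
    by apply: eq_bigl => a; case: eqP => [->|_]; rewrite ?andbF // andbT; apply/esym/asbP.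
  by rewrite big1 // => a /andP [/asbP h1 /eqP h2]; case: h; rewrite -h2.
(* Charged squares may stick out of the window, but only by a factor [1 + 1 / K] in norm at either
   end. *)
set X1 := ((K * x) %/ K.+1)%N; set X2 := ((K.+1 * z) %/ K)%N.
pose V a := (X1 < gn a <= X2)%N.
pose G a := asb (Cdst w (gtoC a) <= r / 2 * q).
have hX2 : (X2 <= 2 * z)%N.
  by rewrite /X2 -(leq_pmul2r (m := K)); [apply: leq_trans (leq_divM _ _) _; nia | lia].
have hX1 : (X1 <= x)%N by have := leq_divM (K * x) K.+1; rewrite -/X1; nia.
have hzX2 : (z <= X2)%N by rewrite /X2 leq_divRL; [nia | lia].
have hVG a : asb (hit (idx s a)) -> V a && ~~ G a.
  have key u p : gprime p -> (x < gn (gmul u p) <= z)%N -> idx s (gmul u p) = idx s a ->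
      r * q < Cdst w (gtoC (gmul u p)) -> V a && ~~ G a.
    move=> hp /andP [hw1 hw2] e hwv.
    have [n1 n2] := idx_norm_close hK hs hsx (ltnW hw1) e.
    have {}n1 : INR K * rn a <= (INR K + 1) * rn (gmul u p).
      have -> : (INR K + 1) * rn (gmul u p) = INR K * ((1 + 1 / INR K) * rn (gmul u p)) by field; lra.
      by apply: Rmult_le_compat_l; lra.
    have {}n2 : INR K * rn (gmul u p) <= (INR K + 1) * rn a.
      have -> : (INR K + 1) * rn a = INR K * ((1 + 1 / INR K) * rn a) by field; lra.
      by apply: Rmult_le_compat_l; lra.
    have r1 := INR_lt hw1; have r2 := INR_le hw2; rewrite -/(rn (gmul u p)) in r1 r2.
    rewrite /V; apply/andP; split; first (apply/andP; split).
    - rewrite /X1 ltn_divLR //; apply: INR_ltE; rewrite !INRM INRS -/(rn a).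
      have : INR K * INR x < INR K * rn (gmul u p) by apply: Rmult_lt_compat_l; lra.
      lra.
    - rewrite /X2 leq_divRL; last lia.
      apply: INR_leE; rewrite (INRM (gn a)) (INRM K.+1) INRS -/(rn a).
      have : (INR K + 1) * rn (gmul u p) <= (INR K + 1) * INR z by apply: Rmult_le_compat_l; lra.
      lra.
    apply/asbP => hG; have h1 := idx_close hs (esym e).
    have h2 := Cdst_triangle w (gtoC a) (gtoC (gmul u p)).
    have : 3 / (8 * INR K) * q < r / 2 * q by apply: Rmult_lt_compat_r.
    lra.
  by move/asbP => [] [p [hp hw e]]; [apply: (key g p) | apply: (key b p)] => //; case: (w3 p hp).
have hdisc := @disc_sum_ge w r L x (2 * z)%N hr hx ltac:(rewrite -/z; lia) hrq w1 w2.
rewrite -/q -/z in hdisc.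
have hV : \sum_(a <- ball (2 * z) | V a) (1 / rn a) = H1 X2 - H1 X1.
  by apply: H1_sub => //; apply: leq_trans hX1 (leq_trans hxz hzX2).
have hpos a : a \in ball (2 * z) -> 0 <= 1 / rn a.
  by move=> /ball_neq0 /rn_gt0 ha; apply: Rdiv_le_0_compat; lra.
have p1 : \sum_(a <- ball (2 * z) | asb (hit (idx s a))) (1 / rn a) <=
    \sum_(a <- ball (2 * z) | V a && ~~ G a) (1 / rn a).
  by apply: sum_le_pred => [a _|a ha _]; [exact: hVG | exact: hpos].
have p2 : \sum_(a <- ball (2 * z) | (x < gn a <= z)%N && G a) (1 / rn a) <=
    \sum_(a <- ball (2 * z) | V a && G a) (1 / rn a).
  apply: sum_le_pred => [a _|a ha _]; last exact: hpos.
  by move=> /andP [h ->]; rewrite /V andbT; lia.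
apply: Rle_trans p1 _.
have e : \sum_(a <- ball (2 * z) | V a) (1 / rn a) =
    \sum_(a <- ball (2 * z) | V a && G a) (1 / rn a) + \sum_(a <- ball (2 * z) | V a && ~~ G a) (1 / rn a).
  exact: bigID.
have h := Rle_trans _ _ _ hdisc p2.
rewrite -hV e; lra.
Qed.

(** * Choice of the parameters *)

Lemma eventually_large (A : R) : exists X0, (0 < X0)%N /\ forall x, (X0 <= x)%N ->
  A <= sqrt (INR x) /\ A <= ln (INR x).
Proof.
pose a := Rabs A; have ha : A <= a by apply: Rle_abs.
have ha0 : 0 <= a by apply: Rabs_pos.
have he := exp_pos (2 * a); have [h _] := archimed (exp (2 * a)).
exists (Z.to_nat (up (exp (2 * a)))); split.
  have : (0 < up (exp (2 * a)))%Z by apply: lt_IZR; lra.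
  lia.
move=> x /INR_le; rewrite {1}INR_IZR_INZ Z2Nat.id; last by apply: le_IZR; lra.
move=> hx; have hx' : exp (2 * a) <= INR x by lra.
split.
  have h1 := exp_ineq1_le a.
  apply: Rle_trans (_ : sqrt (exp a * exp a) <= _).
    by rewrite sqrt_square; [lra | left; exact: exp_pos].
  by apply: sqrt_le_1_alt; rewrite -exp_plus; have -> : a + a = 2 * a by ring.
have : ln (exp (2 * a)) <= ln (INR x) by apply: ln_le.
rewrite ln_exp; lra.
Qed.

Lemma exists_nat_ge (y : R) : exists n : nat, y <= INR n.
Proof.
have [n [_ h]] := nfloor_ex (Rabs y) (Rabs_pos y).
by exists n.+1; rewrite INRS; have := Rle_abs y; lra.
Qed.

(** Of the [5 / K] in the logarithm, the upper end costs [1 / K] and the lower end [4 / K], which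
    includes the rounding of [K x / (K + 1)], small because [K <= x]. *)
Lemma H1_window_upper : exists C, 0 <= C /\ forall K x M, (4 <= K)%N -> (K <= x)%N -> (0 < M)%N ->
  H1 ((K.+1 * (M * x)) %/ K) - H1 ((K * x) %/ K.+1) <=
  cK * ln (INR M) + 5 * cK / INR K + C / sqrt (INR x).
Proof.
have hc := cK_gt0; have [C [g [hC h]]] := H1_asymp; exists (4 * C); split; first lra.
move=> K x M hK hx hM; have hK4 := INR_le hK; have hx4 := INR_le hx.
have e4 : INR 4 = 4 by rewrite INR_IZR_INZ. rewrite e4 in hK4.
have hM1 := INR_ge1 hM.
set z := (M * x)%N; set X2 := (_ %/ K)%N; set X1 := (_ %/ _)%N.
have a1 : INR X1 * (INR K + 1) <= INR K * INR x.
  by rewrite -INRS -!INRM; apply: INR_le; apply: leq_divM.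
have a2 : INR K * INR x < (INR X1 + 1) * (INR K + 1).
  by rewrite -!INRS -!INRM; apply: INR_lt; apply: ltn_ceil.
have b1 : INR X2 * INR K <= (INR K + 1) * INR z.
  by rewrite -INRS -!INRM; apply: INR_le; apply: leq_divM.
have b2 : INR z <= INR X2.
  by apply: INR_le; rewrite /X2 leq_divRL; [nia | lia].
have b3 : INR x <= INR z by apply: INR_le; apply: leq_pmull.
have ez : INR z = INR M * INR x by rewrite INRM.
set t := 1 / INR K; have ht : 0 < t <= 1 / 4.
  split; first by apply: Rdiv_lt_0_compat; lra.
  by apply: Rmult_le_compat_l; [lra | apply: Rinv_le_contravar; lra].
have hKt : INR K * t = 1 by rewrite /t; field; lra.
have c1 : INR x * (1 - 2 * t) <= INR X1.
  apply: (Rmult_le_reg_r (INR K + 1)); first lra.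
  have e : INR x * (1 - 2 * t) * (INR K + 1) = INR x * INR K + INR x - 2 * INR x * (INR K * t) - 2 * INR x * t by ring.
  rewrite e hKt; have : 0 <= INR x * t - 1.
    have : INR K * t <= INR x * t by apply: Rmult_le_compat_r; lra.
    lra.
  nra.
have c2 : INR X2 <= INR z * (1 + t).
  apply: (Rmult_le_reg_r (INR K)); first lra.
  have -> : INR z * (1 + t) * INR K = INR z * (INR K + INR K * t) by ring.
  rewrite hKt; lra.
have x1 : INR x / 4 <= INR X1 by nra.
have l2 : ln (INR X2) <= ln (INR M) + ln (INR x) + t.
  have : ln (INR X2) <= ln (INR z * (1 + t)) by apply: ln_le; lra.
  rewrite ln_mult; [|lra|lra]; rewrite ez ln_mult; [|lra|lra].
  by have := ln_le_sub1 (x := 1 + t) ltac:(lra); lra.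
have l1 : ln (INR x) - 4 * t <= ln (INR X1).
  have : ln (INR x * (1 - 2 * t)) <= ln (INR X1) by apply: ln_le; nra.
  rewrite ln_mult; [|lra|lra].
  have := @ln_sub_bounds (1 - 2 * t) 1 ltac:(lra) ltac:(lra); rewrite ln_1 => - [_ hl].
  have : (1 - (1 - 2 * t)) / (1 - 2 * t) <= 4 * t.
    apply: (Rmult_le_reg_r (1 - 2 * t)); first lra.
    have -> : (1 - (1 - 2 * t)) / (1 - 2 * t) * (1 - 2 * t) = 2 * t by field; lra.
    nra.
  lra.
have sq y : INR x / 4 <= y -> 1 / sqrt y <= 2 * (1 / sqrt (INR x)).
  move=> hy; have s0 : 0 < sqrt (INR x) by apply: sqrt_lt_R0; lra.
  have -> : 2 * (1 / sqrt (INR x)) = 1 / (sqrt (INR x) / 2) by field; lra.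
  apply: Rmult_le_compat_l; first lra; apply: Rinv_le_contravar; first lra.
  have -> : sqrt (INR x) / 2 = sqrt (INR x / 4).
    rewrite sqrt_div; [|lra|lra]; have -> : 4 = 2 * 2 by ring.
    by rewrite sqrt_square; lra.
  exact: sqrt_le_1_alt.
have hX1 : (0 < X1)%N by apply: INR_ltE; rewrite -[INR 0]/0; lra.
have hX2 : (0 < X2)%N by apply: INR_ltE; rewrite -[INR 0]/0; lra.
have /Rabs_le_between k1 := h X1 hX1; have /Rabs_le_between k2 := h X2 hX2.
have s1 := Rmult_le_compat_l C _ _ hC (sq _ x1).
have s2 := Rmult_le_compat_l C _ _ hC (sq (INR X2) ltac:(lra)).
have e5 : 5 * cK / INR K = cK * (5 * t) by rewrite /t; field; lra.
have e6 : 4 * C / sqrt (INR x) = C * (2 * (1 / sqrt (INR x))) + C * (2 * (1 / sqrt (INR x))).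
  by field; apply: Rgt_not_eq; apply: sqrt_lt_R0; lra.
rewrite e5 e6.
have : cK * (ln (INR X2) - ln (INR X1)) <= cK * (ln (INR M) + 5 * t) by apply: Rmult_le_compat_l; lra.
lra.
Qed.

(** The side must be small against [sqrt x] for norms to be nearly constant on squares, and yet
    comparable to it, so that the number of squares depends on [K] and [M] only. *)
Lemma square_side K x : (0 < K)%N -> 2 + 8 * INR K <= sqrt (INR x) ->
  exists s, [/\ (0 < s)%N, 4 * INR K * INR s <= sqrt (INR x) & sqrt (INR x) <= 8 * INR K * INR s].
Proof.
move=> hK hx; have hK1 := INR_ge1 hK.
have [t1 t2] := Nat_sqrt_bounds x; set q := sqrt (INR x) in hx t1 t2 *.
have h4 : (0 < 4 * K)%N by lia.
have e4 : INR (4 * K) = 4 * INR K by rewrite INRM; have -> : INR 4 = 4 by rewrite INR_IZR_INZ.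
exists (Nat.sqrt x %/ (4 * K))%N; set s := (_ %/ _)%N.
have a1 : INR s * (4 * INR K) <= INR (Nat.sqrt x).
  by rewrite -e4 -INRM; apply: INR_le; apply: leq_divM.
have a2 : INR (Nat.sqrt x) < (INR s + 1) * (4 * INR K).
  by rewrite -e4 -INRS -INRM; apply: INR_lt; apply: ltn_ceil.
have h : q <= 8 * INR K * INR s by nra.
split; [|lra|exact: h].
by apply: INR_ltE; rewrite -[INR 0]/0; nra.
Qed.

Lemma idx_cover K M s x a : (0 < s)%N -> sqrt (INR x) <= 8 * INR K * INR s -> (0 < M)%N ->
  a \in ball (2 * (M * x)) -> idx s a \in zbox (16 * K * M).+1.
Proof.
move=> hs hsx hM; rewrite mem_ball => /andP [_ ha].
have hM1 := INR_ge1 hM; have hs1 := INR_ge1 hs.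
have hq := sqrt_pos (INR x); have eq := sqrt_sqrt (INR x) (pos_INR x).
have key y : (y * y <= Z.of_nat (2 * (M * x)))%Z -> (Z.abs y <= Z.of_nat (16 * K * M) * Z.of_nat s)%Z.
  move=> /IZR_le; rewrite mult_IZR -INR_IZR_INZ !INRM -[INR 2]/2 => hy.
  apply: le_IZR; rewrite abs_IZR mult_IZR -!INR_IZR_INZ !INRM.
  have -> : INR 16 = 16 by rewrite INR_IZR_INZ.
  have h1 : 2 * INR M * sqrt (INR x) <= 16 * INR K * INR M * INR s by nra.
  apply: Rle_trans h1; apply: Rsqr_incr_0_var; last by nra.
  rewrite -Rsqr_abs /Rsqr; move: hy; rewrite -{1}eq; move: (sqrt (INR x)) hq => q hq hy.
  have : 0 <= q * q by nra.
  nra.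
have hn := gnE a; rewrite /gnorm in hn.
have k1 := key (fst a) ltac:(nia); have k2 := key (snd a) ltac:(nia).
have dv y n : (Z.abs y <= Z.of_nat n * Z.of_nat s)%Z -> (Z.abs (y / Z.of_nat s) <=? Z.of_nat n.+1)%Z.
  move=> hy; apply/Z.leb_spec0.
  have h1 := Z.div_mod y (Z.of_nat s) ltac:(lia); have h2 := Z.mod_pos_bound y (Z.of_nat s) ltac:(lia).
  move: h1 h2; set d := (y / _)%Z; set mo := (y mod _)%Z => h1 h2.
  have : (d <= Z.of_nat n)%Z by nia.
  have : (- Z.of_nat n - 1 <= d)%Z by nia.
  lia.
by rewrite mem_zbox !mem_zsym /idx; cbn [fst snd]; rewrite !dv.
Qed.

(** The empty disc has harmonic mass at least [G], worth [8 * G / cK] of prime mass. The grid, the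
    error of [H1] and the sieve errors are each allowed a quarter of this; the last quarter is the
    deficit. *)
Lemma window_deficit g b k L : g <> g0 -> b <> g0 -> 0 < k -> separated g b k -> (1 < L)%N ->
  (forall g x, g <> g0 -> (gn g <= x)%N -> exists p, gprime p /\ (x < gn (gmul g p) <= L * x)%N) ->
  exists d X0, [/\ 0 < d, (0 < X0)%N & forall x, (X0 <= x)%N ->
    wmass g x (16 * L * x) + wmass b x (16 * L * x) <= 8 * ln (INR (16 * L)) - d].
Proof.
move=> hg hb hk hsep hL hpr; have hc := cK_gt0.
have [r [hr hdisc]] := prime_free_disc hg hb hk hsep hpr.
have [Cs [hCs hsieve]] := sieve_square.
have [C [hC hH]] := H1_window_upper.
set M := (16 * L)%N; have hM : (0 < M)%N by rewrite /M; lia.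
have hM1 := INR_ge1 hM; have eM : INR M = 16 * INR L.
  by rewrite /M INRM; have -> : INR 16 = 16 by rewrite INR_IZR_INZ.
have hlM := ln_ge0 hM1.
pose G := r ^ 2 / (64 * (16 * INR L)).
have hG : 0 < G by apply: Rdiv_lt_0_compat; [nra | lra].
(* [W] bounds the harmonic mass to which the factor [(1 + 1 / K) ^ 2] applies, so that factor costs
   at most [3 * W / K]. *)
pose W := cK * ln (INR M) + 5 * cK + 1.
have hW : 0 <= W by rewrite /W; nra.
(* The terms [1 / k] and [1 / r] make squares smaller than the separation and than half the disc
   radius; the last term reduces the cost of the grid to [G / 4]. *)
have [K hK] := exists_nat_ge (4 + 1 / k + 1 / r + 4 * (5 * cK + 3 * W) / G).
have p1 : 0 < 1 / k by apply: Rdiv_lt_0_compat; lra.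
have p2 : 0 < 1 / r by apply: Rdiv_lt_0_compat; lra.
have p3 : 0 <= 4 * (5 * cK + 3 * W) / G by apply: Rdiv_le_0_compat; lra.
have hKr4 : 4 <= INR K by lra.
have hK4 : (4 <= K)%N.
  by apply: INR_leE; have -> : INR 4 = 4 by rewrite INR_IZR_INZ.
have inv_le y : 0 < y -> 1 / y <= INR K -> 3 / (8 * INR K) <= 3 / 8 * y.
  move=> hy h; apply: (Rmult_le_reg_r (8 * INR K)); first lra.
  have -> : 3 / (8 * INR K) * (8 * INR K) = 3 by field; lra.
  have : 1 / y * y <= INR K * y by apply: Rmult_le_compat_r; lra.
  have -> : 1 / y * y = 1 by field; lra.
  lra.
have hKk := inv_le k hk ltac:(lra); have hKr := inv_le r ltac:(lra) ltac:(lra).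
have hKG : (5 * cK + 3 * W) / INR K <= G / 4.
  apply: (Rmult_le_reg_r (INR K)); first lra.
  have -> : (5 * cK + 3 * W) / INR K * INR K = 5 * cK + 3 * W by field; lra.
  have : 4 * (5 * cK + 3 * W) / G * (G / 4) <= INR K * (G / 4) by apply: Rmult_le_compat_r; lra.
  have -> : 4 * (5 * cK + 3 * W) / G * (G / 4) = 5 * cK + 3 * W by field; lra.
  lra.
set m := (16 * K * M).+1.
pose E := INR (size (zbox m)) * (2 * (rn g + rn b) * Cs * (2 * INR M)).
have hg1 := rn_ge1 hg; have hb1 := rn_ge1 hb.
have hE : 0 <= E.
  apply: Rmult_le_pos; first exact: pos_INR.
  by apply: Rmult_le_pos; [apply: Rmult_le_pos => //; lra | lra].
(* In order, the summands give a positive side for the squares, enough points in the disc,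
   [C / sqrt x] at most 1 and at most [G / 4], and total sieve errors [E / ln x] at most
   [2 * G / cK]. *)
have [X0 [hX0 hlarge]] := eventually_large (2 + 8 * INR K + 8 / r + C + 4 * C / G + E * cK / (2 * G)).
have p4 : 0 < 8 / r by apply: Rdiv_lt_0_compat; lra.
have p5 : 0 <= 4 * C / G by apply: Rdiv_le_0_compat; lra.
have p6 : 0 <= E * cK / (2 * G) by apply: Rdiv_le_0_compat; nra.
exists (2 * G / cK), (X0 + K + gn g + gn b)%N; split; [by apply: Rdiv_lt_0_compat; lra | lia |].
move=> x hx; have [hq hln] := hlarge x ltac:(lia).
have hx0 : (0 < x)%N by lia.
have hx1 := INR_ge1 hx0.
have [s [hs1 hs2 hs3]] := @square_side K x ltac:(lia) ltac:(lra).
have hrq : 8 <= r * sqrt (INR x).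
  have : r * (8 / r) <= r * sqrt (INR x) by apply: Rmult_le_compat_l; lra.
  have -> : r * (8 / r) = 8 by field; lra.
  lra.
have := @window_upper g b k r L Cs K s m x hg hb hsep hsieve hCs ltac:(lia) hr ltac:(lia)
  ltac:(lra) ltac:(lra) hs1 hs2 hx0 hrq (fun a => @idx_cover K M s x a hs1 hs3 hM)
  (hdisc x hx0 ltac:(lia) ltac:(lia)).
have := hH K x M hK4 ltac:(lia) hM; rewrite -/M -/G.
set D := H1 _ - H1 _; set F := INR (2 * _) / _ / _; set q := sqrt (INR x) in hq *.
set Wt := wmass _ _ _ + _ => hD hW1.
have hCq : C / q <= 1 /\ C / q <= G / 4.
  split; apply: (Rmult_le_reg_r q); try lra; have -> : C / q * q = C by field; lra.
    lra.
  have : 4 * C / G * (G / 4) <= q * (G / 4) by apply: Rmult_le_compat_r; lra.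
  have -> : 4 * C / G * (G / 4) = C by field; lra.
  lra.
have hF : F <= 2 * INR M / ln (INR x).
  have hl0 : 0 < ln (INR x) by lra.
  have e2 : INR (2 * (M * x)) = 2 * INR M * INR x by rewrite !INRM -[INR 2]/2; ring.
  have hl : ln (INR x) <= ln (INR (2 * (M * x))) by apply: ln_le; [lra | rewrite e2; nra].
  rewrite /F e2 in hl *.
  have -> : 2 * INR M * INR x / ln (2 * INR M * INR x) / INR x = 2 * INR M * / ln (2 * INR M * INR x).
    by field; lra.
  by apply: Rmult_le_compat_l; [lra | apply: Rinv_le_contravar].
set t := 1 / INR K in hW1.
have ht : 0 < t <= 1 / 4.
  split; first by apply: Rdiv_lt_0_compat; lra.
  by apply: Rmult_le_compat_l; [lra | apply: Rinv_le_contravar; lra].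
have hlast : INR (size (zbox m)) * ((1 + t) * (rn g + rn b) * Cs * F) <= 2 * G / cK.
  apply: Rle_trans (_ : E / ln (INR x) <= _).
    rewrite /E; have -> : INR (size (zbox m)) * (2 * (rn g + rn b) * Cs * (2 * INR M)) / ln (INR x) =
      INR (size (zbox m)) * (2 * (rn g + rn b) * Cs * (2 * INR M / ln (INR x))) by field; lra.
    apply: Rmult_le_compat_l; first exact: pos_INR.
    have hu : 0 <= (rn g + rn b) * Cs by apply: Rmult_le_pos; lra.
    have hf0 : 0 <= 2 * INR M / ln (INR x) by apply: Rdiv_le_0_compat; lra.
    apply: Rle_trans (_ : (1 + t) * (rn g + rn b) * Cs * (2 * INR M / ln (INR x)) <= _).
      by apply: Rmult_le_compat_l => //; nra.
    by apply: Rmult_le_compat_r => //; nra.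
  apply: (Rmult_le_reg_r (ln (INR x))); first lra.
  have -> : E / ln (INR x) * ln (INR x) = E by field; lra.
  have : E * cK / (2 * G) * (2 * G / cK) <= ln (INR x) * (2 * G / cK).
    apply: Rmult_le_compat_r; last lra. by apply: Rdiv_le_0_compat; lra.
  have -> : E * cK / (2 * G) * (2 * G / cK) = E by field; lra.
  lra.
have h5 : 5 * cK / INR K = 5 * cK * t by rewrite /t; field; lra.
have h6 : (5 * cK + 3 * W) / INR K = 5 * cK * t + 3 * W * t by rewrite /t; field; lra.
rewrite h5 in hD; rewrite h6 in hKG.
have hmain : (1 + t) ^ 2 * (D - G) <= cK * ln (INR M) - G / 2.
  pose U := cK * ln (INR M) + 5 * cK * t + C / q - G.
  have hDU : D - G <= U by rewrite /U; lra.
  have hUW : U <= W by rewrite /U /W; nra.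
  have t1 : 1 <= (1 + t) ^ 2 <= 1 + 3 * t by nra.
  have s1 : (1 + t) ^ 2 * (D - G) <= (1 + t) ^ 2 * U by apply: Rmult_le_compat_l; lra.
  have s2 : ((1 + t) ^ 2 - 1) * U <= ((1 + t) ^ 2 - 1) * W by apply: Rmult_le_compat_l; lra.
  have s3 : ((1 + t) ^ 2 - 1) * W <= 3 * t * W by apply: Rmult_le_compat_r; lra.
  rewrite /U in s1 s2; lra.
have h8 : 8 / cK * (1 + t) ^ 2 * (D - G) <= 8 / cK * (cK * ln (INR M) - G / 2).
  rewrite Rmult_assoc; apply: Rmult_le_compat_l => //.
  by left; apply: Rdiv_lt_0_compat; lra.
have h9 : 8 / cK * (cK * ln (INR M) - G / 2) = 8 * ln (INR M) - 2 * (2 * G / cK) by field; lra.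
lra.
Qed.

(** Masses of consecutive windows add up exactly, so after [j] windows the deficits amount to
    [j * d], whereas Mertens on the whole range from [Y] to [M ^ j * Y] errs by at most [2 * B] for
    both sets together. *)
Lemma not_separated g b k : g <> g0 -> b <> g0 -> 0 < k -> ~ separated g b k.
Proof.
move=> hg hb hk hsep; have [L [hL hpr]] := prime_in_window.
have [d [X0 [hd hX0 hdef]]] := window_deficit hg hb hk hsep hL hpr.
have [B [hB hW]] := wmass_bounds.
set M := (16 * L)%N in hdef; have hM : (0 < M)%N by rewrite /M; lia.
have hM1 := INR_ge1 hM.
pose Y := (X0 + gn g + gn b)%N.
pose X j := (M ^ j * Y)%N.
have XS j : X j.+1 = (M * X j)%N by rewrite /X expnS mulnA.
have Xge j : (Y <= X j)%N by rewrite /X; apply: leq_pmull; rewrite expn_gt0 hM.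
have upper j : wmass g Y (X j) + wmass b Y (X j) <= INR j * (8 * ln (INR M) - d).
  elim: j => [|j IH].
    have -> : X 0%N = Y by rewrite /X expn0 mul1n.
    by rewrite !wmassE //= ; lra.
  have h := hdef (X j) ltac:(have := Xge j; rewrite /Y; lia); rewrite -XS in h.
  have hXj : (X j <= X j.+1)%N by rewrite XS; apply: leq_pmull.
  move: IH h; rewrite !wmassE // INRS; lra.
have lower j : 8 * (INR j * ln (INR M)) - 2 * B <= wmass g Y (X j) + wmass b Y (X j).
  have hY : 1 <= INR Y by apply: INR_ge1; rewrite /Y; lia.
  have /Rabs_le_between h1 := hW g Y (X j) hg ltac:(rewrite /Y; lia) (Xge j).
  have /Rabs_le_between h2 := hW b Y (X j) hb ltac:(rewrite /Y; lia) (Xge j).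
  have e : ln (INR (X j)) = INR j * ln (INR M) + ln (INR Y).
    elim: j {h1 h2} => [|j IH]; first by rewrite /X expn0 mul1n /=; ring.
    rewrite XS INRM ln_mult; [|lra|]; last by have := INR_le (Xge j); lra.
    by rewrite IH INRS; ring.
  by rewrite e in h1 h2; lra.
have [j hj] := exists_nat_ge (2 * B / d + 1).
have : (2 * B / d + 1) * d <= INR j * d by apply: Rmult_le_compat_r; lra.
have -> : (2 * B / d + 1) * d = 2 * B + d by field; lra.
have := upper j; have := lower j; lra.
Qed.

(** * Gaussian rationals and the conclusion *)

Lemma Cmult_Cdiv (a b : C) : 0 < Cmod b -> Cmult b (Cdiv a b) = a.
Proof.
move=> hb; have := Cmod_sq b; case: a b hb => [a1 a2] [b1 b2] hb; cbn [fst snd] => e.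
have hn : b1 * b1 + b2 * b2 <> 0 by rewrite -e; nra.
by rewrite /Cdiv /Cmult; cbn [fst snd]; f_equal; field.
Qed.

Lemma gaussian_rational_dense (z : C) eps : 0 < eps -> exists b g,
  [/\ b <> g0, g <> g0 & Cdst (Cdiv (gtoC b) (gtoC g)) z < eps].
Proof.
move=> he; have [n hn] := exists_nat_ge (3 / eps + 1).
have p : 0 < 3 / eps by apply: Rdiv_lt_0_compat; lra.
have hn0 : (0 < n)%N by apply: INR_ltE; rewrite -[INR 0]/0; lra.
pose u1 := up (INR n * fst z); pose u2 := up (INR n * snd z).
(* The numerator must be nonzero even when [z] is near 0; replacing 0 by 1 raises the rounding error
   from 1 to 2. *)
pose v1 := if (u1 =? 0)%Z then 1%Z else u1.
have hv1 : v1 <> 0%Z by rewrite /v1; case: Z.eqb_spec.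
have b1 : Rabs (IZR v1 - INR n * fst z) <= 2.
  have [h1 h2] := archimed (INR n * fst z); rewrite -/u1 in h1 h2; rewrite /v1.
  by case: Z.eqb_spec => h; apply: Rabs_le; [rewrite h in h1 h2 | ]; lra.
have b2 : Rabs (IZR u2 - INR n * snd z) <= 2.
  by have [h1 h2] := archimed (INR n * snd z); apply: Rabs_le; rewrite /u2; lra.
exists (v1, u2), (Z.of_nat n, 0%Z); split; [by case | by case; lia |].
(* Errors of at most 2 in each coordinate give a distance at most [2 * sqrt 2 / n], below
   [3 / n]. *)
set r := 3 / INR n; have hr : r < eps.
  apply: (Rmult_lt_reg_r (INR n)); first lra.
  have -> : r * INR n = 3 by rewrite /r; field; lra.
  have : (3 / eps + 1) * eps <= INR n * eps by apply: Rmult_le_compat_r; lra.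
  have -> : (3 / eps + 1) * eps = 3 + eps by field; lra.
  lra.
apply: Rle_lt_trans hr; have hr0 : 0 < r by apply: Rdiv_lt_0_compat; lra.
apply: Cdst_le; first lra.
rewrite /gtoC /Cdiv; cbn [fst snd]; rewrite -INR_IZR_INZ.
have -> : (IZR v1 * INR n + IZR u2 * 0) / (INR n * INR n + 0 * 0) - fst z = (IZR v1 - INR n * fst z) / INR n.
  by field; lra.
have -> : (IZR u2 * INR n - IZR v1 * 0) / (INR n * INR n + 0 * 0) - snd z = (IZR u2 - INR n * snd z) / INR n.
  by field; lra.
move/Rabs_le_between: b1 => b1; move/Rabs_le_between: b2 => b2.
move: b1 b2; move: (IZR v1 - _) (IZR u2 - _) => x y hx hy.
have -> : x / INR n * (x / INR n) + y / INR n * (y / INR n) = (x * x + y * y) * (/ INR n * / INR n) by field; lra.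
have -> : r * r = 9 * (/ INR n * / INR n) by rewrite /r; field; lra.
apply: Rmult_le_compat_r; last by nra.
by apply: Rmult_le_pos; left; apply: Rinv_0_lt_compat; lra.
Qed.

(* Density in C: every z and every eps > 0 admits a quotient of Gaussian
   primes within distance eps. *)
Theorem mainTheorem1 :
  forall (z : R * R) (eps : R), (0 < eps)%R ->
  exists g1 g2 : gint, gprime g1 /\ gprime g2 /\
    (Cdist (Cdiv (gtoC g1) (gtoC g2)) z < eps)%R.
Proof.
move=> z eps heps; apply: Classical_Prop.NNPP => hno.
have [b [g [hb hg hbg]]] := @gaussian_rational_dense z (eps / 2) ltac:(lra).
have mpos a : a <> g0 -> 0 < Cmod (gtoC a).
  by move/rn_gt0 => h; rewrite Cmod_gtoC; apply: sqrt_lt_R0.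
have hb0 := mpos b hb; have hg0 := mpos g hg.
(* Half of [eps] is used by the approximation of [z], so [p / q] stays at distance [eps / 2] from
   [b / g]. Multiplying by [|g| |q|] and comparing with [|b| |q|] gives this constant. *)
apply: (@not_separated g b (eps / 2 * Cmod (gtoC g) / Cmod (gtoC b))) => //.
  by apply: Rdiv_lt_0_compat => //; nra.
move=> p q hp hq; have hq0 := mpos q (gprime_neq0 hq).
have h1 : eps <= Cdst (Cdiv (gtoC p) (gtoC q)) z.
  by apply: Rnot_lt_le => h; apply: hno; exists p, q.
have h2 := Cdst_triangle (Cdiv (gtoC p) (gtoC q)) (Cdiv (gtoC b) (gtoC g)) z.
have e1 := Cmult_Cdiv (gtoC p) hq0; have e2 := Cmult_Cdiv (gtoC b) hg0.
have -> : Cdst (gtoC (gmul g p)) (gtoC (gmul b q)) =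
    Cmod (gtoC g) * Cmod (gtoC q) * Cdst (Cdiv (gtoC p) (gtoC q)) (Cdiv (gtoC b) (gtoC g)).
  rewrite /Cdst !gtoC_mul -{1}e1 -{1}e2 -!Cmod_mult; congr Cmod; ring.
rewrite gtoC_mul Cmod_mult.
have -> : eps / 2 * Cmod (gtoC g) / Cmod (gtoC b) * (Cmod (gtoC b) * Cmod (gtoC q)) =
  Cmod (gtoC g) * Cmod (gtoC q) * (eps / 2) by field; lra.
by apply: Rmult_le_compat_l; [nra | lra].
Qed.
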